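(* Let $\mathcal{G}_\delta$ be either the non-commutative polydisk or the non-commutative (column) ball in $d$ variables, and let $\phi\in\mathcal{S}(\mathcal{G}_\delta)$. Suppose $T \in \mathcal{I}_\delta\cap\mathbb{M}_n^d$ is a B-point of $\phi$. Then $$\eta(H) = \lim_{t \downarrow 0} \frac{\phi(T + t H) - \phi(T)}{t}$$ exists for all $H\in\mathbb{M}_n^d$ satisfying $T + tH \in \mathcal{G}_\delta$ for $t$ small and positive. Moreover $\eta$ is a holomorphic function of $H$, which is homogeneous of degree $1$.
   Context: $\mathbb{M}_n$ is the set of $n\times n$ complex matrices and $\mathbb{M}^{[d]} = \bigcup_{n\ge 1} \mathbb{M}_n^d$. For a matrix $\delta$ of non-commutative polynomials in $d$ variables, $\mathcal{G}_\delta=\bigcup_{n\ge1}\{x\in\mathbb{M}_n^d:\|\delta(x)\|<1\}$ (operator norm). The non-commutative polydisk is $\mathcal{G}_\delta$ for $\delta(x)$ the diagonal $d\times d$ matrix with entries $x^1,\dots,x^d$, i.e. $\{x\in\mathbb{M}^{[d]}:\max_{r}\|x^r\|<1\}$. The non-commutative column ball is $\mathcal{G}_\delta$ for $\delta(x)$ the column with entries $x^1,\dots,x^d$, i.e. $\{x:\|\sum_{r}x^{r*}x^r\|<1\}$. $\mathcal{B}_\delta$ is the topological boundary of $\mathcal{G}_\delta$ (in each $\mathbb{M}_n^d$), and $\mathcal{I}_\delta=\{x\in\mathcal{B}_\delta:\delta(x)\text{ is an isometry}\}$ (so for the polydisk each $T^r$ is unitary; for the column ball $\sum_r T^{r*}T^r=I$).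 An nc-function on $\mathcal{G}_\delta$ is a graded function $\phi$ ($x\in\mathbb{M}_n^d\Rightarrow\phi(x)\in\mathbb{M}_n$) with $\phi(x\oplus y)=\phi(x)\oplus\phi(y)$ and $\phi(s^{-1}xs)=s^{-1}\phi(x)s$ ($s\in\mathbb{M}_n$ invertible, acting componentwise) whenever the arguments on both sides lie in $\mathcal{G}_\delta$. $\mathcal{S}(\mathcal{G}_\delta)$ is the set of nc-functions $\phi$ on $\mathcal{G}_\delta$ with $\|\phi(x)\|<1$ for all $x\in\mathcal{G}_\delta$. $T\in\mathcal{B}_\delta\cap\mathbb{M}_n^d$ is a B-point for $\phi$ if $\lim_{j\to\infty}\frac{\|I-\phi(Z_j)^*\phi(Z_j)\|}{1-\|\delta(Z_j)\|^2}<\infty$ for some sequence $Z_j$ in $\mathcal{G}_\delta\cap\mathbb{M}_n^d$ converging to $T$. If $T$ is a B-point, $\phi(T)$ denotes the unique unitary matrix $W\in\mathbb{M}_n$ such that $\phi(Z_j)\to W$ for every sequence $Z_j\to T$ in $\mathcal{G}_\delta\cap\mathbb{M}_n^d$ along which $\frac{\|I-\phi(Z_j)^*\phi(Z_j)\|}{1-\|\delta(Z_j)\|^2}$ is bounded. Homogeneous of degree $1$ means $\eta(zH)=z\eta(H)$ for scalars $z$ whenever $H$ and $zH$ are both in the domain of $\eta$. *)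

(* Defs.v *)
From HB Require Import structures.
From mathcomp Require Import all_boot all_order all_algebra.
From mathcomp Require Import sesquilinear spectral.
From mathcomp Require Import all_classical all_reals all_analysis.
From mathcomp Require Import complex.

Set Implicit Arguments.
Unset Strict Implicit.
Unset Printing Implicit Defensive.
Import Order.TTheory GRing.Theory Num.Theory.
Import numFieldNormedType.Exports.

Local Open Scope classical_set_scope.
Local Open Scope ring_scope.
Local Open Scope complex_scope.
Local Open Scope sesquilinear_scope.

(* The usual topology of the complex plane (that of the modulus), with R[i] as
   a normed space over itself. *)
HB.instance Definition _ (R : realType) := NormedModule.copy R[i] R[i]^o.

Section nc_julia_caratheodory.
Context {R : realType}.
Local Notation C := R[i].

Definition l2norm n (v : 'cV[C]_n) : R :=
  Num.sqrt (\sum_i (Normc.normc (v i 0)) ^+ 2).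

Definition opnorm m n (A : 'M[C]_(m, n)) : R :=
  sup [set l2norm (A *m v) | v in [set v : 'cV[C]_n | l2norm v <= 1]].

Definition isometry m n (A : 'M[C]_(m, n)) : Prop :=
  forall v : 'cV[C]_n, l2norm (A *m v) = l2norm v.

(* A d-tuple x of n x n matrices is stored as the matrix with the blocks
   x^1, ..., x^d stacked on top of each other, so that its vector space
   structure and topology are those of the library; the r-th component is
   [submxcol x r] and a tuple is formed with [\mxcol_r]. *)
Definition mxtuple (d n : nat) := 'M[C]_(\sum_(r < d) n, n).

Section tuples.
Variable d : nat.

Definition tuple_dsum n m (x : mxtuple d n) (y : mxtuple d m) :
    mxtuple d (n + m) :=
  \mxcol_(r < d) block_mx (submxcol x r) 0 0 (submxcol y r).

Definition tuple_conj n (s : 'M[C]_n) (x : mxtuple d n) : mxtuple d n :=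
  \mxcol_(r < d) (invmx s *m submxcol x r *m s).

(* A non-commutative polynomial, as a finite list of pairs (coefficient, word
   in the variables); [::] is the zero polynomial. *)
Definition ncpoly := seq (C * seq 'I_d).

Definition ncpoly_var (r : 'I_d) : ncpoly := [:: (1, [:: r])].

Definition ncpoly_eval n (p : ncpoly) (x : mxtuple d n) : 'M[C]_n :=
  \sum_(m <- p) m.1 *: \prod_(r <- m.2) (submxcol x r : 'M[C]_n).

Record ncpolymx := NCPolyMx {
  nrows : nat;
  ncols : nat;
  ncentry : 'I_nrows -> 'I_ncols -> ncpoly }.

Definition ncmx_eval (delta : ncpolymx) n (x : mxtuple d n) :
    'M[C]_(\sum_(i < nrows delta) n, \sum_(j < ncols delta) n) :=
  \mxblock_(i < nrows delta, j < ncols delta) ncpoly_eval (ncentry i j) x.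

Definition polydisk : ncpolymx :=
  @NCPolyMx d d (fun i j => if i == j then ncpoly_var i else [::]).

Definition column_ball : ncpolymx :=
  @NCPolyMx d 1 (fun i _ => ncpoly_var i).

Variable delta : ncpolymx.

(* The level-n part of G_delta; there is no level 0. *)
Definition Gdom (n : nat) : set (mxtuple d n) :=
  [set x | (0 < n)%N /\ opnorm (ncmx_eval delta x) < 1].

Definition Bdry (n : nat) : set (mxtuple d n) :=
  closure (@Gdom n) `\` interior (@Gdom n).

Definition Ibdry (n : nat) : set (mxtuple d n) :=
  [set x | @Bdry n x /\ isometry (ncmx_eval delta x)].

(* Graded functions; only the values on G_delta matter. *)
Definition graded_fun := forall n : nat, mxtuple d n -> 'M[C]_n.

Definition nc_function (phi : graded_fun) : Prop :=
  (forall n m (x : mxtuple d n) (y : mxtuple d m),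
     Gdom x -> Gdom y -> Gdom (tuple_dsum x y) ->
     phi _ (tuple_dsum x y) = block_mx (phi _ x) 0 0 (phi _ y)) /\
  (forall n (s : 'M[C]_n) (x : mxtuple d n),
     s \in unitmx -> Gdom x -> Gdom (tuple_conj s x) ->
     phi _ (tuple_conj s x) = invmx s *m phi _ x *m s).

Definition schur_class (phi : graded_fun) : Prop :=
  nc_function phi /\
  (forall n (x : mxtuple d n), Gdom x -> opnorm (phi _ x) < 1).

Definition julia_quotient (phi : graded_fun) n (x : mxtuple d n) : R :=
  opnorm (1%:M - (phi _ x) ^t* *m phi _ x)
    / (1 - opnorm (ncmx_eval delta x) ^+ 2).

Definition approaches n (Z : nat -> mxtuple d n) (T : mxtuple d n) : Prop :=
  (forall j, Gdom (Z j)) /\ Z @ \oo --> T.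

Definition Bpoint (phi : graded_fun) n (T : mxtuple d n) : Prop :=
  Bdry T /\
  exists2 Z : nat -> mxtuple d n, approaches Z T &
    cvg ((fun j => julia_quotient phi (Z j)) @ \oo).

(* phi(T) for a B-point T (junk value 0 if there is no such unitary). *)
Definition boundary_value (phi : graded_fun) n (T : mxtuple d n) : 'M[C]_n :=
  xget 0 [set W : 'M[C]_n | W \is unitarymx /\
    forall Z : nat -> mxtuple d n, approaches Z T ->
      (exists M : R, forall j, julia_quotient phi (Z j) <= M) ->
      (fun j => phi n (Z j)) @ \oo --> W].

Definition directions n (T : mxtuple d n) : set (mxtuple d n) :=
  [set H | \forall t \near (0 : R)^'+, Gdom (T + t%:C *: H)].

End tuples.

(* [differentiable] is Frechet differentiability over the scalars C. *)
Definition holomorphic_on (V W : normedModType C) (U : set V) (f : V -> W) :=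
  open U /\ forall x, U x -> differentiable f x.

End nc_julia_caratheodory.

Arguments mxtuple R d n : clear implicits.
Arguments ncpolymx R d : clear implicits.
Arguments graded_fun R d : clear implicits.
Arguments polydisk R d : clear implicits.
Arguments column_ball R d : clear implicits.

(* Main.v *)
Require Import Defs.
From HB Require Import structures.
From mathcomp Require Import all_boot all_order all_algebra.
From mathcomp Require Import sesquilinear spectral.
From mathcomp Require Import all_classical all_reals all_analysis.
From mathcomp Require Import complex.
From mathcomp Require Import ring lra.

Set Implicit Arguments.
Unset Strict Implicit.
Unset Printing Implicit Defensive.
Import Order.TTheory GRing.Theory Num.Theory.
Import numFieldNormedType.Exports.

Local Open Scope classical_set_scope.
Local Open Scope ring_scope.
Local Open Scope complex_scope.

(** Let phi be in the Schur class, T a distinguished boundary point of the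
    polydisk or of the column ball and W = phi(T). With
    f_t(H) = (phi(T + t H) - W) / t, the claim is that f_t(H) converges as t
    decreases to 0, that the limit eta is holomorphic and that it is homogeneous.
    The argument uses no complex analysis and no realization formula: analyticity
    enters only through evaluations of phi at larger block matrices, where phi is
    still a contraction and still respects intertwinings, that is, x L = L y
    implies phi(x) L = L phi(y) ([schur_intertwine]).

    Pick inequality. Evaluating phi at the block upper triangular point with
    corners x, y and off-diagonal entry l (x - y) yields, for a scalar positive
    2 x 2 matrix P, the implication: if (I - x_i* x_j) P_ij is positive then so
    is (I - phi_i* phi_j) P_ij ([pick_transfer]).

    Boundedness. With x = T + t H and y running through the sequence that
    witnesses the B-point, this gives the Julia inequality
    |phi(T + t H) - W| <= C t ([julia_inequality]), locally uniformly in the open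
    convex cone of the directions H with Re T* H < 0. The same bound holds for the
    amplification of T by an identity matrix, hence for f_t at all matrix levels
    ([diff_quot_bounded]).

    Self-adjoint directions. If T* H is self-adjoint, the Pick inequality for
    T + s1 H and T + s2 H with s1 much smaller than s2 says that the real part of
    -W* f_s(H) is almost monotone in s, so that it converges, and that the
    imaginary part tends to 0 ([julia_caratheodory_sym]).

    All directions. On a complex line H + z K, evaluating f_t at H (x) 1 + K (x) B
    with B bidiagonal, of diagonal z_0, ..., z_N, shows that f_t at z_N differs
    from its Lagrange interpolation at z_0, ..., z_(N-1) by at most
    C prod |z_N - z_i|, uniformly in t ([newton_interp]). Convergence on a small
    segment therefore spreads to a disc ([vitali_step]), and a chain of discs
    leads from a self-adjoint direction to any given one ([dirderiv_exists]).

    The limit. The interpolation estimate passes to eta. Interpolating z eta(H)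
    along the same chain of discs gives eta(z H) = z eta(H)
    ([eta_homogeneous]). With three nodes the estimate bounds second divided
    differences; it makes difference quotients Cauchy, with a quadratic remainder,
    and gives additivity of the differential by comparison with a midpoint
    ([frechet_eta], [ddiffD]). *)

(** * The real inner product on complex columns *)

Section real_inner_product.
Context {R : realType}.
Local Notation C := R[i].
Local Open Scope sesquilinear_scope.

(** The inequalities below only involve real parts of inner products, so the
    complex columns are treated as a Euclidean space over the reals. *)
Definition rdot n (v w : 'cV[C]_n) : R :=
  \sum_i (complex.Re (v i 0) * complex.Re (w i 0) + complex.Im (v i 0) * complex.Im (w i 0)).

Definition nsq n (v : 'cV[C]_n) : R := rdot v v.

Lemma rdotC n (v w : 'cV[C]_n) : rdot v w = rdot w v.
Proof. by apply: eq_bigr => i _; ring. Qed.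

Lemma rdotDl n (u v w : 'cV[C]_n) : rdot (u + v) w = rdot u w + rdot v w.
Proof.
rewrite -big_split; apply: eq_bigr => i _; rewrite mxE.
by case: (u i 0) (v i 0) => a b [e f] /=; ring.
Qed.

Lemma rdotDr n (u v w : 'cV[C]_n) : rdot w (u + v) = rdot w u + rdot w v.
Proof. by rewrite ![rdot w _]rdotC rdotDl. Qed.

Lemma rdotZl n (a : R) (v w : 'cV[C]_n) : rdot (a%:C *: v) w = a * rdot v w.
Proof.
rewrite mulr_sumr; apply: eq_bigr => i _; rewrite mxE.
by case: (v i 0) => b e /=; ring.
Qed.

Lemma rdotZr n (a : R) (v w : 'cV[C]_n) : rdot v (a%:C *: w) = a * rdot v w.
Proof. by rewrite rdotC rdotZl rdotC. Qed.

Lemma rdotNl n (v w : 'cV[C]_n) : rdot (- v) w = - rdot v w.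
Proof. by rewrite -scaleN1r -[-1](rmorphN1 (real_complex R)) rdotZl mulN1r. Qed.

Lemma rdotNr n (v w : 'cV[C]_n) : rdot v (- w) = - rdot v w.
Proof. by rewrite rdotC rdotNl rdotC. Qed.

Lemma rdotBl n (u v w : 'cV[C]_n) : rdot (u - v) w = rdot u w - rdot v w.
Proof. by rewrite rdotDl rdotNl. Qed.

Lemma rdotBr n (u v w : 'cV[C]_n) : rdot w (u - v) = rdot w u - rdot w v.
Proof. by rewrite rdotDr rdotNr. Qed.

Lemma rdot0l n (v : 'cV[C]_n) : rdot 0 v = 0.
Proof. by rewrite -(subrr v) rdotBl subrr. Qed.

Lemma rdot0r n (v : 'cV[C]_n) : rdot v 0 = 0.
Proof. by rewrite rdotC rdot0l. Qed.

Lemma nsq_ge0 n (v : 'cV[C]_n) : 0 <= nsq v.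
Proof. by apply: sumr_ge0 => i _; rewrite -!expr2 addr_ge0 ?sqr_ge0. Qed.

Lemma nsq_eq0 n (v : 'cV[C]_n) : nsq v = 0 -> v = 0.
Proof.
move=> /eqP; rewrite psumr_eq0 => [/allP v0|i _]; last first.
  by rewrite -!expr2 addr_ge0 ?sqr_ge0.
apply/matrixP => i j; rewrite ord1 mxE {j}.
have := v0 i; rewrite mem_index_enum => /(_ isT); rewrite /= -!expr2.
rewrite paddr_eq0 ?sqr_ge0// !sqrf_eq0 => /andP[/eqP a /eqP b].
by rewrite [LHS]complexE a b /= rmorph0 mulr0 addr0.
Qed.

Lemma nsq0 n : nsq (0 : 'cV[C]_n) = 0.
Proof. exact: rdot0l. Qed.

Lemma nsqD n (v w : 'cV[C]_n) : nsq (v + w) = nsq v + 2 * rdot v w + nsq w.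
Proof. by rewrite /nsq !(rdotDl, rdotDr) (rdotC w v); ring. Qed.

Lemma nsqB n (v w : 'cV[C]_n) : nsq (v - w) = nsq v - 2 * rdot v w + nsq w.
Proof. by rewrite /nsq !(rdotBl, rdotBr) (rdotC w v); ring. Qed.

Lemma nsqN n (v : 'cV[C]_n) : nsq (- v) = nsq v.
Proof. by rewrite /nsq rdotNl rdotNr opprK. Qed.

Lemma nsqZ n (z : C) (v : 'cV[C]_n) : nsq (z *: v) = Normc.normc z ^+ 2 * nsq v.
Proof.
rewrite mulr_sumr; apply: eq_bigr => i _; rewrite mxE.
case: z (v i 0) => a b [e f] /=.
by rewrite sqr_sqrtr ?addr_ge0 ?sqr_ge0//; ring.
Qed.

Lemma nsqZR n (a : R) (v : 'cV[C]_n) : nsq (a%:C *: v) = a ^+ 2 * nsq v.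
Proof. by rewrite /nsq rdotZl rdotZr; ring. Qed.

Lemma rdot_CS n (v w : 'cV[C]_n) : rdot v w ^+ 2 <= nsq v * nsq w.
Proof.
have [->|w0] := eqVneq w 0; first by rewrite rdot0r nsq0 expr0n mulr0.
have wp : 0 < nsq w.
  by rewrite lt_neqAle nsq_ge0 andbT eq_sym; apply: contra_neq w0 => /nsq_eq0.
have := nsq_ge0 ((nsq w)%:C *: v - (rdot v w)%:C *: w).
rewrite nsqB !nsqZR rdotZl rdotZr.
have -> : nsq w ^+ 2 * nsq v - 2 * (nsq w * (rdot v w * rdot v w)) +
   rdot v w ^+ 2 * nsq w = nsq w * (nsq v * nsq w - rdot v w ^+ 2) by ring.
by rewrite pmulr_rge0// subr_ge0.
Qed.

Lemma l2normE n (v : 'cV[C]_n) : l2norm v = Num.sqrt (nsq v).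
Proof.
congr Num.sqrt; apply: eq_bigr => i _; case: (v i 0) => a b /=.
by rewrite sqr_sqrtr ?addr_ge0 ?sqr_ge0// !expr2.
Qed.

Lemma l2norm_ge0 n (v : 'cV[C]_n) : 0 <= l2norm v.
Proof. by rewrite l2normE sqrtr_ge0. Qed.

Lemma sqr_l2norm n (v : 'cV[C]_n) : l2norm v ^+ 2 = nsq v.
Proof. by rewrite l2normE sqr_sqrtr ?nsq_ge0. Qed.

Lemma l2norm_le n (v : 'cV[C]_n) k : 0 <= k -> (l2norm v <= k) = (nsq v <= k ^+ 2).
Proof. by move=> k0; rewrite -sqr_l2norm ler_sqr ?nnegrE ?l2norm_ge0. Qed.

Lemma rdot_le n (v w : 'cV[C]_n) : rdot v w <= l2norm v * l2norm w.
Proof.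
apply: le_trans (ler_norm _) _.
rewrite -ler_sqr ?nnegrE ?mulr_ge0 ?l2norm_ge0//.
by rewrite exprMn !sqr_l2norm real_normK ?num_real// rdot_CS.
Qed.

Lemma rdot_ge n (v w : 'cV[C]_n) : - (l2norm v * l2norm w) <= rdot v w.
Proof.
rewrite lerNl -rdotNl; apply: le_trans (rdot_le _ _) _.
by rewrite [l2norm (- v)]l2normE nsqN -l2normE.
Qed.

Lemma l2normD n (v w : 'cV[C]_n) : l2norm (v + w) <= l2norm v + l2norm w.
Proof.
rewrite l2norm_le ?addr_ge0 ?l2norm_ge0// nsqD -!sqr_l2norm.
by have := rdot_le v w; nra.
Qed.

Lemma l2normN n (v : 'cV[C]_n) : l2norm (- v) = l2norm v.
Proof. by rewrite !l2normE nsqN. Qed.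

Lemma l2normB n (v w : 'cV[C]_n) : l2norm (v - w) <= l2norm v + l2norm w.
Proof. by rewrite -(l2normN w); exact: l2normD. Qed.

Lemma normc_ge0 (z : C) : 0 <= Normc.normc z.
Proof. by case: z => a b /=; rewrite sqrtr_ge0. Qed.

Lemma normcR (a : R) : Normc.normc a%:C = `|a|.
Proof. by rewrite /= expr0n addr0 sqrtr_sqr. Qed.

Lemma l2normZ n (z : C) (v : 'cV[C]_n) : l2norm (z *: v) = Normc.normc z * l2norm v.
Proof.
rewrite !l2normE nsqZ sqrtrM ?sqr_ge0// sqrtr_sqr ger0_norm//.
exact: normc_ge0.
Qed.

Lemma l2norm0 n : l2norm (0 : 'cV[C]_n) = 0.
Proof. by rewrite l2normE nsq0 sqrtr0. Qed.

Lemma l2norm_sum n I (s : seq I) (P : pred I) (F : I -> 'cV[C]_n) :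
  l2norm (\sum_(i <- s | P i) F i) <= \sum_(i <- s | P i) l2norm (F i).
Proof.
elim/big_ind2: _ => [|x1 x2 y1 y2 h1 h2|//]; first by rewrite l2norm0.
by apply: le_trans (l2normD _ _) _; exact: lerD.
Qed.

Lemma rdot_complex n (v w : 'cV[C]_n) :
  rdot v w = complex.Re (\sum_i v i 0 * (w i 0)^*).
Proof.
rewrite (big_morph (@complex.Re R) (id1 := 0) (op1 := +%R)) //; last first.
  by move=> [a b] [e f].
by apply: eq_bigr => i _; case: (v i 0) (w i 0) => a b [e f] /=; ring.
Qed.

Lemma rdot_adj n m (A : 'M[C]_(m, n)) v w :
  rdot (A *m v) w = rdot v (A ^t* *m w).
Proof.
rewrite !rdot_complex; congr complex.Re.
under eq_bigr => i _ do rewrite mxE mulr_suml.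
rewrite exchange_big /=; apply: eq_bigr => i _.
rewrite mxE rmorph_sum mulr_sumr; apply: eq_bigr => j _.
rewrite !mxE rmorphM; set x := (X in _ = _ * (X * _)).
by have -> : x = A j i by [exact: conjcK]; ring.
Qed.

Lemma rdot_col_mx m n (v1 w1 : 'cV[C]_m) (v2 w2 : 'cV[C]_n) :
  rdot (col_mx v1 v2) (col_mx w1 w2) = rdot v1 w1 + rdot v2 w2.
Proof.
rewrite /rdot big_split_ord /=; congr +%R; apply: eq_bigr => i _.
  by rewrite !col_mxEu.
by rewrite !col_mxEd.
Qed.

Lemma nsq_col_mx m n (v : 'cV[C]_m) (w : 'cV[C]_n) :
  nsq (col_mx v w) = nsq v + nsq w.
Proof. exact: rdot_col_mx. Qed.

Lemma rdot_submxcol k (p : 'I_k -> nat) (v w : 'cV[C]_(\sum_i p i)) :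
  rdot v w = \sum_i rdot (submxcol v i) (submxcol w i).
Proof.
rewrite /rdot sig_big_dep (reindex _ tagnat.sig_bij_on)/=.
by apply: eq_bigr => j _; rewrite !mxE !tagnat.sig2K.
Qed.

End real_inner_product.

(** * Row balls of matrix tuples and the two-point Pick inequality *)

Section grouped_columns.
Context {R : realType}.
Local Notation C := R[i].
Variables (d : nat) (I : finType) (g : 'I_d -> I).

(** Both domains are handled at once by grouping the d coordinates: the norm of
    a tuple is the largest of the norms of the columns [gcol c x] formed by the
    coordinates of one group (the others are replaced by 0). The polydisk has one
    group for each coordinate, the column ball a single group. *)
Definition gcol c m (x : mxtuple R d m) : 'M[C]_(\sum_(r < d) m, m) :=
  \mxcol_(r < d) (if g r == c then submxcol x r else 0).

Lemma gcolD c m (x y : mxtuple R d m) : gcol c (x + y) = gcol c x + gcol c y.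
Proof.
apply/mxcolP => r; rewrite submxcolD !mxcolK submxcolD.
by case: ifP; rewrite ?addr0.
Qed.

Lemma gcolZ c m (z : C) (x : mxtuple R d m) : gcol c (z *: x) = z *: gcol c x.
Proof.
have subZ k (A : 'M[C]_(\sum_(i < d) m, k)) r :
    submxcol (z *: A) r = z *: submxcol A r by apply/matrixP => i j; rewrite !mxE.
apply/mxcolP => r; rewrite mxcolK !subZ mxcolK.
by case: ifP; rewrite ?scaler0.
Qed.

Lemma rdot_gcol c m (x y : mxtuple R d m) v w :
  rdot (gcol c x *m v) (gcol c y *m w) =
  \sum_(r | g r == c) rdot (submxcol x r *m v) (submxcol y r *m w).
Proof.
rewrite rdot_submxcol [RHS]big_mkcond; apply: eq_bigr => r _.
by rewrite -!submxcol_mul !mxcolK; case: ifP; rewrite // !mul0mx rdot0l.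
Qed.

Definition gball m (x : mxtuple R d m) : Prop := (0 < m)%N /\
  exists2 k : R, k < 1 & forall c v, nsq (gcol c x *m v) <= k * nsq v.

(** The quadratic form of the 2 x 2 block matrix with blocks a (I - A* A),
    I - A* B, I - B* A and b (I - B* B). *)
Definition pick_form m k (A B : 'M[C]_(m, k)) (a b : R) (v w : 'cV[C]_k) : R :=
  a * (nsq v - nsq (A *m v)) + 2 * (rdot v w - rdot (A *m v) (B *m w))
  + b * (nsq w - nsq (B *m w)).

(** The conjugate of the direct sum of x and y by a unipotent matrix. Its norm
    controls the difference x - y, which is where the noncommutative structure
    replaces the Schwarz lemma. *)
Definition pick_block m (l : C) (x y : mxtuple R d m) : mxtuple R d (m + m) :=
  \mxcol_(r < d) block_mx (submxcol x r) (l *: (submxcol x r - submxcol y r))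
                          0 (submxcol y r).

Lemma nsq_pick_block c m (l : R) (x y : mxtuple R d m) (v w : 'cV[C]_m) :
  nsq (gcol c (pick_block l%:C x y) *m col_mx (v - l%:C *: w) w) =
  nsq (gcol c x *m v - l%:C *: (gcol c y *m w)) + nsq (gcol c y *m w).
Proof.
rewrite nsqB nsqZR rdotZr /nsq !rdot_gcol !mulr_sumr -sumrB -!big_split /=.
apply: eq_bigr => r _; rewrite mxcolK mul_block_col mul0mx add0r rdot_col_mx.
congr (_ + _).
have -> : submxcol x r *m (v - l%:C *: w) +
    l%:C *: (submxcol x r - submxcol y r) *m w =
    submxcol x r *m v - l%:C *: (submxcol y r *m w).
  rewrite mulmxBr -scalemxAl mulmxBl -scalemxAr scalerBr.
  by rewrite addrA subrK.
by rewrite -[LHS]/(nsq _) nsqB nsqZR rdotZr.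
Qed.

Section contractive_nc.
Variable phi : graded_fun R d.
Hypothesis phi_int : forall m k (x : mxtuple R d m) (y : mxtuple R d k)
    (L : 'M[C]_(m, k)), gball x -> gball y ->
  (forall r, submxcol x r *m L = L *m submxcol y r) ->
  phi x *m L = L *m phi y.
Hypothesis phi_con : forall m (x : mxtuple R d m) v, gball x ->
  nsq (phi x *m v) <= nsq v.

(** The form with parameters a, b is, after a change of variables, the defect
    of the contractive block [pick_block l x y] with l^2 = 1 / (a b - 1); phi maps
    this block to the one built in the same way on phi(x) and phi(y), because the
    two columns that diagonalize it intertwine it with x and with y. *)
Lemma pick_transfer m (x y : mxtuple R d m) (a b e : R) :
    gball x -> gball y -> 0 < a -> 1 < a * b -> 0 < e ->
    (forall c v w,
       e * (nsq v + nsq w) <= pick_form (gcol c x) (gcol c y) a b v w) ->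
  forall v w, 0 <= pick_form (phi x) (phi y) a b v w.
Proof.
move=> Gx Gy a0 ab e0 H.
have ab0 : 0 < a * b - 1 by rewrite subr_gt0.
pose l := Num.sqrt (a * b - 1)^-1.
have l2 : l ^+ 2 = (a * b - 1)^-1 by rewrite sqr_sqrtr// invr_ge0 ltW.
have l0 : 0 < l by rewrite sqrtr_gt0 invr_gt0.
have abl : a * b * l ^+ 2 = l ^+ 2 + 1.
  by rewrite l2; field; rewrite gt_eqF.
(* the change of variable turning the block upper triangular norm into the form *)
have formE k p (A B : 'M[C]_(p, k)) v w :
    a * (nsq (v - l%:C *: w) + nsq w
        - (nsq (A *m v - l%:C *: (B *m w)) + nsq (B *m w)))
    = pick_form A B a b v (- (a * l)%:C *: w).
  rewrite /pick_form -rmorphN -scalemxAr !nsqB !nsqZR !rdotZr.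
  transitivity (a * (nsq v - nsq (A *m v)) - 2 * (a * l) *
      (rdot v w - rdot (A *m v) (B *m w))
      + a * (l ^+ 2 + 1) * (nsq w - nsq (B *m w))); first by ring.
  by rewrite -abl; ring.
set z := pick_block l%:C x y.
have Gz : gball z.
  split; first by rewrite addn_gt0; case: Gx => ->.
  pose e' := Num.min (e / (2 * a)) (e * a * l ^+ 2 / (2 * l ^+ 2 + 1)).
  have d0 : 0 < 2 * l ^+ 2 + 1 by rewrite ltr_wpDl// mulr_ge0// sqr_ge0.
  have e'0 : 0 < e'.
    by rewrite lt_min !divr_gt0 ?mulr_gt0// exprn_gt0.
  have e'1 : e' * (2 * a) <= e.
    by rewrite -ler_pdivlMr ?mulr_gt0// /e' ge_min lexx.
  have e'2 : e' * (2 * l ^+ 2 + 1) <= e * a * l ^+ 2.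
    by rewrite -ler_pdivlMr// /e' ge_min lexx orbT.
  exists (1 - e'); first by rewrite gtrBl.
  move=> c vw; rewrite -[vw]vsubmxK; set u := usubmx vw; set w := dsubmx vw.
  pose v := u + l%:C *: w; have -> : u = v - l%:C *: w by rewrite addrK.
  rewrite nsq_pick_block nsq_col_mx.
  rewrite -(ler_pM2l a0).
  have := formE _ _ (gcol c x) (gcol c y) v w.
  have := H c v (- (a * l)%:C *: w); rewrite -rmorphN nsqZR sqrrN.
  have : nsq (v - l%:C *: w) <= 2 * nsq v + 2 * l ^+ 2 * nsq w.
    have := nsq_ge0 (v + l%:C *: w); rewrite nsqD nsqB nsqZR; lra.
  set P := pick_form _ _ _ _ _ _ => h1 h2 h3.
  have nv := nsq_ge0 v; have nw := nsq_ge0 w.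
  have h4 : e' * (nsq (v - l%:C *: w) + nsq w) <= e' * (2 * nsq v + (2 * l ^+ 2 + 1) * nsq w).
    rewrite ler_pM2l//; lra.
  have h5 : e' * (2 * a) * nsq v <= e * nsq v by rewrite ler_wpM2r.
  have h6 : e' * (2 * l ^+ 2 + 1) * nsq w <= e * a * l ^+ 2 * nsq w.
    by rewrite ler_wpM2r.
  have h7 : a * (e' * (2 * l ^+ 2 + 1) * nsq w) <= a * (e * a * l ^+ 2 * nsq w).
    by rewrite ler_pM2l.
  have h8 : a * (e' * (nsq (v - l%:C *: w) + nsq w)) <=
     a * (e' * (2 * nsq v + (2 * l ^+ 2 + 1) * nsq w)) by rewrite ler_pM2l.
  lra.
have z1 : phi z *m col_mx 1%:M 0 = col_mx 1%:M 0 *m phi x.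
  apply: phi_int => // r; rewrite mxcolK mul_block_col mul_col_mx.
  by rewrite !mul0mx !mulmx0 !mulmx1 mul1mx !addr0.
have z2 : phi z *m col_mx (- l%:C)%:M 1%:M = col_mx (- l%:C)%:M 1%:M *m phi y.
  apply: phi_int => // r; rewrite mxcolK mul_block_col mul_col_mx.
  rewrite !mul0mx !mulmx1 mul1mx add0r mul_mx_scalar mul_scalar_mx.
  by congr col_mx; rewrite scalerBr scaleNr addKr scaleNr.
move=> v w.
pose w' := - ((a * l)^-1)%:C *: w.
have -> : w = - (a * l)%:C *: w'.
  rewrite /w' scalerA mulrNN -rmorphM divff ?rmorph1 ?scale1r//.
  by rewrite mulf_neq0// gt_eqF.
rewrite -formE pmulr_rge0// subr_ge0.
have := phi_con (col_mx (v - l%:C *: w') w') Gz.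
have -> : col_mx (v - l%:C *: w') w' =
   col_mx 1%:M 0 *m v + col_mx (- l%:C)%:M 1%:M *m w'.
  rewrite !mul_col_mx !mul1mx mul0mx mul_scalar_mx add_col_mx add0r.
  by rewrite scaleNr.
rewrite mulmxDr !mulmxA z1 z2 -!mulmxA !mul_col_mx !mul1mx !mul0mx.
by rewrite !mul_scalar_mx !add_col_mx !add0r !scaleNr !nsq_col_mx.
Qed.

End contractive_nc.
End grouped_columns.

(** * One-sided limits at zero *)

Section limits_at_zero.
Context {R : realType}.
Local Notation C := R[i].

Definition lim0 (r : R -> R) (l : R) : Prop := forall e, 0 < e ->
  exists2 D, 0 < D & forall s, 0 < s < D -> `|r s - l| <= e.

(** The limit is the lower limit: once r is close to it from above at some s2,
    almost monotonicity keeps r below any larger value at all smaller s1. *)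
Lemma almost_monotone_lim0 (r : R -> R) (M D0 : R) : 0 < D0 ->
    (forall s, 0 < s < D0 -> `|r s| <= M) ->
    (forall e, 0 < e -> exists2 D, 0 < D & forall s1 s2,
        0 < s2 < D -> 0 < s1 < D * s2 -> r s2 - e <= r s1) ->
  exists l, lim0 r l.
Proof.
move=> D00 rM mono.
pose E : set R := [set l | exists2 D, 0 < D & forall s, 0 < s < D -> l <= r s].
have E0 : E !=set0.
  exists (- M); exists D0 => // s /rM; exact: lerNnormlW.
have Eub : ubound E M.
  move=> l [D Dp lr].
  have h : 0 < Num.min D D0 / 2 by rewrite divr_gt0// lt_min Dp.
  have h2 : Num.min D D0 / 2 < Num.min D D0 by lra.
  apply: le_trans (lr (Num.min D D0 / 2) _) _.
    by rewrite h (lt_le_trans h2)// ge_min lexx.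
  apply: le_trans (ler_norm _) (rM (Num.min D D0 / 2) _).
  by rewrite h (lt_le_trans h2)// ge_min lexx orbT.
have supE : has_sup E by split => //; exists M.
exists (sup E) => e e0.
have [l [D1 D1p lr] hl] := sup_adherent e0 supE.
have e20 : 0 < e / 2 by lra.
have [D2 D2p mo] := mono _ e20.
exists (Num.min D1 D2); first by rewrite lt_min D1p.
move=> s; rewrite lt_min => /and3P[s0 s1 s2].
rewrite ler_distl; apply/andP; split.
  by apply: le_trans (lr s _); rewrite ?s0 ?s1// ltW.
suff : E (r s - e / 2) by move=> /(ub_le_sup (ex_intro _ M Eub)); lra.
exists (D2 * s); first by rewrite mulr_gt0.
by move=> s' hs'; apply: mo; rewrite ?s0.
Qed.

Lemma cauchy_lim0 (r : R -> R) :
    (forall e, 0 < e -> exists2 D, 0 < D & forall s s',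
        0 < s < D -> 0 < s' < D -> `|r s - r s'| <= e) ->
  exists l, lim0 r l.
Proof.
move=> cau; have [D Dp h] := cau _ ltr01.
apply: (@almost_monotone_lim0 _ (`|r (D / 2)| + 1) D) => //.
  move=> s sD; rewrite -lerBlDl; apply: le_trans (lerB_dist _ _) _.
  by apply: h => //; lra.
move=> e /cau[D' D'p h']; exists (Num.min D' 1); first by rewrite lt_min D'p/=.
move=> s1 s2; rewrite lt_min => /and3P[s20 s2D s21] /andP[s10 s12].
have m1 : Num.min D' 1 <= 1 by rewrite ge_min lexx orbT.
have : s1 < s2.
  by apply: lt_le_trans s12 _; rewrite ler_piMl// ltW.
move=> s1s2; have := h' s1 s2; rewrite s10 s20 s2D (lt_trans s1s2)// => /(_ isT isT).
by rewrite ler_distl => /andP[].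
Qed.

Lemma lim0_uniq (r : R -> R) (l l' : R) : lim0 r l -> lim0 r l' -> l = l'.
Proof.
move=> h h'; apply/eqP; rewrite -subr_eq0 -normr_eq0 -[_ == 0]negbK.
apply/negP => n0; have e0 : 0 < `|l - l'| / 4.
  by rewrite divr_gt0// lt_neqAle normr_ge0 eq_sym n0.
have [D Dp k] := h _ e0; have [D' D'p k'] := h' _ e0.
pose s := Num.min D D' / 2.
have sp : 0 < s by rewrite divr_gt0// lt_min Dp.
have s2 : s < Num.min D D' by rewrite /s in sp *; lra.
have := k s; have := k' s; rewrite sp !(lt_le_trans s2) ?ge_min ?lexx ?orbT//.
move=> /(_ isT) a /(_ isT) b.
have : `|l - l'| <= `|r s - l| + `|r s - l'|.
  by rewrite -[l - l'](subrKA (r s)) (distrC (r s) l) ler_normD.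
lra.
Qed.

Definition mxlim0 m k (F : R -> 'M[C]_(m, k)) (L : 'M[C]_(m, k)) : Prop :=
  forall e, 0 < e -> exists2 D, 0 < D &
    forall s, 0 < s < D -> forall v, l2norm ((F s - L) *m v) <= e * l2norm v.

Lemma normc_le_ReIm (z : C) : Normc.normc z <= `|complex.Re z| + `|complex.Im z|.
Proof.
case: z => a b /=; rewrite -ler_sqr ?nnegrE ?sqrtr_ge0 ?addr_ge0//.
rewrite sqr_sqrtr ?addr_ge0 ?sqr_ge0// sqrrD !real_normK ?num_real//.
by rewrite lerD2r lerDl mulrn_wge0// mulr_ge0.
Qed.

Lemma normc_le_l2norm m (v : 'cV[C]_m) i : Normc.normc (v i 0) <= l2norm v.
Proof.
rewrite -ler_sqr ?nnegrE ?l2norm_ge0 ?normc_ge0//.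
rewrite sqr_sqrtr; last by apply: sumr_ge0 => j _; exact: sqr_ge0.
by rewrite (bigD1 i)//= lerDl sumr_ge0// => j _; exact: sqr_ge0.
Qed.

Lemma l2norm_delta m (i : 'I_m) : l2norm (delta_mx i 0 : 'cV[C]_m) = 1.
Proof.
rewrite /l2norm (bigD1 i)//= mxE !eqxx /= big1 => [|j ji].
  by rewrite addr0 expr1n expr0n addr0 sqrtr1 expr1n sqrtr1.
by rewrite mxE (negbTE ji) /= expr0n addr0 sqrtr0 expr0n.
Qed.

Lemma l2norm_mulmx_le m k (A : 'M[C]_(m, k)) v :
  l2norm (A *m v) <= (\sum_j \sum_i Normc.normc (A i j)) * l2norm v.
Proof.
have -> : A *m v = \sum_j \sum_i (A i j * v j 0) *: delta_mx i 0.
  apply/colP => i; rewrite !mxE summxE; apply: eq_bigr => j _.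
  rewrite summxE (bigD1 i)//= !mxE !eqxx mulr1 big1 ?addr0// => i' ne.
  by rewrite !mxE eq_sym (negbTE ne) mulr0.
apply: le_trans (l2norm_sum _ _ _) _; rewrite mulr_suml; apply: ler_sum => j _.
apply: le_trans (l2norm_sum _ _ _) _; rewrite mulr_suml; apply: ler_sum => i _.
rewrite l2normZ l2norm_delta mulr1 Normc.normcM ler_wpM2l ?normc_ge0//.
exact: normc_le_l2norm.
Qed.

Lemma rdot_delta_Re m (v : 'cV[C]_m) i : rdot v (delta_mx i 0) = complex.Re (v i 0).
Proof.
rewrite /rdot (bigD1 i)//= mxE !eqxx /= mulr1 mulr0 addr0 big1 ?addr0// => j ji.
by rewrite mxE (negbTE ji) /= !mulr0 addr0.
Qed.

Lemma rdot_delta_Im m (v : 'cV[C]_m) i :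
  rdot v ('i%C *: delta_mx i 0) = complex.Im (v i 0).
Proof.
rewrite /rdot (bigD1 i)//= !mxE !eqxx /= big1 => [|j ji]; first by ring.
by rewrite !mxE (negbTE ji) /= ; ring.
Qed.

(** In finite dimension convergence of all matrix coefficients is convergence
    in norm; entries are recovered from real inner products with e_i and i e_i. *)
Lemma weak_lim0 m k (F : R -> 'M[C]_(m, k)) :
    (forall v w, exists l, lim0 (fun s => rdot (F s *m v) w) l) ->
  exists L, mxlim0 F L.
Proof.
move=> H.
have ReE (A : 'M[C]_(m, k)) (i : 'I_m) (j : 'I_k) :
    complex.Re (A i j) = rdot (A *m delta_mx j 0) (delta_mx i 0) :> R.
  by rewrite rdot_delta_Re -colE mxE.
have ImE (A : 'M[C]_(m, k)) (i : 'I_m) (j : 'I_k) :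
    complex.Im (A i j) = rdot (A *m delta_mx j 0) ('i%C *: delta_mx i 0) :> R.
  by rewrite rdot_delta_Im -colE mxE.
have /choice[La hLa] (ij : 'I_m * 'I_k) : exists l, lim0 (fun s => complex.Re (F s ij.1 ij.2)) l.
  have [l hl] := H (delta_mx ij.2 0) (delta_mx ij.1 0); exists l => e /hl[D Dp h].
  by exists D => // s /h; rewrite ReE.
have /choice[Lb hLb] (ij : 'I_m * 'I_k) : exists l, lim0 (fun s => complex.Im (F s ij.1 ij.2)) l.
  have [l hl] := H (delta_mx ij.2 0) ('i%C *: delta_mx ij.1 0); exists l => e /hl[D Dp h].
  by exists D => // s /h; rewrite ImE.
exists (\matrix_(i, j) (La (i, j) +i* Lb (i, j))) => e e0.
pose N : R := (k * m)%:R + 1.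
have N0 : 0 < N by rewrite ltr_wpDl.
have e'0 : 0 < e / (2 * N) by rewrite divr_gt0// mulr_gt0.
have /choice[D hD] (ij : 'I_m * 'I_k) : exists D, 0 < D /\ forall s, 0 < s < D ->
    Normc.normc (F s ij.1 ij.2 - (La ij +i* Lb ij)) <= e / N.
  have [D1 D1p h1] := hLa ij _ e'0; have [D2 D2p h2] := hLb ij _ e'0.
  exists (Num.min D1 D2); split; first by rewrite lt_min D1p.
  move=> s; rewrite lt_min => /and3P[s0 s1 s2].
  apply: le_trans (normc_le_ReIm _) _.
  have -> : e / N = e / (2 * N) + e / (2 * N) by field; rewrite gt_eqF.
  have := h1 s; have := h2 s; rewrite s0 s1 s2.
  by case: (F s _ _) => a b /= => /(_ isT) k2 /(_ isT) k1; exact: lerD.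
exists (\big[Num.min/1]_ij D ij).
  elim/big_ind: _ => // [x y x0 y0|ij _]; last by case: (hD ij).
  by rewrite lt_min x0.
move=> s /andP[s0 sD] v; apply: le_trans (l2norm_mulmx_le _ _) _.
apply: ler_wpM2r; first exact: l2norm_ge0.
have -> : e = e / N * N by rewrite divfK// gt_eqF.
apply: (@le_trans _ _ (\sum_(j < k) \sum_(i < m) e / N)).
  apply: ler_sum => j _; apply: ler_sum => i _.
  rewrite !mxE; case: (hD (i, j)) => _ /(_ s); apply.
  by rewrite s0 (lt_le_trans sD)//; exact: bigmin_le.
rewrite !sumr_const !card_ord -!mulrnA -mulr_natr ler_wpM2l//.
  by rewrite ltW// divr_gt0.
by rewrite /N mulnC lerDl.
Qed.

Lemma mxlim0_dot m k (F : R -> 'M[C]_(m, k)) L v w : mxlim0 F L ->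
  lim0 (fun s => rdot (F s *m v) w) (rdot (L *m v) w).
Proof.
move=> h e e0.
have c0 : 0 < l2norm v * l2norm w + 1 by rewrite ltr_wpDl ?mulr_ge0 ?l2norm_ge0.
have [D Dp hD] := h (e / (l2norm v * l2norm w + 1)) (divr_gt0 e0 c0).
exists D => // s /hD /(_ v) h1.
rewrite -rdotBl -mulmxBl.
have h2 : l2norm ((F s - L) *m v) * l2norm w <= e.
  apply: (@le_trans _ _ (e / (l2norm v * l2norm w + 1) * l2norm v * l2norm w)).
    by rewrite ler_wpM2r ?l2norm_ge0.
  rewrite -mulrA mulrAC ler_pdivrMr// ler_wpM2l ?ltW//; lra.
rewrite ler_norml; apply/andP; split.
  by apply: le_trans (rdot_ge _ _); rewrite lerN2.
exact: le_trans (rdot_le _ _) h2.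
Qed.

Lemma rdot_ext m (v w : 'cV[C]_m) : (forall u, rdot v u = rdot w u) -> v = w.
Proof.
move=> h; apply/eqP; rewrite -subr_eq0; apply/eqP/nsq_eq0.
by rewrite /nsq rdotBl h subrr.
Qed.

Lemma mx_ext m k (A B : 'M[C]_(m, k)) : (forall v : 'cV[C]_k, A *m v = B *m v) -> A = B.
Proof.
move=> h; apply/matrixP => i j.
by have /colP/(_ i) := h (delta_mx j 0); rewrite -!colE !mxE.
Qed.

Lemma mxlim0_uniq m k (F : R -> 'M[C]_(m, k)) L L' :
  mxlim0 F L -> mxlim0 F L' -> L = L'.
Proof.
move=> h h'; apply: mx_ext => v; apply: rdot_ext => w.
exact: lim0_uniq (mxlim0_dot v w h) (mxlim0_dot v w h').
Qed.

Lemma mxlim0_le m k (F : R -> 'M[C]_(m, k)) L (v : 'cV[C]_k) M D0 : 0 < D0 ->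
    (forall s, 0 < s < D0 -> l2norm (F s *m v) <= M) ->
  mxlim0 F L -> l2norm (L *m v) <= M.
Proof.
move=> D00 hF h; apply/ler_addgt0Pr => e e0.
have c0 : 0 < l2norm v + 1 by rewrite ltr_wpDl ?l2norm_ge0.
have [D Dp hD] := h (e / (l2norm v + 1)) (divr_gt0 e0 c0).
pose s := Num.min D D0 / 2.
have sp : 0 < s by rewrite divr_gt0// lt_min Dp.
have s2 : s < Num.min D D0 by rewrite /s in sp *; lra.
have := hF s; have := hD s; rewrite sp !(lt_le_trans s2) ?ge_min ?lexx ?orbT//.
move=> /(_ isT v) a /(_ isT) b.
have : e / (l2norm v + 1) * l2norm v <= e.
  rewrite mulrAC ler_pdivrMr// ler_wpM2l ?ltW//; lra.
have -> : L *m v = F s *m v - (F s - L) *m v by rewrite mulmxBl subKr.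
by have := l2normB (F s *m v) ((F s - L) *m v); lra.
Qed.

End limits_at_zero.

(** * Julia's inequality *)

Section julia.
Context {R : realType}.
Local Notation C := R[i].
Variables (d : nat) (I : finType) (g : 'I_d -> I) (c0 : I).
Local Notation gcol := (gcol g).
Local Notation gball := (gball g).
Variable phi : graded_fun R d.
Hypothesis phi_int : forall m k (x : mxtuple R d m) (y : mxtuple R d k)
    (L : 'M[C]_(m, k)), gball x -> gball y ->
  (forall r, submxcol x r *m L = L *m submxcol y r) ->
  phi x *m L = L *m phi y.
Hypothesis phi_con : forall m (x : mxtuple R d m) v, gball x ->
  nsq (phi x *m v) <= nsq v.

Definition giso m (T : mxtuple R d m) := forall c v, nsq (gcol c T *m v) = nsq v.

Lemma rdot_giso m (T : mxtuple R d m) : giso T ->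
  forall c v w, rdot (gcol c T *m v) (gcol c T *m w) = rdot v w.
Proof.
move=> iT c v w; have := nsqD (gcol c T *m v) (gcol c T *m w).
rewrite -mulmxDr !iT nsqD; lra.
Qed.

Lemma l2norm_giso m (T : mxtuple R d m) : giso T ->
  forall c v, l2norm (gcol c T *m v) = l2norm v.
Proof. by move=> iT c v; rewrite !l2normE iT. Qed.

(** What is used of a sequence that witnesses a B-point: e j is
    1 - |delta(Z j)|^2 and al bounds the Julia quotients. *)
Record julia_seq m (T : mxtuple R d m) (Z : nat -> mxtuple R d m) (al : R)
    (e : nat -> R) : Prop := JuliaSeq {
  js_ball : forall j, gball (Z j);
  js_gt0 : forall j, 0 < e j;
  js_dom : forall j c w, e j * nsq w <= nsq w - nsq (gcol c (Z j) *m w);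
  js_phi : forall j w, nsq w - nsq (phi (Z j) *m w) <= al * e j * nsq w;
  js_cvg : forall E, 0 < E -> exists N, forall j, (N <= j)%N -> forall c w,
     l2norm (gcol c (Z j - T) *m w) <= E * l2norm w }.

Lemma l2norm_gball_le m (x : mxtuple R d m) c v : gball x ->
  l2norm (gcol c x *m v) <= l2norm v.
Proof.
case=> _ [k k1 /(_ c v) h]; rewrite l2norm_le ?l2norm_ge0// sqr_l2norm.
by apply: le_trans h _; rewrite ler_piMl ?nsq_ge0// ltW.
Qed.

(** At T the column of each group is isometric, so that the defect of Z j, which
    dominates e j, tends to 0. *)
Lemma js_e_small m (T : mxtuple R d m) Z al e : (0 < m)%N -> giso T ->
  julia_seq T Z al e ->
  forall E, 0 < E -> exists N, forall j, (N <= j)%N -> e j <= E.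
Proof.
move=> m0 iT J E E0; have E20 : 0 < E / 2 by lra.
have [N hN] := js_cvg J E20; exists N => j /hN {hN}/(_ c0).
pose w : 'cV[C]_m := delta_mx (Ordinal m0) 0; move=> /(_ w) h.
have nw : nsq w = 1 by rewrite -sqr_l2norm l2norm_delta expr1n.
have := js_dom J j c0 w; rewrite nw mulr1 => /le_trans; apply.
have -> : Z j = T + (Z j - T) by rewrite addrC subrK.
rewrite gcolD mulmxDl nsqD iT nw.
have := rdot_ge (gcol c0 T *m w) (gcol c0 (Z j - T) *m w).
rewrite l2norm_giso// -(l2norm_delta (Ordinal m0)) -/w.
have := nsq_ge0 (gcol c0 (Z j - T) *m w).
move: h; rewrite l2norm_delta; lra.
Qed.

(** Apply the Pick inequality to x and Z j with weights a and 1 / e j. The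
    defect of Z j is then at least 1, that of phi(Z j) at most al, and the mixed
    term is controlled because Z j is close to T. *)
Lemma julia_seq_pick m (T : mxtuple R d m) Z al e (x : mxtuple R d m) a ga mu :
    (0 < m)%N -> giso T -> julia_seq T Z al e -> gball x ->
    0 < mu -> 0 < a -> 4 * mu ^+ 2 <= a * ga ->
    (forall c v, ga * nsq v <= nsq v - nsq (gcol c x *m v)) ->
    (forall c v w, - (mu * (l2norm v * l2norm w)) <=
        rdot v w - rdot (gcol c x *m v) (gcol c T *m w)) ->
  exists N, forall j, (N <= j)%N -> forall v w,
    0 <= a * (nsq v - nsq (phi x *m v)) +
         2 * (rdot v w - rdot (phi x *m v) (phi (Z j) *m w)) + al * nsq w.
Proof.
move=> m0 iT J Gx mu0 a0 amu hga hmu.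
have mu20 : 0 < mu / 2 by lra.
have a20 : 0 < a / 2 by lra.
have [N1 h1] := js_cvg J mu20; have [N2 h2] := js_e_small m0 iT J a20.
exists (maxn N1 N2) => j; rewrite geq_max => /andP[/h1 {}h1 /h2 {}h2] v w.
have ej := js_gt0 J j.
have ej0 : e j != 0 by rewrite gt_eqF.
have b0 : 0 < (e j)^-1 by rewrite invr_gt0.
pose E := Num.min (mu ^+ 2) (1 / 4).
have E0 : 0 < E by rewrite lt_min exprn_gt0//=; lra.
have ab : 1 < a * (e j)^-1 by rewrite ltr_pdivlMr// mul1r; lra.
have H : forall c v w, E * (nsq v + nsq w) <=
    pick_form (gcol c x) (gcol c (Z j)) a (e j)^-1 v w; last first.
  have := pick_transfer phi_int phi_con Gx (js_ball J j) a0 ab E0 H v w.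
  have := js_phi J j w; rewrite -(ler_pM2l b0).
  have -> : (e j)^-1 * (al * e j * nsq w) = al * nsq w by field.
  by move=> hphi /le_trans; apply; rewrite /pick_form lerD2l.
move=> {v w} c v w; rewrite /pick_form.
have hx := l2norm_gball_le c v Gx.
have hb : nsq w <= (e j)^-1 * (nsq w - nsq (gcol c (Z j) *m w)).
  by have := js_dom J j c w; rewrite -(ler_pM2l b0) mulKf.
have ha : 4 * mu ^+ 2 * nsq v <= a * (nsq v - nsq (gcol c x *m v)).
  apply: (@le_trans _ _ (a * ga * nsq v)); first by rewrite ler_wpM2r ?nsq_ge0.
  by rewrite -mulrA ler_pM2l.
have hc : - (3 / 2 * mu * (l2norm v * l2norm w)) <=
    rdot v w - rdot (gcol c x *m v) (gcol c (Z j) *m w).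
  have -> : Z j = T + (Z j - T) by rewrite addrC subrK.
  rewrite gcolD mulmxDl rdotDr.
  have k1 := hmu c v w; have k2 := h1 c w.
  have k3 := rdot_le (gcol c x *m v) (gcol c (Z j - T) *m w).
  have : l2norm (gcol c x *m v) * l2norm (gcol c (Z j - T) *m w) <=
     l2norm v * (mu / 2 * l2norm w) by rewrite ler_pM ?l2norm_ge0.
  lra.
have : E * nsq v <= mu ^+ 2 * nsq v by rewrite ler_wpM2r ?nsq_ge0// ge_min lexx.
have : E * nsq w <= 1 / 4 * nsq w by rewrite ler_wpM2r ?nsq_ge0// ge_min lexx orbT.
have : 0 <= (2 * mu * l2norm v - l2norm w) ^+ 2 by exact: sqr_ge0.
rewrite -!sqr_l2norm in ha hb *.
move: (l2norm v) (l2norm w) ha hb hc => p q ha hb hc s1 s2 s3.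
move: ha hb hc; set A1 := a * _; set B1 := _^-1 * _; set D1 := rdot _ _ - _.
by nra.
Qed.

Lemma phi_con_norm m (x : mxtuple R d m) v : gball x ->
  l2norm (phi x *m v) <= l2norm v.
Proof. by move=> Gx; rewrite l2norm_le ?l2norm_ge0// sqr_l2norm phi_con. Qed.

Definition mxseqlim m (F : nat -> 'M[C]_m) (W : 'M[C]_m) : Prop :=
  forall E, 0 < E -> exists N, forall j, (N <= j)%N -> forall w,
     l2norm ((F j - W) *m w) <= E * l2norm w.

(** Let j tend to infinity in the Pick inequality and choose w with
    W w = -(W v - phi(x) v) / al; the defect of phi(x) at v is at most
    2 |v| |W v - phi(x) v| since W is isometric. *)
Lemma julia_inequality m (T : mxtuple R d m) Z al e (W Wi : 'M[C]_m)
    (x : mxtuple R d m) a ga mu :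
    (0 < m)%N -> giso T -> julia_seq T Z al e -> 0 < al ->
    mxseqlim (fun j => phi (Z j)) W ->
    (forall w, nsq (W *m w) = nsq w) -> W *m Wi = 1%:M -> gball x ->
    0 < mu -> 0 < a -> 4 * mu ^+ 2 <= a * ga ->
    (forall c v, ga * nsq v <= nsq v - nsq (gcol c x *m v)) ->
    (forall c v w, - (mu * (l2norm v * l2norm w)) <=
        rdot v w - rdot (gcol c x *m v) (gcol c T *m w)) ->
  forall v, l2norm ((phi x - W) *m v) <= 2 * al * a * l2norm v.
Proof.
move=> m0 iT J al0 cW isoW WWi Gx mu0 a0 amu hga hmu v.
have H w : 0 <= a * (nsq v - nsq (phi x *m v)) +
         2 * (rdot v w - rdot (phi x *m v) (W *m w)) + al * nsq w.
  apply/ler_addgt0Pr => E E0.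
  have c0' : 0 < 2 * (l2norm v * l2norm w) + 1.
    by rewrite ltr_wpDl ?mulr_ge0 ?l2norm_ge0.
  have [N1 h1] := cW _ (divr_gt0 E0 c0').
  have [N2 h2] := julia_seq_pick m0 iT J Gx mu0 a0 amu hga hmu.
  have {}h1 := h1 _ (leq_maxl N1 N2) w.
  have := h2 _ (leq_maxr N1 N2) v w; set j := maxn _ _ in h1 *.
  have -> : phi (Z j) *m w = W *m w + (phi (Z j) - W) *m w.
    by rewrite mulmxBl addrC subrK.
  rewrite rdotDr.
  have := rdot_ge (phi x *m v) ((phi (Z j) - W) *m w).
  have : l2norm (phi x *m v) * l2norm ((phi (Z j) - W) *m w) <=
     l2norm v * (E / (2 * (l2norm v * l2norm w) + 1) * l2norm w).
    by rewrite ler_pM ?l2norm_ge0// phi_con_norm.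
  have : 2 * (l2norm v * (E / (2 * (l2norm v * l2norm w) + 1) * l2norm w)) <= E.
    rewrite [leLHS](_ : _ = E * (2 * (l2norm v * l2norm w)) / (2 * (l2norm v * l2norm w) + 1)).
      by rewrite ler_pdivrMr// ler_wpM2l ?ltW//; lra.
    by field; rewrite gt_eqF.
  lra.
pose y := W *m v - phi x *m v.
pose w := - (al^-1)%:C *: (Wi *m y).
have Ww : W *m w = - (al^-1)%:C *: y by rewrite -scalemxAr mulmxA WWi mul1mx.
have isoWd u u' : rdot (W *m u) (W *m u') = rdot u u'.
  have := nsqD (W *m u) (W *m u'); rewrite -mulmxDr !isoW nsqD; lra.
have := H w; rewrite -isoWd -rdotBl -/y Ww -(isoW w) Ww.
rewrite -rmorphN rdotZr nsqZR.
have -> : phi x *m v = W *m v - y by rewrite subKr.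
rewrite nsqB isoW -/(nsq y).
rewrite mulmxBl -l2normN opprB -/y.
have := rdot_le (W *m v) y.
have -> : l2norm (W *m v) = l2norm v by rewrite !l2normE isoW.
rewrite -!sqr_l2norm; have := l2norm_ge0 y; have := l2norm_ge0 v.
move: (l2norm y) (l2norm v) (rdot _ _) => p q t q0 p0 tle.
have -> : a * (q ^+ 2 - (q ^+ 2 - 2 * t + p ^+ 2)) + 2 * (- al^-1 * p ^+ 2) +
   al * ((- al^-1) ^+ 2 * p ^+ 2) = a * (2 * t - p ^+ 2) - p ^+ 2 / al.
  by field; rewrite gt_eqF.
move=> h.
have : p ^+ 2 <= 2 * al * a * q * p.
  have : p ^+ 2 / al <= a * (2 * (q * p)).
    apply: le_trans (_ : _ <= a * (2 * t - p ^+ 2)) _; first by lra.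
    by rewrite ler_pM2l//; have := sqr_ge0 p; lra.
  by rewrite ler_pdivrMr//; lra.
have [->|pn0] := eqVneq p 0; first by rewrite !mulr_ge0// ltW.
by rewrite expr2 ler_pM2r// lt_neqAle eq_sym pn0.
Qed.

Lemma gball_radial m (T : mxtuple R d m) (t : R) : (0 < m)%N -> giso T -> 0 < t < 1 ->
  gball ((1 - t)%:C *: T).
Proof.
move=> m0 iT /andP[t0 t1]; split => //.
exists ((1 - t) ^+ 2); first by nra.
by move=> c v; rewrite gcolZ -scalemxAl nsqZR iT.
Qed.

(** Two contractions A, V with Re A* V close to the identity are close to each
    other. The estimate does not involve a limit of phi(Z j), so it gives the
    existence of the boundary value and its independence of the sequence. *)
Lemma radial_close m (T : mxtuple R d m) Z al e : (0 < m)%N -> giso T ->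
  julia_seq T Z al e -> forall s, 0 < s < 1 ->
  exists N, forall j, (N <= j)%N -> forall v,
    nsq ((phi ((1 - s ^+ 2 / 4)%:C *: T) - phi (Z j)) *m v) <= s * (1 + al) * nsq v.
Proof.
move=> m0 iT J s /andP[s0 s1].
pose t := s ^+ 2 / 4.
have t01 : 0 < t < 1 by rewrite /t; nra.
have Gx := gball_radial m0 iT t01; have [t0 t1] := andP t01.
have s20 : 0 < s ^+ 2 by rewrite exprn_gt0.
have st : s ^+ 2 = 4 * t by rewrite /t; lra.
have tt : 4 * t ^+ 2 <= s ^+ 2 * t by rewrite st -mulrA expr2.
have [c v|c v w|N hN] := julia_seq_pick m0 iT J Gx t0 s20 tt.
- rewrite gcolZ -scalemxAl nsqZR iT.
  have : 0 <= t * (1 - t) * nsq v by rewrite !mulr_ge0 ?nsq_ge0//; lra.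
  lra.
- rewrite gcolZ -scalemxAl rdotZl rdot_giso//.
  have : 0 <= t * (rdot v w + l2norm v * l2norm w).
    by rewrite mulr_ge0//; have := rdot_ge v w; lra.
  lra.
exists N => j /hN h v; have := h v (- s%:C *: v).
have pc := phi_con v (js_ball J j).
have px := phi_con v Gx; have px0 := nsq_ge0 (phi ((1 - t)%:C *: T) *m v).
rewrite -/t mulmxBl nsqB -rmorphN -scalemxAr !rdotZr nsqZR -/(nsq v).
move: (rdot _ _) pc px px0 => z pc px px0 hh.
have : s * (2 * (nsq v - z)) <= s * (s * (1 + al) * nsq v) by nra.
by rewrite ler_pM2l//; lra.
Qed.

End julia.

(** * Amplifications and bounded difference quotients *)

Section amplification.
Context {R : realType}.
Local Notation C := R[i].

(** The Kronecker product of B with X, with blocks B i j X. *)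
Definition kron K n (B : 'M[C]_K) (X : 'M[C]_n) : 'M[C]_(\sum_(i < K) n) :=
  \mxblock_(i < K, j < K) (B i j *: X).

(** The Kronecker product of the column u with the identity. *)
Definition kron_col K n (u : 'cV[C]_K) : 'M[C]_(\sum_(i < K) n, n) :=
  \mxcol_(i < K) (u i 0)%:M.

Definition kron_blk K n (B : 'M[C]_K) (v : 'cV[C]_(\sum_(i < K) n)) (i : 'I_K) : 'cV[C]_n :=
  \sum_j B i j *: submxcol v j.

Lemma submxcol_kron K n (B : 'M[C]_K) (X : 'M[C]_n) v i :
  submxcol (kron B X *m v) i = X *m kron_blk B v i.
Proof.
rewrite -[v]submxcolK mul_mxblock_mxrow mxcolK mulmx_sumr.
by apply: eq_bigr => j _; rewrite mxcolK -scalemxAl -scalemxAr.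
Qed.

Lemma kron_mul_col K n (B : 'M[C]_K) (X : 'M[C]_n) (u : 'cV[C]_K) :
  kron B X *m kron_col n u = kron_col n (B *m u) *m X.
Proof.
rewrite mul_mxblock_mxrow mxcol_mul; apply: eq_mxcol => i.
rewrite mul_scalar_mx mxE scaler_suml; apply: eq_bigr => j _.
by rewrite mul_mx_scalar scalerA mulrC.
Qed.

Lemma kron_colZ K n (a : C) (u : 'cV[C]_K) : kron_col n (a *: u) = a *: kron_col n u.
Proof.
apply/matrixP => i j; rewrite !mxE.
by case: eqP => _ /=; rewrite ?mulr1n ?mulr0n ?mulr0.
Qed.

Lemma submxcol_kron_col K n (u : 'cV[C]_K) (v : 'cV[C]_n) i :
  submxcol (kron_col n u *m v) i = u i 0 *: v.
Proof. by rewrite -submxcol_mul mxcolK mul_scalar_mx. Qed.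

Lemma kron_blk1 K n (v : 'cV[C]_(\sum_(i < K) n)) i : kron_blk 1%:M v i = submxcol v i.
Proof.
rewrite /kron_blk (bigD1 i)//= mxE eqxx scale1r big1 ?addr0// => j ji.
by rewrite mxE eq_sym (negbTE ji) scale0r.
Qed.

Lemma submxcol_inj K n (v w : 'cV[C]_(\sum_(i < K) n)) :
  (forall i, submxcol v i = submxcol w i) -> v = w.
Proof. by move=> h; apply/mxcolP. Qed.

Lemma colE_kron K n (v : 'cV[C]_(\sum_(i < K) n)) :
  v = \sum_j kron_col n (delta_mx j 0) *m submxcol v j.
Proof.
apply: submxcol_inj => i; rewrite submxcol_sum (bigD1 i)//= submxcol_kron_col.
rewrite mxE !eqxx scale1r big1 ?addr0// => j ji.
by rewrite submxcol_kron_col mxE eq_sym (negbTE ji) scale0r.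
Qed.

Lemma nsq_submxcol K n (v : 'cV[C]_(\sum_(i < K) n)) :
  nsq v = \sum_i nsq (submxcol v i).
Proof. exact: rdot_submxcol. Qed.

Lemma sum_gt0 K n : (0 < K)%N -> (0 < n)%N -> (0 < \sum_(i < K) n)%N.
Proof. by move=> K0 n0; rewrite sum_nat_const card_ord muln_gt0 K0. Qed.

Variables (d : nat) (I : finType) (g : 'I_d -> I) (c0 : I).
Local Notation gcol := (gcol g).
Local Notation gball := (gball g).
Local Notation giso := (giso g).

Definition kron_tuple K n (B : 'M[C]_K) (X : mxtuple R d n) : mxtuple R d (\sum_(i < K) n) :=
  \mxcol_(r < d) kron B (submxcol X r).

Lemma kron_tuple1B K n (X Y : mxtuple R d n) :
  kron_tuple (1%:M : 'M[C]_K) (X - Y) = kron_tuple 1%:M X - kron_tuple 1%:M Y.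
Proof.
apply/matrixP => i j; rewrite !mxE; ring.
Qed.

Lemma rdot_kron_tuple c K n (B B' : 'M[C]_K) (X Y : mxtuple R d n) v w :
  rdot (gcol c (kron_tuple B X) *m v) (gcol c (kron_tuple B' Y) *m w) =
  \sum_i rdot (gcol c X *m kron_blk B v i) (gcol c Y *m kron_blk B' w i).
Proof.
rewrite rdot_gcol.
under [RHS]eq_bigr do rewrite rdot_gcol.
rewrite [RHS]exchange_big; apply: eq_bigr => r _.
by rewrite rdot_submxcol; apply: eq_bigr => i _; rewrite !mxcolK !submxcol_kron.
Qed.

Lemma nsq_kron_tuple c K n (B : 'M[C]_K) (X : mxtuple R d n) v :
  nsq (gcol c (kron_tuple B X) *m v) = \sum_i nsq (gcol c X *m kron_blk B v i).
Proof. exact: rdot_kron_tuple. Qed.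

Lemma nsq_kron_tuple1 c K n (X : mxtuple R d n) v :
  nsq (gcol c (kron_tuple (1%:M : 'M[C]_K) X) *m v) = \sum_i nsq (gcol c X *m submxcol v i).
Proof. by rewrite nsq_kron_tuple; apply: eq_bigr => i _; rewrite kron_blk1. Qed.

Lemma nsq_kron1 K n (A : 'M[C]_n) v :
  nsq (kron (1%:M : 'M[C]_K) A *m v) = \sum_i nsq (A *m submxcol v i).
Proof. by rewrite nsq_submxcol; apply: eq_bigr => i _; rewrite submxcol_kron kron_blk1. Qed.

Lemma giso_kron_tuple1 K n (T : mxtuple R d n) : giso T -> giso (kron_tuple (1%:M : 'M[C]_K) T).
Proof.
move=> iT c v; rewrite nsq_kron_tuple1 nsq_submxcol.
by apply: eq_bigr => i _; rewrite iT.
Qed.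

Lemma gball_kron_tuple1 K n (x : mxtuple R d n) : (0 < K)%N -> gball x ->
  gball (kron_tuple (1%:M : 'M[C]_K) x).
Proof.
move=> K0 [n0 [k k1 hk]]; split; first exact: sum_gt0.
exists k => // c v; rewrite nsq_kron_tuple1 nsq_submxcol mulr_sumr.
by apply: ler_sum => i _; exact: hk.
Qed.

Variable phi : graded_fun R d.
Hypothesis phi_int : forall m k (x : mxtuple R d m) (y : mxtuple R d k)
    (L : 'M[C]_(m, k)), gball x -> gball y ->
  (forall r, submxcol x r *m L = L *m submxcol y r) ->
  phi x *m L = L *m phi y.
Hypothesis phi_con : forall m (x : mxtuple R d m) v, gball x ->
  nsq (phi x *m v) <= nsq v.

Lemma phi_kron_tuple1 K n (x : mxtuple R d n) : (0 < K)%N -> gball x ->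
  phi (kron_tuple (1%:M : 'M[C]_K) x) = kron 1%:M (phi x).
Proof.
move=> K0 Gx; have Gk := gball_kron_tuple1 K0 Gx.
apply: mx_ext => v; rewrite {1 2}(colE_kron v) !mulmx_sumr.
apply: eq_bigr => j _; rewrite !mulmxA kron_mul_col mul1mx; congr (_ *m _).
by apply: phi_int => // r; rewrite mxcolK kron_mul_col mul1mx.
Qed.

(** All that the sequel needs to know about T and W. In contrast with the
    definition of a B-point this is visibly stable under amplification. *)
Definition julia_point m (T : mxtuple R d m) (W : 'M[C]_m) (al : R) : Prop :=
  [/\ (0 < m)%N, giso T, 0 < al,
      exists Z e, julia_seq g phi T Z al e /\ mxseqlim (fun j => phi (Z j)) W
    & (forall w, nsq (W *m w) = nsq w) /\ exists Wi, W *m Wi = 1%:M].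

(** The sequence Z j is amplified along with T; phi commutes with
    amplifications since it respects intertwinings. *)
Lemma julia_point_amp K n (T : mxtuple R d n) W al : (0 < K)%N -> julia_point T W al ->
  julia_point (kron_tuple (1%:M : 'M[C]_K) T) (kron 1%:M W) al.
Proof.
move=> K0 [n0 iT al0 [Z [e [[jb j0 jd jp jc] hW]]] [iW [Wi hWi]]].
have l2le m (A B : 'M[C]_(m, n)) E : 0 < E ->
    (forall w, l2norm (A *m w) <= E * l2norm w) ->
    forall w, nsq (A *m w) <= E ^+ 2 * nsq w.
  move=> E0 h w; rewrite -!sqr_l2norm -exprMn ler_sqr ?nnegrE ?l2norm_ge0//.
  by rewrite mulr_ge0 ?l2norm_ge0 ?ltW.
split => //.
- exact: sum_gt0.
- exact: giso_kron_tuple1.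
- exists (fun j => kron_tuple 1%:M (Z j)), e; split.
    split => //.
    + by move=> j; exact: gball_kron_tuple1.
    + move=> j c w; rewrite nsq_kron_tuple1 nsq_submxcol mulr_sumr -sumrB.
      by apply: ler_sum => i _; exact: jd.
    + move=> j w; rewrite phi_kron_tuple1// nsq_kron1 nsq_submxcol mulr_sumr -sumrB.
      by apply: ler_sum => i _; exact: jp.
    + move=> E E0; have [N hN] := jc E E0; exists N => j /hN h c w.
      rewrite l2norm_le ?mulr_ge0 ?l2norm_ge0 ?(ltW E0)//.
      rewrite -kron_tuple1B nsq_kron_tuple1 exprMn sqr_l2norm nsq_submxcol mulr_sumr.
      by apply: ler_sum => i _; apply: l2le.
  move=> E E0; have [N hN] := hW E E0; exists N => j /hN h w.
  rewrite l2norm_le ?mulr_ge0 ?l2norm_ge0 ?(ltW E0)//.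
  have -> : phi (kron_tuple (1%:M : 'M[C]_K) (Z j)) - kron 1%:M W = kron 1%:M (phi (Z j) - W).
    by rewrite phi_kron_tuple1//; apply/matrixP => i k; rewrite !mxE; ring.
  rewrite nsq_kron1 exprMn sqr_l2norm nsq_submxcol mulr_sumr.
  by apply: ler_sum => i _; apply: l2le.
- split.
    by move=> w; rewrite nsq_kron1 nsq_submxcol; apply: eq_bigr => i _; rewrite iW.
  exists (kron 1%:M Wi); apply: mx_ext => v; apply: submxcol_inj => i.
  by rewrite -mulmxA submxcol_kron kron_blk1 submxcol_kron kron_blk1 mulmxA hWi !mul1mx.
Qed.

(** The real part of T* H is at most -lam in each group: the points T + t H then
    enter the domain at a definite speed. *)
Definition inward m (T : mxtuple R d m) (lam : R) (H : mxtuple R d m) : Prop :=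
  forall c v, lam * nsq v <= - rdot (gcol c H *m v) (gcol c T *m v).

Definition gbounded m (h : R) (H : mxtuple R d m) : Prop :=
  forall c v, nsq (gcol c H *m v) <= h ^+ 2 * nsq v.

Lemma inward_defect m (T H : mxtuple R d m) (lam h t : R) : giso T -> inward T lam H ->
    gbounded h H -> 0 < t -> t * h ^+ 2 <= lam ->
  forall c v, t * lam * nsq v <= nsq v - nsq (gcol c (T + t%:C *: H) *m v).
Proof.
move=> iT cH bH t0 th c v; rewrite gcolD gcolZ mulmxDl -scalemxAl nsqD nsqZR iT.
rewrite rdotZr rdotC.
have : t * (lam * nsq v) <= t * (- rdot (gcol c H *m v) (gcol c T *m v)).
  by rewrite ler_pM2l.
have : t ^+ 2 * nsq (gcol c H *m v) <= t ^+ 2 * (h ^+ 2 * nsq v).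
  by rewrite ler_wpM2l ?sqr_ge0.
have : t * (t * h ^+ 2) * nsq v <= t * lam * nsq v.
  by rewrite ler_wpM2r ?nsq_ge0// ler_pM2l.
lra.
Qed.

Lemma gball_inward m (T H : mxtuple R d m) (lam h t : R) : (0 < m)%N -> giso T ->
    0 < lam -> inward T lam H -> gbounded h H -> 0 < t -> t * h ^+ 2 <= lam ->
  gball (T + t%:C *: H).
Proof.
move=> m0 iT l0 cH bH t0 th; split => //; exists (1 - t * lam).
  by rewrite gtrBl mulr_gt0.
by move=> c v; have := inward_defect iT cH bH t0 th c v; lra.
Qed.

Definition diff_quot m (T : mxtuple R d m) (W : 'M[C]_m) (t : R) (H : mxtuple R d m) : 'M[C]_m :=
  (t^-1)%:C *: (phi (T + t%:C *: H) - W).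

(** Julia's inequality at x = T + t H, where the defect of x is at least t lam
    and I - x* T = -t H* T: the admissible weight a is of order t, and so is the
    distance from phi(x) to W. *)
Lemma diff_quot_bounded m (T H : mxtuple R d m) W (al lam h t : R) : julia_point T W al ->
    0 < lam -> inward T lam H -> 0 < h -> gbounded h H -> 0 < t -> t * h ^+ 2 <= lam ->
  forall v, l2norm (diff_quot T W t H *m v) <= 8 * al * h ^+ 2 / lam * l2norm v.
Proof.
move=> [m0 iT al0 [Z [e [J hW]]] [iW [Wi hWi]]] l0 cH h0 bH t0 th v.
have Gx := gball_inward m0 iT l0 cH bH t0 th.
have mu0 : 0 < t * h by rewrite mulr_gt0.
have a0 : 0 < 4 * t * h ^+ 2 / lam by rewrite divr_gt0 ?mulr_gt0 ?exprn_gt0.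
have ln0 : lam != 0 by rewrite gt_eqF.
have tn0 : t != 0 by rewrite gt_eqF.
have amu : 4 * (t * h) ^+ 2 <= 4 * t * h ^+ 2 / lam * (t * lam).
  by rewrite le_eqVlt; apply/orP; left; apply/eqP; field.
have := julia_inequality c0 phi_int phi_con m0 iT J al0 hW iW hWi Gx mu0 a0 amu
  (inward_defect iT cH bH t0 th).
move=> /(_ _ v) hj.
rewrite /diff_quot -scalemxAl l2normZ normcR ger0_norm ?invr_ge0 ?(ltW t0)//.
rewrite ler_pdivrMl//.
have -> : t * (8 * al * h ^+ 2 / lam * l2norm v) =
  2 * al * (4 * t * h ^+ 2 / lam) * l2norm v by field.
apply: hj => c {}v w; rewrite gcolD gcolZ mulmxDl -scalemxAl rdotDl rdotZl.
rewrite rdot_giso// opprD addrA subrr sub0r lerN2 -mulrA ler_pM2l//.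
apply: le_trans (rdot_le _ _) _; rewrite mulrA (l2norm_giso iT).
apply: ler_wpM2r; first exact: l2norm_ge0.
rewrite l2norm_le ?mulr_ge0 ?l2norm_ge0 ?(ltW h0)//.
by rewrite exprMn sqr_l2norm.
Qed.

End amplification.

(** * Newton interpolation through bidiagonal amplifications *)

Section newton_interpolation.
Context {R : realType}.
Local Notation C := R[i].
Local Notation normc := Normc.normc.

(** Diagonal z 0, ..., z N and ones on the superdiagonal. Its eigenvectors are
    the values at its eigenvalues of the Newton basis of the nodes z. *)
Definition bidiag N (z : nat -> C) : 'M[C]_N.+1 :=
  \matrix_(i, j) ((if i == j then z i else 0) +
                  (if (j == i.+1 :> nat) then 1 else 0)).

Definition newton_vec N (z : nat -> C) (x : C) : 'cV[C]_N.+1 :=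
  \col_k \prod_(l < k) (x - z l).

Lemma bidiag_sum (V : lmodType C) N (z : nat -> C) (X : 'I_N.+1 -> V) k :
  \sum_j bidiag N z k j *: X j =
  z k *: X k + (if (k < N)%N then X (inord k.+1) else 0).
Proof.
under eq_bigr do rewrite mxE scalerDl.
rewrite big_split /= (bigD1 k)//= eqxx big1 => [|j ji]; last first.
  by rewrite eq_sym (negbTE ji) scale0r.
rewrite addr0; congr (_ + _); case: ifP => kN.
  rewrite (bigD1 (inord k.+1))//= inordK// eqxx scale1r big1 ?addr0// => j ji.
  case: eqP => [jk|_]; last by rewrite scale0r.
  by move: ji; rewrite -jk inord_val eqxx.
rewrite big1// => j _; case: eqP => [jk|_]; last by rewrite scale0r.
by have := ltn_ord j; rewrite [X in (X < _)%N]jk ltnS => kN2; move: kN; rewrite kN2.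
Qed.

Lemma bidiag_newton N z i : (i <= N)%N ->
  bidiag N z *m newton_vec N z (z i) = z i *: newton_vec N z (z i).
Proof.
move=> iN; apply/colP => k; rewrite !mxE.
have := bidiag_sum (z : nat -> C) (fun j => newton_vec N z (z i) j 0 : C^o) k.
rewrite /GRing.scale/= => ->; rewrite !mxE; case: ifP => kN.
  rewrite inordK// big_ord_recr /=; ring.
have kE : k = N :> nat by apply/eqP; rewrite eqn_leq -ltnS ltn_ord leqNgt kN.
rewrite addr0 kE; have [->//|ni] := eqVneq i N.
have iN' : (i < N)%N by rewrite ltn_neqAle ni.
by rewrite (bigD1 (Ordinal iN'))//= subrr mul0r !mulr0.
Qed.

(** A diagonal matrix with entries of modulus at most 1 plus a shift. *)
Lemma nsq_bidiag N n (z : nat -> C) (v : 'cV[C]_(\sum_(i < N.+1) n)) :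
  (forall i, (i <= N)%N -> normc (z i) <= 1) ->
  \sum_i nsq (kron_blk (bidiag N z) v i) <= 4 * nsq v.
Proof.
move=> z1; rewrite nsq_submxcol.
have h i : nsq (kron_blk (bidiag N z) v i) <= 2 * nsq (submxcol v i) +
    2 * (if (i < N)%N then nsq (submxcol v (inord i.+1)) else 0).
  rewrite /kron_blk bidiag_sum; set w := (X in _ + X).
  apply: le_trans (_ : _ <= 2 * nsq (z i *: submxcol v i) + 2 * nsq w) _.
    by have := nsq_ge0 (z i *: submxcol v i - w); rewrite nsqB nsqD; lra.
  apply: lerD; rewrite ler_pM2l//; last by rewrite /w; case: ifP; rewrite ?nsq0.
  rewrite nsqZ ler_piMl ?nsq_ge0// expr_le1 ?normc_ge0//.
  by apply: z1; rewrite -ltnS.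
apply: le_trans (ler_sum _ (fun i _ => h i)) _.
rewrite big_split /= -!mulr_sumr.
have : \sum_(i < N.+1) (if (i < N)%N then nsq (submxcol v (inord i.+1)) else 0)
    <= \sum_(i < N.+1) nsq (submxcol v i).
  rewrite big_ord_recr /= ltnn addr0 [leRHS]big_ord_recl.
  apply: ler_wpDl; first exact: nsq_ge0.
  apply: ler_sum => i _; rewrite ltn_ord.
  suff -> : inord i.+1 = lift ord0 i by [].
  by apply/val_inj; rewrite /= inordK// ltnS.
lra.
Qed.

Lemma submxcolZ k n m (z : C) (A : 'M[C]_(\sum_(i < k) n, m)) r :
  submxcol (z *: A) r = z *: submxcol A r.
Proof. by apply/matrixP => i j; rewrite !mxE. Qed.

Lemma l2norm_submxcol k n (v : 'cV[C]_(\sum_(i < k) n)) i :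
  l2norm (submxcol v i) <= l2norm v.
Proof.
rewrite l2norm_le ?l2norm_ge0// sqr_l2norm nsq_submxcol (bigD1 i)//=.
by rewrite lerDl sumr_ge0// => j _; exact: nsq_ge0.
Qed.

Lemma normc_prod J (r : seq J) (P : pred J) (F : J -> C) :
  normc (\prod_(i <- r | P i) F i) = \prod_(i <- r | P i) normc (F i).
Proof. by apply: big_morph; [exact: Normc.normcM|exact: Normc.normc1]. Qed.

Variables (d : nat) (I : finType) (g : 'I_d -> I) (c0 : I).
Local Notation gcol := (gcol g).
Local Notation gball := (gball g).
Variable phi : graded_fun R d.
Hypothesis phi_int : forall m k (x : mxtuple R d m) (y : mxtuple R d k)
    (L : 'M[C]_(m, k)), gball x -> gball y ->
  (forall r, submxcol x r *m L = L *m submxcol y r) ->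
  phi x *m L = L *m phi y.
Hypothesis phi_con : forall m (x : mxtuple R d m) v, gball x ->
  nsq (phi x *m v) <= nsq v.

(** Weights of a quadrature-like rule: the value at z N of a polynomial of degree
    less than N is recovered from its values at z 0, ..., z (N - 1). *)
Definition exact_rule N (z : nat -> C) (c : 'I_N -> C) :=
  forall p : {poly C}, (size p <= N)%N -> p.[z N] = \sum_(i < N) c i * p.[z i].

Lemma gboundedP n (h : R) (H : mxtuple R d n) : 0 <= h ->
  gbounded g h H <-> forall c v, l2norm (gcol c H *m v) <= h * l2norm v.
Proof.
move=> h0; split=> hH c v; have := hH c v.
  by rewrite l2norm_le ?exprMn ?sqr_l2norm ?mulr_ge0 ?l2norm_ge0.
by rewrite l2norm_le ?exprMn ?sqr_l2norm ?mulr_ge0 ?l2norm_ge0.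
Qed.

Lemma gbounded_add n (A B : mxtuple R d n) (h k : R) : 0 <= h -> 0 <= k ->
  gbounded g h A -> gbounded g k B -> gbounded g (h + k) (A + B).
Proof.
move=> h0 k0 /(gboundedP _ h0) hA /(gboundedP _ k0) hB; apply/gboundedP; first exact: addr_ge0.
move=> c v; rewrite gcolD mulmxDl; apply: le_trans (l2normD _ _) _.
by rewrite mulrDl; apply: lerD.
Qed.

Lemma gbounded_le n (A : mxtuple R d n) (h k : R) : 0 <= h -> h <= k ->
  gbounded g h A -> gbounded g k A.
Proof.
move=> h0 hk hA c v; apply: le_trans (hA c v) _.
by apply: ler_wpM2r; rewrite ?nsq_ge0// ler_sqr ?nnegrE// (le_trans h0).
Qed.

Lemma gboundedZ n (A : mxtuple R d n) (h : R) x :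
  gbounded g h A -> gbounded g (normc x * h) (x *: A).
Proof.
move=> hA c v; rewrite gcolZ -scalemxAl nsqZ exprMn -[leRHS]mulrA.
by apply: ler_wpM2l; rewrite ?sqr_ge0.
Qed.

Lemma inward_add n (T A B : mxtuple R d n) (lam k : R) : giso g T -> 0 <= k ->
  inward g T lam A -> gbounded g k B -> inward g T (lam - k) (A + B).
Proof.
move=> iT k0 cA /(gboundedP _ k0) hB c v; rewrite gcolD mulmxDl rdotDl opprD mulrBl.
apply: lerD; first exact: cA.
rewrite lerN2; apply: le_trans (rdot_le _ _) _; rewrite (l2norm_giso iT).
by rewrite -sqr_l2norm expr2 mulrA; apply: ler_wpM2r; rewrite ?l2norm_ge0.
Qed.

Lemma inward_le n (T A : mxtuple R d n) (lam lam' : R) : lam' <= lam ->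
  inward g T lam A -> inward g T lam' A.
Proof.
by move=> l cA c v; apply: le_trans (cA c v); apply: ler_wpM2r; rewrite ?nsq_ge0.
Qed.

Lemma inward_kron_tuple1 K n (T A : mxtuple R d n) (lam : R) :
  inward g T lam A -> inward g (kron_tuple (1%:M : 'M[C]_K) T) lam (kron_tuple 1%:M A).
Proof.
move=> cA c v; rewrite rdot_kron_tuple nsq_submxcol mulr_sumr -sumrN; apply: ler_sum => i _.
by rewrite !kron_blk1; exact: cA.
Qed.

Lemma gbounded_kron_tuple1 K n (A : mxtuple R d n) (h : R) :
  gbounded g h A -> gbounded g h (kron_tuple (1%:M : 'M[C]_K) A).
Proof.
move=> hA c v; rewrite nsq_kron_tuple1 nsq_submxcol mulr_sumr.
by apply: ler_sum => i _; exact: hA.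
Qed.

Lemma gbounded_kron_bidiag N n (A : mxtuple R d n) (h : R) (z : nat -> C) :
    (forall i, (i <= N)%N -> normc (z i) <= 1) ->
  gbounded g h A -> gbounded g (2 * h) (kron_tuple (bidiag N z) A).
Proof.
move=> z1 hA c v; rewrite nsq_kron_tuple.
apply: le_trans (_ : _ <= \sum_i h ^+ 2 * nsq (kron_blk (bidiag N z) v i)) _.
  by apply: ler_sum => i _; exact: hA.
rewrite -mulr_sumr; apply: le_trans (ler_wpM2l (sqr_ge0 _) (nsq_bidiag v z1)) _.
by rewrite le_eqVlt; apply/orP; left; apply/eqP; ring.
Qed.

(** Each eigenvector of the bidiagonal matrix intertwines H (x) 1 + K (x) B with
    H + z_i K. The eigenvector for z N minus the combination with weights c of the
    others is prod (z N - z i) times the last basis vector, as its other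
    coordinates are polynomials of degree less than N in the eigenvalue. The first
    coordinates of all eigenvectors are 1, so the first block of the image under
    f_t of this relation is the interpolation error. *)
Lemma newton_interp N n (T H K : mxtuple R d n) W (al lam h t : R)
    (z : nat -> C) (c : 'I_N -> C) :
    julia_point g phi T W al -> 0 < lam -> lam <= h -> inward g T lam H -> gbounded g h H ->
    gbounded g (lam / 4) K -> (forall i, (i <= N)%N -> normc (z i) <= 1) ->
    exact_rule z c -> 0 < t -> 8 * t * h ^+ 2 <= lam ->
  forall v, l2norm ((diff_quot phi T W t (H + z N *: K) -
       \sum_(i < N) c i *: diff_quot phi T W t (H + z i *: K)) *m v)
     <= 64 * al * h ^+ 2 / lam * \prod_(i < N) normc (z N - z i) * l2norm v.
Proof.
move=> J l0 lh cH bH bK z1 exz t0 th v.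
have [n0 iT al0 _ _] := J.
have iTT : giso g (kron_tuple (1%:M : 'M[C]_N.+1) T) by exact: giso_kron_tuple1.
have J' := julia_point_amp phi_int (ltn0Sn N) J.
have l20 : 0 < lam / 2 by lra.
have h20 : 0 < 2 * h by lra.
have th2 : t * (2 * h) ^+ 2 <= lam / 2 by rewrite exprMn; lra.
have l40 : 0 <= lam / 4 by lra.
pose HH := kron_tuple 1%:M H + kron_tuple (bidiag N z) K.
have l24 : 0 <= 2 * (lam / 4) by lra.
have h0 : 0 <= h by lra.
have cHH : inward g (kron_tuple (1%:M : 'M[C]_N.+1) T) (lam / 2) HH.
  by apply: inward_le (inward_add iTT l24 (inward_kron_tuple1 cH) (gbounded_kron_bidiag z1 bK)); lra.
have bHH : gbounded g (2 * h) HH.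
  by apply: gbounded_le (gbounded_add h0 l24 (gbounded_kron_tuple1 bH) (gbounded_kron_bidiag z1 bK)); lra.
have GHH := gball_inward (sum_gt0 (ltn0Sn N) n0) iTT l20 cHH bHH t0 th2.
have dqb := diff_quot_bounded c0 phi_int phi_con J' l20 cHH h20 bHH t0 th2.
pose nv i := newton_vec N z (z i).
have Gx i : (i <= N)%N -> gball (T + t%:C *: (H + z i *: K)).
  move=> /z1 zi; have zK := gboundedZ (z i) bK.
  have zK0 : 0 <= normc (z i) * (lam / 4) by rewrite mulr_ge0 ?normc_ge0.
  have zK1 : normc (z i) * (lam / 4) <= lam / 4 by rewrite ler_piMl.
  apply: (gball_inward n0 iT l20 _ _ t0 th2).
    by apply: inward_le (inward_add iT zK0 cH zK); lra.
  by apply: gbounded_le (gbounded_add h0 zK0 bH zK); lra.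
have dqE i : (i <= N)%N -> diff_quot phi (kron_tuple (1%:M : 'M[C]_N.+1) T) (kron 1%:M W) t HH
    *m kron_col n (nv i) = kron_col n (nv i) *m diff_quot phi T W t (H + z i *: K).
  move=> iN; rewrite /diff_quot -scalemxAl -scalemxAr; congr (_ *: _).
  rewrite mulmxBl mulmxBr kron_mul_col mul1mx; congr (_ - _).
  apply: phi_int => //; first exact: Gx.
  have E1 r (A : mxtuple R d n) : submxcol (kron_tuple (1%:M : 'M[C]_N.+1) A) r *m kron_col n (nv i)
      = kron_col n (nv i) *m submxcol A r by rewrite mxcolK kron_mul_col mul1mx.
  have E2 r : submxcol (kron_tuple (bidiag N z) K) r *m kron_col n (nv i)
      = z i *: (kron_col n (nv i) *m submxcol K r).
    by rewrite mxcolK kron_mul_col bidiag_newton// kron_colZ -scalemxAl.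
  move=> r; rewrite submxcolD submxcolZ [submxcol HH r]submxcolD mulmxDl -scalemxAl.
  rewrite mulmxDl E1 E1 E2 [in RHS]submxcolD [in RHS]submxcolZ [in RHS]submxcolD.
  by rewrite [in RHS]submxcolZ mulmxDr -scalemxAr mulmxDr -scalemxAr.
have nvE : nv N - \sum_(i < N) c i *: nv i =
    (\prod_(i < N) (z N - z i)) *: delta_mx ord_max 0.
  apply/colP => k.
  have -> : (nv N - \sum_(i < N) c i *: nv i) k 0 =
     \prod_(l < k) (z N - z l) - \sum_(i < N) c i * \prod_(l < k) (z i - z l).
    rewrite mxE [nv N k 0]mxE [X in _ + X]mxE; congr (_ - _); rewrite summxE.
    by apply: eq_bigr => i _; rewrite mxE [nv i k 0]mxE.
  rewrite !mxE eqxx andbT.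
  have [kN|kN] := ltnP k N.
    have -> : (k == ord_max) = false by apply/eqP => kE; rewrite kE ltnn in kN.
    pose p : {poly C} := \prod_(l < k) ('X - (z l)%:P).
    have pE x : p.[x] = \prod_(l < k) (x - z l).
      by rewrite horner_prod; apply: eq_bigr => l _; rewrite hornerXsubC.
    have pS : p.[z N] = \sum_(i < N) c i * p.[z i].
      by apply: exz; rewrite size_prod_XsubC /index_enum -enumT size_enum_ord.
    rewrite mulr0; apply/eqP; rewrite subr_eq0 -pE pS; apply/eqP.
    by apply: eq_bigr => i _; rewrite pE.
  have kE : k = ord_max by apply/val_inj/eqP; rewrite eqn_leq kN -ltnS ltn_ord.
  rewrite kE eqxx mulr1 [X in _ - X]big1 ?subr0// => i _.
  by rewrite (bigD1 i)//= subrr mul0r mulr0.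
set A := (X in X *m v).
have : A *m v = submxcol (diff_quot phi (kron_tuple (1%:M : 'M[C]_N.+1) T) (kron 1%:M W) t HH
   *m (kron_col n (nv N - \sum_(i < N) c i *: nv i) *m v)) ord0.
  have -> : kron_col n (nv N - \sum_(i < N) c i *: nv i) =
      kron_col n (nv N) - \sum_(i < N) c i *: kron_col n (nv i).
    apply: mx_ext => u; apply: submxcol_inj => i.
    rewrite mulmxBl mulmx_suml submxcolB submxcol_sum !submxcol_kron_col.
    rewrite !mxE summxE scalerBl scaler_suml; congr (_ - _).
    by apply: eq_bigr => j _; rewrite mxE -scalemxAl submxcolZ submxcol_kron_col scalerA.
  rewrite mulmxA mulmxBr mulmx_sumr dqE//.
  have nv0 i : nv i ord0 0 = 1 by rewrite mxE big_ord0.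
  rewrite [in RHS]mulmxBl [in RHS]mulmx_suml submxcolB submxcol_sum -mulmxA.
  rewrite submxcol_kron_col nv0 scale1r.
  rewrite /A mulmxBl mulmx_suml; congr (_ - _); apply: eq_bigr => i _.
  rewrite -scalemxAr dqE; last exact: ltnW.
  by rewrite -!scalemxAl submxcolZ -mulmxA submxcol_kron_col nv0 scale1r /diff_quot -scalemxAl.
move=> ->; apply: le_trans (l2norm_submxcol _ _) _; apply: le_trans (dqb _) _.
have -> : 8 * al * (2 * h) ^+ 2 / (lam / 2) = 64 * al * h ^+ 2 / lam.
  by field; rewrite gt_eqF.
rewrite -[leRHS]mulrA; apply: ler_wpM2l.
  by rewrite divr_ge0 ?mulr_ge0 ?sqr_ge0// ltW.
rewrite nvE kron_colZ -scalemxAl l2normZ normc_prod; apply: ler_wpM2l.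
  by apply: prodr_ge0 => i _; exact: normc_ge0.
rewrite l2norm_le ?l2norm_ge0// sqr_l2norm nsq_submxcol (bigD1 ord_max)//=.
rewrite submxcol_kron_col mxE !eqxx scale1r big1 ?addr0// => i ni.
by rewrite submxcol_kron_col mxE (negbTE ni) scale0r nsq0.
Qed.

End newton_interpolation.

(** * Convergence in self-adjoint directions *)

Section radial_limits.
Context {R : realType}.
Local Notation C := R[i].

Lemma lim0D (r r' : R -> R) (l l' : R) : lim0 r l -> lim0 r' l' ->
  lim0 (fun s => r s + r' s) (l + l').
Proof.
move=> h h' e e0; have e20 : 0 < e / 2 by lra.
have [D Dp k] := h _ e20; have [D' Dp' k'] := h' _ e20.
exists (Num.min D D'); first by rewrite lt_min Dp.
move=> s; rewrite lt_min => /and3P[s0 s1 s2].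
rewrite opprD addrACA; apply: le_trans (ler_normD _ _) _.
by have := k s; have := k' s; rewrite s0 s1 s2 => /(_ isT) ? /(_ isT) ?; lra.
Qed.

Lemma lim0Z (a : R) (r : R -> R) (l : R) : lim0 r l -> lim0 (fun s => a * r s) (a * l).
Proof.
move=> h e e0; have a0 : 0 < `|a| + 1 by rewrite ltr_wpDl.
have [D Dp k] := h _ (divr_gt0 e0 a0); exists D => // s /k {}k.
rewrite -mulrBr normrM; apply: le_trans (ler_wpM2l (normr_ge0 _) k) _.
rewrite mulrCA ler_piMr ?ltW// ltr_pdivrMr//; lra.
Qed.

Lemma lim0_eq (r r' : R -> R) (l : R) : (forall s, r s = r' s) -> lim0 r l -> lim0 r' l.
Proof. by move=> /funext <-. Qed.

Lemma pick_form_expand p k (A0 A1 B1 : 'M[C]_(p, k)) (s1 s2 a b : R) v w :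
    (forall v w, rdot (A0 *m v) (A0 *m w) = rdot v w) ->
  pick_form (A0 + s1%:C *: A1) (A0 + s2%:C *: B1) a b v w =
  - a * (2 * (s1 * rdot (A1 *m v) (A0 *m v)) + s1 ^+ 2 * nsq (A1 *m v))
  - 2 * (s1 * rdot (A1 *m v) (A0 *m w) + s2 * rdot (B1 *m w) (A0 *m v)
         + s1 * (s2 * rdot (A1 *m v) (B1 *m w)))
  - b * (2 * (s2 * rdot (B1 *m w) (A0 *m w)) + s2 ^+ 2 * nsq (B1 *m w)).
Proof.
move=> iA; rewrite /pick_form !mulmxDl -!scalemxAl.
move: (iA v v) (iA w w) (iA v w); move: (A0 *m v) (A0 *m w) (A1 *m v) (B1 *m w).
move=> x y x1 y1 hx hy hxy.
rewrite !nsqD !nsqZR /nsq hx hy !(rdotDl, rdotDr, rdotZl, rdotZr) hxy.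
by rewrite (rdotC x x1) (rdotC y y1) (rdotC x y1); ring.
Qed.

Variables (d : nat) (I : finType) (g : 'I_d -> I) (c0 : I).
Local Notation gcol := (gcol g).
Local Notation gball := (gball g).
Variable phi : graded_fun R d.
Hypothesis phi_int : forall m k (x : mxtuple R d m) (y : mxtuple R d k)
    (L : 'M[C]_(m, k)), gball x -> gball y ->
  (forall r, submxcol x r *m L = L *m submxcol y r) ->
  phi x *m L = L *m phi y.
Hypothesis phi_con : forall m (x : mxtuple R d m) v, gball x ->
  nsq (phi x *m v) <= nsq v.

(** T* H is self-adjoint in each group. On such a line the points T + z H with z
    in a disc tangent to the imaginary axis at 0 belong to the domain. *)
Definition gsym n (T H : mxtuple R d n) := forall c v w,
  rdot (gcol c H *m v) (gcol c T *m w) = rdot (gcol c H *m w) (gcol c T *m v).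

Section one_direction.
Variables (n : nat) (T H : mxtuple R d n) (W : 'M[C]_n) (al lam h : R).
Hypothesis J : julia_point g phi T W al.
Hypotheses (l0 : 0 < lam) (h0 : 0 < h).
Hypotheses (cH : inward g T lam H) (bH : gbounded g h H) (sH : gsym T H).

Local Notation f s := (diff_quot phi T W s H).
Local Notation beta s v w := (- rdot (f s *m v) (W *m w)).
Local Notation M := (8 * al * h ^+ 2 / lam).

Lemma phi_diff_quot (s : R) : 0 < s -> phi (T + s%:C *: H) = W + s%:C *: f s.
Proof.
move=> s0; rewrite /diff_quot scalerA -rmorphM divff ?gt_eqF// rmorph1 scale1r.
by rewrite [RHS]addrC subrK.
Qed.

Lemma beta_le (s : R) v w : 0 < s -> s * h ^+ 2 <= lam ->
  `|beta s v w| <= M * (l2norm v * l2norm w).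
Proof.
move=> s0 sh; have [_ _ _ _ [iW _]] := J.
have lW : l2norm (W *m w) = l2norm w by rewrite !l2normE iW.
have k : l2norm (f s *m v) * l2norm (W *m w) <= M * (l2norm v * l2norm w).
  rewrite lW mulrA; apply: ler_wpM2r; first exact: l2norm_ge0.
  by have := diff_quot_bounded c0 phi_int phi_con J l0 cH h0 bH s0 sh; apply.
rewrite normrN ler_norml; apply/andP; split.
  by apply: le_trans (rdot_ge _ _); rewrite lerN2.
exact: le_trans (rdot_le _ _) k.
Qed.

(** The weights are a small perturbation of the Szego-type Gram matrix
    (s1 + s2) / (s_i + s_j), for which the leading part of the form is
    -T* H tensored with the all-ones matrix; the factor 1 + E leaves room for
    the terms of second order. *)
Lemma pick_two_points (E s1 s2 : R) : 0 < E <= 1 -> 0 < s1 -> s1 <= s2 ->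
    4 * s2 * h ^+ 2 <= E * lam ->
  forall v w, 0 <= pick_form (phi (T + s1%:C *: H)) (phi (T + s2%:C *: H))
    ((1 + E) * (s1 + s2) / (2 * s1)) ((1 + E) * (s1 + s2) / (2 * s2)) v w.
Proof.
move=> /andP[E0 E1] s10 s12 sh; have [n0 iT al0 _ _] := J.
have s20 : 0 < s2 by lra.
have El : E * lam <= lam by rewrite ler_piMl// ltW.
have h20 : 0 < h ^+ 2 by rewrite exprn_gt0.
have sh2 : s2 * h ^+ 2 <= lam by have := mulr_gt0 s20 h20; lra.
have sh1 : s1 * h ^+ 2 <= lam.
  by apply: le_trans sh2; rewrite ler_pM2r.
have S0 : 0 < s1 + s2 by lra.
have s1n : s1 != 0 by rewrite gt_eqF.
have s2n : s2 != 0 by rewrite gt_eqF.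
apply: (pick_transfer phi_int phi_con (e := (s1 + s2) * (E * lam / 2))).
- exact: gball_inward n0 iT l0 cH bH s10 sh1.
- exact: gball_inward n0 iT l0 cH bH s20 sh2.
- by rewrite divr_gt0 ?mulr_gt0//; lra.
- rewrite -subr_gt0.
  have -> : (1 + E) * (s1 + s2) / (2 * s1) * ((1 + E) * (s1 + s2) / (2 * s2)) - 1 =
    ((1 + E) ^+ 2 * (s1 - s2) ^+ 2 + 4 * (2 * E + E ^+ 2) * (s1 * s2)) / (4 * s1 * s2).
    by field; rewrite s1n s2n.
  have p1 : 0 <= (1 + E) ^+ 2 * (s1 - s2) ^+ 2 by rewrite mulr_ge0 ?sqr_ge0.
  have p2 : 0 < 2 * E + E ^+ 2 by rewrite addr_gt0 ?mulr_gt0 ?exprn_gt0.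
  have p3 := mulr_gt0 p2 (mulr_gt0 s10 s20).
  by rewrite divr_gt0 ?mulr_gt0//; lra.
- by rewrite !mulr_gt0//; lra.
move=> c v w.
have Av := cH c v; have Aw := cH c w.
have := le_trans (mulr_ge0 (ltW l0) (nsq_ge0 _)) (cH c (v + w)).
have Bv := bH c v; have Bw := bH c w.
rewrite !gcolD !gcolZ pick_form_expand; last exact: rdot_giso.
rewrite !mulmxDr !(rdotDl, rdotDr) (sH c w v).
have := rdot_le (gcol c H *m v) (gcol c H *m w).
have := sqr_ge0 (l2norm (gcol c H *m v) - l2norm (gcol c H *m w)).
rewrite sqrrB !sqr_l2norm.
move: Av Aw Bv Bw; have := nsq_ge0 v; have := nsq_ge0 w.
have := nsq_ge0 (gcol c H *m v); have := nsq_ge0 (gcol c H *m w).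
set Avv := rdot (gcol c H *m v) (gcol c T *m v).
set Aww := rdot (gcol c H *m w) (gcol c T *m w).
set Avw := rdot (gcol c H *m v) (gcol c T *m w).
set Qvw := rdot (gcol c H *m v) (gcol c H *m w).
move: (nsq (gcol c H *m v)) (nsq (gcol c H *m w)) (l2norm _ * l2norm _) => Qv Qw z.
move: (nsq v) (nsq w) Avv Aww Avw Qvw.
move=> V U Avv Aww Avw Qvw Qw0 Qv0 U0 V0 Av Aw Bv Bw zle Qle Avw0.
pose p := s1 * s2 / (s1 + s2).
have p0 : 0 <= p by rewrite divr_ge0 ?mulr_ge0 ?ltW.
have p2 : p <= s2 by rewrite ler_pdivrMr// mulrC ler_pM2l//; lra.
rewrite [leRHS](_ : _ =
  (s1 + s2) * (- (Avv + Avw + (Avw + Aww)) + E * - Avv + E * - Aww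
     - (1 + E) / 2 * s1 * Qv - (1 + E) / 2 * s2 * Qw - 2 * p * Qvw)); last first.
  by rewrite /p; field; rewrite s1n s2n gt_eqF.
rewrite -mulrA; apply: ler_wpM2l; first exact: ltW.
have i1 : 2 * p * Qvw <= s2 * (Qv + Qw).
  apply: le_trans (_ : _ <= p * (Qv + Qw)) _; last by rewrite ler_wpM2r// addr_ge0.
  have : p * Qvw <= p * z by rewrite ler_wpM2l.
  have : 0 <= p * (Qv - z *+ 2 + Qw) by rewrite mulr_ge0.
  by lra.
have i2 : (1 + E) / 2 * s1 * Qv <= s2 * Qv.
  by apply: ler_wpM2r => //; nra.
have i3 : (1 + E) / 2 * s2 * Qw <= s2 * Qw.
  by apply: ler_wpM2r => //; nra.
have i4 : E * (lam * V) <= E * - Avv by rewrite ler_pM2l.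
have i5 : E * (lam * U) <= E * - Aww by rewrite ler_pM2l.
have i6 : s2 * (Qv + Qw) <= E * lam / 4 * (V + U).
  apply: le_trans (_ : _ <= s2 * (h ^+ 2 * (V + U))) _.
    by rewrite ler_pM2l//; lra.
  by rewrite mulrA; apply: ler_wpM2r; [exact: addr_ge0 | lra].
lra.
Qed.

(** Divide the Pick inequality for phi by s2. Since s1 / s2 is small, the mixed
    term only involves f at the larger parameter s2. *)
Lemma beta_two_points v w : exists Cst : R, 0 <= Cst /\ forall E, 0 < E <= 1 ->
  exists2 D, 0 < D & forall s1 s2, 0 < s2 < D -> 0 < s1 < E * s2 ->
    - (E * Cst) <= beta s1 v v + beta s2 w w + 2 * beta s2 w v.
Proof.
have [n0 iT al0 _ [iW _]] := J.
have h20 : 0 < h ^+ 2 by rewrite exprn_gt0.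
have M0 : 0 <= M by rewrite divr_ge0 ?mulr_ge0 ?ltW.
pose x := l2norm v; pose y := l2norm w.
have x0 : 0 <= x := l2norm_ge0 v; have y0 : 0 <= y := l2norm_ge0 w.
exists (3 * M * (x * x + y * y) + 2 * M * (x * y) + 2 * M ^+ 2 * (x * y)); split.
  move: M M0 => m m0.
  have xy : 0 <= x * y by exact: mulr_ge0.
  have q1 : 0 <= m * (x * x + y * y) by rewrite mulr_ge0 ?addr_ge0 ?mulr_ge0.
  have q2 : 0 <= m * (x * y) by rewrite mulr_ge0.
  have q3 : 0 <= m ^+ 2 * (x * y) by rewrite mulr_ge0 ?sqr_ge0.
  by lra.
move=> E /andP[E0 E1].
exists (Num.min 1 (E * lam / (4 * h ^+ 2))).
  by rewrite lt_min ltr01/= divr_gt0 ?mulr_gt0.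
move=> s1 s2; rewrite lt_min => /and3P[s20 s21 s2D] /andP[s10 s12E].
have s12 : s1 < s2 by apply: lt_le_trans s12E _; rewrite ler_piMl// ltW.
have sh : 4 * s2 * h ^+ 2 <= E * lam.
  by move: s2D; rewrite ltr_pdivlMr ?mulr_gt0//; lra.
have El : E * lam <= lam by rewrite ler_piMl// ltW.
have sh2 : s2 * h ^+ 2 <= lam by have := mulr_gt0 s20 h20; lra.
have sh1 : s1 * h ^+ 2 <= lam.
  by apply: le_trans sh2; rewrite ler_pM2r// ltW.
have s1n : s1 != 0 by rewrite gt_eqF.
have s2n : s2 != 0 by rewrite gt_eqF.
have E01 : 0 < E <= 1 by rewrite E0.
have := pick_two_points E01 s10 (ltW s12) sh v w.
have isoWd u u' : rdot (W *m u) (W *m u') = rdot u u'.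
  by have := nsqD (W *m u) (W *m u'); rewrite -mulmxDr !iW nsqD; lra.
rewrite (phi_diff_quot s10) (phi_diff_quot s20) pick_form_expand//.
have b1 := beta_le v v s10 sh1; have b2 := beta_le w w s20 sh2.
have b3 := beta_le v w s10 sh1.
have d1 : - (M * M * (x * y)) <= rdot (f s1 *m v) (f s2 *m w).
  apply: le_trans (rdot_ge _ _); rewrite lerN2 mulrACA; apply: ler_pM.
  - exact: l2norm_ge0.
  - exact: l2norm_ge0.
  - by have := diff_quot_bounded c0 phi_int phi_con J l0 cH h0 bH s10 sh1; apply.
  - by have := diff_quot_bounded c0 phi_int phi_con J l0 cH h0 bH s20 sh2; apply.
move: b1 b2 b3; rewrite !ler_norml -/x -/y => /andP[_ b1] /andP[_ b2] /andP[_ b3].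
have := nsq_ge0 (f s1 *m v); have := nsq_ge0 (f s2 *m w).
move: b1 b2 b3 d1 M0.
move: (rdot (f s1 *m v) (W *m v)) (rdot (f s2 *m w) (W *m w))
  (rdot (f s1 *m v) (W *m w)) (rdot (f s2 *m w) (W *m v)) (rdot (f s1 *m v) (f s2 *m w))
  (nsq (f s1 *m v)) (nsq (f s2 *m w)) M.
move=> B1 B2 B3 B4 B5 Q1 Q2 m b1 b2 b3 d1 M0 q2 q1.
pose th := s1 / s2.
have th0 : 0 < th by rewrite divr_gt0.
have thE : th <= E by rewrite ler_pdivrMr// ltW.
rewrite [X in 0 <= X](_ : _ =
   s2 * ((1 + E) * (1 + th) * (- B1 - B2) - 2 * th * B3 - 2 * B4 - 2 * s1 * B5
     - (1 + E) * (1 + th) / 2 * (s1 * Q1 + s2 * Q2))); last first.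
  by rewrite /th; field; rewrite s1n s2n.
rewrite pmulr_rge0// => hh.
clearbody th x y.
have k1 : 0 <= (1 + E) * (1 + th) / 2 * (s1 * Q1 + s2 * Q2).
  have e1 : 0 <= 1 + E by lra.
  have e2 : 0 <= 1 + th by lra.
  apply: mulr_ge0; first by rewrite divr_ge0 ?mulr_ge0.
  by rewrite addr_ge0 ?mulr_ge0 ?(ltW s10) ?(ltW s20).
have k2 : (E + th + E * th) * (- B1 - B2) <= 3 * E * (m * (x * x + y * y)).
  apply: le_trans (_ : _ <= (E + th + E * th) * (m * (x * x + y * y))) _.
    apply: ler_wpM2l; last by lra.
    by rewrite !addr_ge0 ?mulr_ge0 ?(ltW E0) ?(ltW th0).
  apply: ler_wpM2r; first by rewrite mulr_ge0// addr_ge0 ?mulr_ge0.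
  have Eth : E * th <= E by rewrite ler_piMr ?(ltW E0)//; exact: le_trans thE E1.
  by lra.
have k3 : th * - B3 <= E * (m * (x * y)).
  apply: le_trans (_ : _ <= th * (m * (x * y))) _; first by rewrite ler_pM2l.
  by apply: ler_wpM2r => //; rewrite !mulr_ge0.
have k4 : s1 * - B5 <= E * (m * m * (x * y)).
  apply: le_trans (_ : _ <= s1 * (m * m * (x * y))) _; first by rewrite ler_pM2l//; lra.
  apply: ler_wpM2r => //; first by rewrite !mulr_ge0.
  apply: ltW; apply: lt_trans s12E _.
  by rewrite gtr_pMr.
rewrite expr2; lra.
Qed.


Lemma beta_le_sq (s : R) v : 0 < s -> s * h ^+ 2 <= lam ->
  `|beta s v v| <= M * nsq v.
Proof. by move=> s0 sh; rewrite -sqr_l2norm expr2; exact: beta_le. Qed.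

(** For w = -v the two-point inequality says that the diagonal form at s1 is
    almost at least the one at s2. *)
Lemma beta_diag_lim v : exists l, lim0 (fun s => beta s v v) l.
Proof.
have h20 : 0 < h ^+ 2 by rewrite exprn_gt0.
apply: (@almost_monotone_lim0 _ _ (M * nsq v) (lam / h ^+ 2)).
- exact: divr_gt0.
- by move=> s /andP[s0]; rewrite ltr_pdivlMr// => /ltW sh; exact: beta_le_sq.
move=> e e0; have [Cst [C0 hC]] := beta_two_points v (- v).
pose E := Num.min 1 (e / (Cst + 1)).
have C1 : 0 < Cst + 1 by lra.
have E0 : 0 < E by rewrite lt_min ltr01 divr_gt0.
have EC : E * Cst <= e.
  apply: le_trans (_ : _ <= e / (Cst + 1) * Cst) _.
    by apply: ler_wpM2r => //; rewrite ge_min lexx orbT.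
  by rewrite mulrAC ler_pdivrMr// ler_pM2l//; lra.
have E01 : 0 < E <= 1 by rewrite E0 ge_min lexx.
have [D D0 hD] := hC E E01.
exists (Num.min D E); first by rewrite lt_min D0.
move=> s1 s2; rewrite lt_min => /and3P[s20 s2D _] /andP[s10 s12].
have := hD s1 s2; rewrite s20 s2D s10 => /(_ isT).
have -> : s1 < E * s2.
  by apply: lt_le_trans s12 _; rewrite ler_pM2r// ge_min lexx orbT.
move=> /(_ isT); move: (f s1) (f s2) => F1 F2.
rewrite !mulmxN !(rdotNl, rdotNr).
by move: (rdot (F1 *m v) _) (rdot (F2 *m v) _) => x1 x2; lra.
Qed.

(** For w = -(v + tau u) the diagonal terms cancel in the limit and the terms of
    first order in tau leave the antisymmetric part of the form. *)
Lemma beta_antisym v u e : 0 < e -> exists2 D, 0 < D & forall s, 0 < s < D ->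
  - e <= beta s v u - beta s u v.
Proof.
move=> e0; have h20 : 0 < h ^+ 2 by rewrite exprn_gt0.
have M0 : 0 <= M by have [_ _ al0 _ _] := J; rewrite divr_ge0 ?mulr_ge0 ?ltW.
pose m := M * nsq u + 1.
have m0 : 0 < m by rewrite ltr_wpDl// mulr_ge0 ?nsq_ge0.
have [tau tau0 tm] : exists2 tau, 0 < tau & tau * m = e / 2.
  by exists (e / (2 * m)); [rewrite divr_gt0 ?mulr_gt0|field; rewrite gt_eqF].
have [Cst [C0 hC]] := beta_two_points v (- (v + tau%:C *: u)).
have [l hl] := beta_diag_lim v.
have eta0 : 0 < e * tau / 8 by rewrite divr_gt0 ?mulr_gt0.
have [D1 D10 hD1] := hl _ eta0.
have C1 : 0 < Cst + 1 by lra.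
pose E := Num.min 1 (e * tau / 4 / (Cst + 1)).
have E0 : 0 < E by rewrite lt_min ltr01 !divr_gt0 ?mulr_gt0.
have EC : E * Cst <= e * tau / 4.
  apply: le_trans (_ : _ <= e * tau / 4 / (Cst + 1) * Cst) _.
    by apply: ler_wpM2r => //; rewrite ge_min lexx orbT.
  by rewrite mulrAC ler_pdivrMr// ler_pM2l ?divr_gt0 ?mulr_gt0//; lra.
have E01 : 0 < E <= 1 by rewrite E0 ge_min lexx.
have [D2 D20 hD2] := hC E E01.
exists (Num.min (Num.min D1 D2) (lam / h ^+ 2)).
  by rewrite !lt_min D10 D20 divr_gt0.
move=> s2; rewrite !lt_min => /andP[s20 /andP[/andP[s2D1 s2D2] sh]].
have {}sh : s2 * h ^+ 2 <= lam by move: sh; rewrite ltr_pdivlMr// => /ltW.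
pose s1 := E * s2 / 2.
have s10 : 0 < s1 by rewrite divr_gt0 ?mulr_gt0.
have s1E : s1 < E * s2 by have := mulr_gt0 E0 s20; rewrite /s1; lra.
have s12 : s1 < s2.
  by apply: lt_le_trans s1E _; rewrite ler_piMl ?(ltW s20)//; case/andP: E01.
have := hD2 s1 s2; rewrite s20 s2D2 s10 s1E => /(_ isT isT).
have := hD1 s1; have := hD1 s2.
rewrite s20 s2D1 s10 (lt_trans s12)// => /(_ isT) q2 /(_ isT) q1.
have := beta_le_sq u s20 sh.
move: q1 q2; move: (f s1) (f s2) => F1 F2.
rewrite !ler_norml => /andP[_ q1] /andP[q2 _] /andP[_ q3]; move: q1 q2 q3.
rewrite !(mulmxN, mulmxDr) -!scalemxAr.
rewrite !(rdotNl, rdotNr, rdotDl, rdotDr, rdotZl, rdotZr).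
move: (rdot (F1 *m v) (W *m v)) (rdot (F2 *m v) (W *m v)) (rdot (F2 *m v) (W *m u))
  (rdot (F2 *m u) (W *m v)) (rdot (F2 *m u) (W *m u)) => x1 x2 x3 x4 x5 q1 q2 q3 hh.
have q4 : tau * - x5 <= tau * m by rewrite ler_pM2l//; rewrite /m; lra.
have q5 : tau * (tau * - x5) <= tau * (e / 2) by rewrite ler_pM2l// -tm.
suff : tau * - e <= tau * (- x3 - - x4) by rewrite ler_pM2l.
lra.
Qed.

(** Polarization recovers the symmetric part from the diagonal, which converges;
    the antisymmetric part tends to 0 by the inequality for (v, u) and (u, v). *)
Lemma julia_caratheodory_sym : exists L, mxlim0 (fun s => f s) L.
Proof.
have [_ _ _ _ [_ [Wi hWi]]] := J.
apply: weak_lim0 => v w.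
pose u := Wi *m w; have -> : w = W *m u by rewrite mulmxA hWi mul1mx.
have [l1 h1] := beta_diag_lim (v + u).
have [l2 h2] := beta_diag_lim (v - u).
have h3 : lim0 (fun s => beta s v u - beta s u v) 0.
  move=> e e0; have [D D0 hD] := beta_antisym v u e0.
  have [D' D'0 hD'] := beta_antisym u v e0.
  exists (Num.min D D'); first by rewrite lt_min D0.
  move=> s; rewrite lt_min => /and3P[s0 sD sD'].
  have := hD s; have := hD' s; rewrite s0 sD sD' => /(_ isT) q1 /(_ isT) q2.
  by rewrite subr0 ler_norml; apply/andP; split; lra.
exists (- (4^-1 * l1) + (4^-1 * l2) - 2^-1 * 0).
have := lim0D (lim0D (lim0Z (- 4^-1) h1) (lim0Z 4^-1 h2)) (lim0Z (- 2^-1) h3).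
rewrite !mulNr; apply: lim0_eq => s /=; move: (f s) => F.
rewrite !(mulmxDr, mulmxN) !(rdotDl, rdotDr, rdotNl, rdotNr).
move: (rdot (F *m v) (W *m v)) (rdot (F *m v) (W *m u)) (rdot (F *m u) (W *m v))
  (rdot (F *m u) (W *m u)) => x1 x2 x3 x4. lra.
Qed.

End one_direction.
End radial_limits.

(** * Propagation of convergence along complex lines *)

Section continuation.
Context {R : realType}.
Local Notation C := R[i].
Local Notation normc := Normc.normc.

Lemma lagrange_rule N (z : nat -> C) :
    (forall i j : nat, (i < N)%N -> (j < N)%N -> z i = z j -> i = j) ->
  exists c : 'I_N -> C, exact_rule z c.
Proof.
move=> zinj.
pose ell (i : 'I_N) : {poly C} := \prod_(j < N | j != i) ('X - (z j)%:P).
have ellE i x : (ell i).[x] = \prod_(j < N | j != i) (x - z j).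
  by rewrite horner_prod; apply: eq_bigr => j _; rewrite hornerXsubC.
have ell0 i : (ell i).[z i] != 0.
  rewrite ellE; apply/prodf_neq0 => j ji.
  rewrite subr_eq0; apply: contra ji => /eqP zij; apply/eqP/val_inj/esym.
  exact: zinj (ltn_ord i) (ltn_ord j) zij.
have ellj i j : j != i -> (ell i).[z j] = 0.
  by move=> ji; rewrite ellE (bigD1 j)//= subrr mul0r.
exists (fun i => (ell i).[z N] / (ell i).[z i]) => p sp.
pose q : {poly C} := \sum_(i < N) (p.[z i] / (ell i).[z i]) *: ell i.
have sq : (size q <= N)%N.
  apply: leq_trans (size_sum _ _ _) _; apply/bigmax_leqP => i _.
  apply: leq_trans (size_scale_leq _ _) _.
  rewrite /ell -big_filter size_prod_XsubC.
  rewrite size_filter; have := count_predC (pred1 i) (index_enum 'I_N).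
  rewrite count_uniq_mem ?index_enum_uniq// mem_index_enum add1n.
  by move=> ->; rewrite /index_enum -enumT size_enum_ord.
have pq : p = q.
  apply/eqP; rewrite -subr_eq0; apply/eqP.
  have := @roots_geq_poly_eq0 _ (p - q) [seq z (nat_of_ord i) | i <- enum (ordinal N)]. apply.
  - apply/allP => _ /mapP[i _ ->]; rewrite rootE hornerD hornerN subr_eq0.
    rewrite horner_sum (bigD1 i)//= hornerZ divfK// big1 ?addr0// => j ji.
    by rewrite hornerZ (ellj j i) ?mulr0// eq_sym.
  - rewrite map_inj_in_uniq ?enum_uniq// => i j _ _ /zinj h.
    exact: val_inj (h (ltn_ord i) (ltn_ord j)).
  - rewrite size_map size_enum_ord; apply: leq_trans (size_polyD _ _) _.
    by rewrite size_polyN geq_max sp.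
rewrite [in LHS]pq horner_sum; apply: eq_bigr => i _.
by rewrite hornerZ; ring.
Qed.

Lemma mxlim0Z m k (F : R -> 'M[C]_(m, k)) L (a : C) : mxlim0 F L ->
  mxlim0 (fun s => a *: F s) (a *: L).
Proof.
move=> h e e0; have a0 : 0 < normc a + 1 by rewrite ltr_wpDl ?normc_ge0.
have [D Dp hD] := h _ (divr_gt0 e0 a0); exists D => // s /hD {}hD v.
rewrite -scalerBr -scalemxAl l2normZ.
apply: le_trans (ler_wpM2l (normc_ge0 _) (hD v)) _.
rewrite mulrA; apply: ler_wpM2r; first exact: l2norm_ge0.
rewrite mulrCA ler_piMr ?ltW// ltr_pdivrMr//; lra.
Qed.

Lemma mxlim0D m k (F F' : R -> 'M[C]_(m, k)) L L' : mxlim0 F L -> mxlim0 F' L' ->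
  mxlim0 (fun s => F s + F' s) (L + L').
Proof.
move=> h h' e e0; have e20 : 0 < e / 2 by lra.
have [D Dp hD] := h _ e20; have [D' Dp' hD'] := h' _ e20.
exists (Num.min D D'); first by rewrite lt_min Dp.
move=> s; rewrite lt_min => /and3P[s0 s1 s2] v.
rewrite opprD addrACA mulmxDl; apply: le_trans (l2normD _ _) _.
have := hD s; have := hD' s; rewrite s0 s1 s2 => /(_ isT v) q1 /(_ isT v) q2.
by apply: le_trans (lerD q2 q1) _; rewrite -mulrDl -splitr.
Qed.

Lemma mxlim0_cst m k (L : 'M[C]_(m, k)) : mxlim0 (fun => L) L.
Proof.
move=> e e0; exists 1 => // s _ v.
by rewrite subrr mul0mx l2norm0 mulr_ge0 ?l2norm_ge0 ?ltW.
Qed.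

Lemma mxlim0_eq m k (F F' : R -> 'M[C]_(m, k)) L :
  (forall s, F s = F' s) -> mxlim0 F L -> mxlim0 F' L.
Proof. by move=> /funext <-. Qed.

Lemma mxlim0_sum m k N (F : 'I_N -> R -> 'M[C]_(m, k)) (L : 'I_N -> 'M[C]_(m, k)) :
  (forall i, mxlim0 (F i) (L i)) ->
  mxlim0 (fun s => \sum_i F i s) (\sum_i L i).
Proof.
elim: N F L => [|N IH] F L h.
  rewrite big_ord0; apply: mxlim0_eq (mxlim0_cst 0) => s.
  by rewrite big_ord0.
rewrite big_ord_recr; apply: mxlim0_eq (mxlim0D (IH _ _ _) (h ord_max)) => [s|i].
  by rewrite big_ord_recr.
exact: h.
Qed.

(** Discs of radius rho / 4 centred at equally spaced points of the segment from
    a to b: each disc contains the segment back from the next centre, from which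
    the hypothesis recovers the next disc. The first one comes from real
    translates of a. *)
Lemma chain_of_balls (P : C -> Prop) (a b : C) (rho : R) : 0 < rho ->
    (forall (s : R) u, 0 <= s <= 1 -> u != 0 -> normc u <= 1 ->
      (forall x : R, 0 <= x <= 1 / 4 -> P (a + s%:C * (b - a) + rho%:C * (x%:C * u))) ->
      forall y, normc y <= 1 / 4 -> P (a + s%:C * (b - a) + rho%:C * y)) ->
    (forall x : R, 0 <= x <= rho / 4 -> P (a + x%:C)) ->
  P b.
Proof.
move=> rho0 step start.
have [<-|ab] := eqVneq a b.
  by have := start 0; rewrite rmorph0 addr0; apply; lra.
have [m0 m0P] : exists m : nat, normc (b - a) * 4 / rho < m%:R.
  by exists (Num.bound (normc (b - a) * 4 / rho)); apply: archi_boundP;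
    rewrite divr_ge0 ?mulr_ge0 ?normc_ge0 ?ltW.
pose m := m0.+1; have mp : 0 < m%:R :> R by rewrite ltr0n.
have hm : normc (b - a) * 4 / rho <= m%:R.
  by apply: ltW; apply: lt_le_trans m0P _; rewrite ler_nat.
have rn0 : rho != 0 by rewrite gt_eqF.
have mn0 : m%:R != 0 :> R by rewrite gt_eqF.
have key : forall j : nat, (j <= m)%N -> forall y, normc y <= 1 / 4 ->
    P (a + (j%:R / m%:R)%:C * (b - a) + rho%:C * y).
  elim=> [_|j IH jm].
    apply: (step _ 1); rewrite ?oner_neq0 ?Normc.normc1//.
      by rewrite mul0r lexx ler01.
    move=> x x01; rewrite mul0r rmorph0 mul0r addr0 mulr1 -rmorphM.
    by apply: start; rewrite mulr_ge0//; [nra | lra | lra].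
  pose u : C := - ((4 / (m%:R * rho))%:C * (b - a)).
  have nu : normc u = 4 / (m%:R * rho) * normc (b - a).
    rewrite normcN Normc.normcM normcR ger0_norm//.
    by rewrite divr_ge0 ?mulr_ge0 ?ltW.
  have nu1 : normc u <= 1.
    rewrite nu mulrAC ler_pdivrMr ?mulr_gt0// mul1r.
    by move: hm; rewrite ler_pdivrMr//; lra.
  apply: (step _ u) => //.
  - apply/andP; split; first by rewrite divr_ge0 ?ler0n.
    by rewrite ler_pdivrMr// mul1r ler_nat.
  - rewrite oppr_eq0 mulf_neq0//; last by rewrite subr_eq0 eq_sym.
    by rewrite fmorph_eq0 mulf_neq0 ?invr_eq0 ?mulf_neq0.
  move=> x x01.
  have := IH (ltnW jm) (((1 - 4 * x) / (m%:R * rho))%:C * (b - a)).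
  rewrite Normc.normcM normcR => /(_ _).
  set Q := (X in P X); set Q' := (X in _ -> P X).
  suff -> : Q = Q'.
    apply; rewrite ger0_norm; last first.
      apply: divr_ge0; first by lra.
      by rewrite mulr_ge0 ?ler0n// ltW.
    apply: le_trans (_ : _ <= 1 / (m%:R * rho) * normc (b - a)) _.
      apply: ler_wpM2r; first exact: normc_ge0.
      apply: ler_wpM2r; last by lra.
      by rewrite invr_ge0 mulr_ge0 ?ler0n// ltW.
    by move: nu1; rewrite nu; lra.
  rewrite /Q /Q' /u -!addrA; congr (_ + _).
  have gen (q1 q2 q3 q4 : R) (w : C) : q2 + rho * q3 = q4 - rho * (x * q1) ->
     q2%:C * w + rho%:C * (q3%:C * w) = q4%:C * w + rho%:C * (x%:C * - (q1%:C * w)).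
    move=> q; transitivity ((q2 + rho * q3)%:C * w).
      by rewrite rmorphD rmorphM; ring.
    by rewrite q rmorphB !rmorphM; ring.
  by apply: gen; rewrite -natr1; field; rewrite rn0 mn0.
have := key m (leqnn m) 0; rewrite divff// rmorph1 mulr0 addr0 !mul1r.
rewrite (addrC a) subrK.
by apply; rewrite Normc.normc0; lra.
Qed.

(** Interpolation nodes on the segment from 0 to u / 4: all of them are at
    distance at most 1/2 from a target y in the disc of radius 1/4, so the
    remainder of the interpolation decays like 2^-N. *)
Lemma ray_rule (u y : C) N : u != 0 -> normc u <= 1 -> normc y <= 1 / 4 ->
  exists (z : nat -> C) (c : 'I_N -> C), [/\ z N = y,
    forall i : 'I_N, exists2 a : R, 0 <= a <= 1 / 4 & z i = a%:C * u,
    forall i, (i <= N)%N -> normc (z i) <= 1, exact_rule z c &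
    \prod_(i < N) normc (z N - z i) <= (1 / 2) ^+ N].
Proof.
move=> u0 u1 y1.
pose a (i : nat) : R := i%:R / (4 * N.+1%:R).
have N1 : 0 < N.+1%:R :> R by rewrite ltr0n.
have a01 i : (i < N)%N -> 0 <= a i <= 1 / 4.
  move=> iN; rewrite /a divr_ge0 ?mulr_ge0 ?ler0n//= ler_pdivrMr ?mulr_gt0//.
  have : i%:R <= N.+1%:R :> R by rewrite ler_nat ltnW// ltnW.
  by lra.
pose z (i : nat) : C := if (i < N)%N then (a i)%:C * u else y.
have zN : z N = y by rewrite /z ltnn.
have nz i : (i < N)%N -> normc (z i) <= 1 / 4.
  move=> iN; rewrite /z iN Normc.normcM normcR; have /andP[p q] := a01 i iN.
  by rewrite ger0_norm//; apply: le_trans q; rewrite ler_piMr.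
have zinj : forall i j : nat, (i < N)%N -> (j < N)%N -> z i = z j -> i = j.
  move=> i j iN jN; rewrite /z iN jN => /(mulIf u0) /complexI.
  move=> /(@mulIf _ (4 * N.+1%:R)^-1); rewrite invr_eq0 mulf_neq0 ?gt_eqF//.
  by move=> /(_ isT)/eqP; rewrite eqr_nat => /eqP.
have [c hc] := lagrange_rule zinj.
exists z, c; split => // [i|i|].
- by exists (a i); [exact: a01 | rewrite /z ltn_ord].
- rewrite leq_eqVlt => /orP[/eqP ->|/nz iN]; last by lra.
  by rewrite zN; lra.
- rewrite -[X in _ ^+ X](card_ord N) -prodr_const; apply: ler_prod => i _.
  rewrite normc_ge0 /=; apply: le_trans (le_normcD _ _) _.
  by rewrite normcN zN; have := nz i (ltn_ord i); lra.
Qed.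

Lemma half_power_small (B e : R) : 0 <= B -> 0 < e ->
  exists N : nat, B * (1 / 2) ^+ N <= e.
Proof.
move=> B0 e0; have Be : 0 <= B / e := divr_ge0 B0 (ltW e0).
have [N] : exists N : nat, B / e < N%:R.
  by exists (Num.bound (B / e)); exact: archi_boundP.
rewrite ltr_pdivrMr// => hB; exists N.
have N2 : N%:R <= 2 ^+ N :> R by rewrite -natrX ler_nat ltnW// ltn_expl.
have p0 : 0 < 2 ^+ N :> R by rewrite exprn_gt0.
rewrite expr_div_n expr1n mul1r ler_pdivrMr//.
have : N%:R * e <= 2 ^+ N * e by rewrite ler_wpM2r// ltW.
by move: (2 ^+ N) (N%:R) hB {N2 p0} => q1 q2; lra.
Qed.

Variables (d : nat) (I : finType) (g : 'I_d -> I) (c0 : I).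
Local Notation gcol := (gcol g).
Local Notation gball := (gball g).
Variable phi : graded_fun R d.
Hypothesis phi_int : forall m k (x : mxtuple R d m) (y : mxtuple R d k)
    (L : 'M[C]_(m, k)), gball x -> gball y ->
  (forall r, submxcol x r *m L = L *m submxcol y r) ->
  phi x *m L = L *m phi y.
Hypothesis phi_con : forall m (x : mxtuple R d m) v, gball x ->
  nsq (phi x *m v) <= nsq v.
Variables (n : nat) (T : mxtuple R d n) (W : 'M[C]_n) (al : R).
Hypothesis J : julia_point g phi T W al.

Definition has_dirderiv (H : mxtuple R d n) :=
  exists L, mxlim0 (fun t => diff_quot phi T W t H) L.

(** The interpolation error is small uniformly in t, and the interpolant is a
    fixed linear combination of convergent quotients; hence the quotients at y are
    Cauchy. *)
Lemma vitali_step (H K : mxtuple R d n) (lam h : R) (u : C) :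
    0 < lam -> lam <= h -> inward g T lam H -> gbounded g h H -> gbounded g (lam / 4) K ->
    u != 0 -> normc u <= 1 ->
    (forall x : R, 0 <= x <= 1 / 4 -> has_dirderiv (H + (x%:C * u) *: K)) ->
  forall y, normc y <= 1 / 4 -> has_dirderiv (H + y *: K).
Proof.
move=> l0 lh cH bH bK u0 u1 hx y y1.
have [_ _ al0 _ _] := J.
have h0 : 0 < h by lra.
have M0 : 0 <= 64 * al * h ^+ 2 / lam.
  by apply: ltW; rewrite divr_gt0 ?mulr_gt0 ?exprn_gt0.
apply: weak_lim0 => v w; apply: cauchy_lim0 => e e0.
pose B := 64 * al * h ^+ 2 / lam * (l2norm v * l2norm w).
have B0 : 0 <= B := mulr_ge0 M0 (mulr_ge0 (l2norm_ge0 v) (l2norm_ge0 w)).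
have e40 : 0 < e / 4 by rewrite divr_gt0.
have [N hN] := half_power_small B0 e40.
have [z [c [zN zi z1 hc pr]]] := ray_rule N u0 u1 y1.
have /choice[Ls hLs] (i : 'I_N) : exists L, mxlim0 (fun t => diff_quot phi T W t (H + z i *: K)) L.
  by have [a a01 ->] := zi i; exact: hx.
have hS := mxlim0_sum (fun i => mxlim0Z (c i) (hLs i)).
have [D D0 hD] := mxlim0_dot v w hS e40.
have t00 : 0 < lam / (8 * h ^+ 2) by rewrite divr_gt0 ?mulr_gt0 ?exprn_gt0.
have key t : 0 < t < Num.min D (lam / (8 * h ^+ 2)) ->
    `|rdot (diff_quot phi T W t (H + y *: K) *m v) w -
      rdot ((\sum_i c i *: Ls i) *m v) w| <= e / 2.
  rewrite lt_min => /and3P[t0 tD th].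
  have {}th : 8 * t * h ^+ 2 <= lam.
    by move: th; rewrite ltr_pdivlMr ?mulr_gt0 ?exprn_gt0//; lra.
  have := newton_interp c0 phi_int phi_con J l0 lh cH bH bK z1 hc t0 th v.
  rewrite zN in pr *; move=> hni.
  set A := (X in l2norm (X *m v) <= _) in hni.
  have bA : l2norm (A *m v) * l2norm w <= e / 4.
    apply: le_trans hN; rewrite /B.
    apply: le_trans (ler_wpM2r (l2norm_ge0 w) hni) _.
    rewrite [leRHS]mulrAC [leRHS]mulrA; apply: ler_wpM2r; first exact: l2norm_ge0.
    by apply: ler_wpM2r; [exact: l2norm_ge0 | exact: ler_wpM2l].
  have tD' : 0 < t < D by rewrite t0.
  have hq : `|rdot ((\sum_(i < N) c i *: diff_quot phi T W t (H + z i *: K)) *m v) w -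
      rdot ((\sum_i c i *: Ls i) *m v) w| <= e / 4 := hD t tD'.
  have := rdot_le (A *m v) w; have := rdot_ge (A *m v) w.
  rewrite [rdot _ _](_ : _ = rdot (diff_quot phi T W t (H + y *: K) *m v) w -
     rdot ((\sum_(i < N) c i *: diff_quot phi T W t (H + z i *: K)) *m v) w); last first.
    by rewrite /A mulmxBl rdotBl.
  move: bA hq; rewrite !ler_norml.
  move: (rdot _ w) (rdot _ w) (rdot _ w) (l2norm _ * _) => r1 r2 r3 r4.
  by move=> bA /andP[q1 q2] q3 q4; apply/andP; split; lra.
exists (Num.min D (lam / (8 * h ^+ 2))); first by rewrite lt_min D0.
move=> t t' /key k1 /key; rewrite distrC => k2.
rewrite -[X in `|X|](subrKA (rdot ((\sum_i c i *: Ls i) *m v) w)).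
by apply: le_trans (ler_normD _ _) _; lra.
Qed.

End continuation.

(** * Convergence in every inward direction *)

Section all_directions.
Context {R : realType}.
Local Notation C := R[i].
Local Notation normc := Normc.normc.
Local Open Scope sesquilinear_scope.
Variables (d : nat) (I : finType) (g : 'I_d -> I) (c0 : I).
Local Notation gcol := (gcol g).
Local Notation gball := (gball g).

Lemma rdot_iN n (v w : 'cV[C]_n) : rdot ('i%C *: v) w = - rdot v ('i%C *: w).
Proof.
rewrite -sumrN; apply: eq_bigr => i _; rewrite !mxE.
by case: (v i 0) (w i 0) => a b [e f] /=; ring.
Qed.

Lemma rdot_adjC m n (A : 'M[C]_(m, n)) x w : rdot (A ^t* *m x) w = rdot x (A *m w).
Proof. by rewrite [LHS]rdotC -rdot_adj rdotC. Qed.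

Lemma gbounded_ex n (H : mxtuple R d n) : exists2 h : R, 0 <= h & gbounded g h H.
Proof.
pose b c := \sum_j \sum_i normc (gcol c H i j).
have b0 c : 0 <= b c.
  by apply: sumr_ge0 => j _; apply: sumr_ge0 => i _; exact: normc_ge0.
exists (\sum_c b c); first by apply: sumr_ge0.
apply/gboundedP; first by apply: sumr_ge0.
move=> c v; apply: le_trans (l2norm_mulmx_le _ _) _.
apply: ler_wpM2r; first exact: l2norm_ge0.
by rewrite -/(b c) [leRHS](bigD1 c)//= lerDl sumr_ge0.
Qed.

(** Half of A* - A for A = T* H: the skew-adjoint part to be cancelled. *)
Definition skew_part n (T H : mxtuple R d n) (c : I) : 'M[C]_n :=
  (2^-1)%:C *: ((gcol c T ^t* *m gcol c H) ^t* - gcol c T ^t* *m gcol c H).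

(** The direction K with T* K equal to the skew part, so that T* (H + K) is
    self-adjoint. Multiplying K by i makes T* K self-adjoint too, which gives a
    complex line through H with a real segment of self-adjoint directions. *)
Definition skew_dir n (T H : mxtuple R d n) : mxtuple R d n :=
  \mxcol_(r < d) (submxcol T r *m skew_part T H (g r)).

Lemma gcol_skew_dir c n (T H : mxtuple R d n) :
  gcol c (skew_dir T H) = gcol c T *m skew_part T H c.
Proof.
rewrite mxcol_mul; apply: eq_mxcol => r; rewrite mxcolK.
by case: eqP => [->|_]; rewrite ?mul0mx.
Qed.

Lemma rdot_skew_part n (T H : mxtuple R d n) c v w :
  rdot (skew_part T H c *m v) w =
  2^-1 * (rdot (gcol c H *m w) (gcol c T *m v) - rdot (gcol c H *m v) (gcol c T *m w)).
Proof.
rewrite -scalemxAl rdotZl mulmxBl rdotBl rdot_adjC -!mulmxA rdot_adjC; congr (_ * (_ - _)).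
by rewrite rdotC rdot_adjC.
Qed.

Lemma gsym_real_dir n (T H : mxtuple R d n) (x : R) : giso g T ->
  gsym g T (H + skew_dir T H + x%:C *: ('i%C *: skew_dir T H)).
Proof.
move=> iT c v w; rewrite !gcolD !gcolZ !gcol_skew_dir !mulmxDl -!scalemxAl -!mulmxA.
have E (x1 y1 w1 : 'cV[C]_(\sum_(r < d) n)) :
    rdot (x1 + y1 + x%:C *: ('i%C *: y1)) w1 =
    rdot x1 w1 + rdot y1 w1 - x * rdot y1 ('i%C *: w1).
  by rewrite !(rdotDl, rdotZl) rdot_iN; ring.
rewrite (E _ _ (gcol c T *m w)) (E _ _ (gcol c T *m v)) {E}.
rewrite !scalemxAr !(rdot_giso iT) !rdot_skew_part -!scalemxAr !rdot_iN.
move: (rdot _ _) (rdot _ _) (rdot _ _) (rdot _ _) => r1 r2 r3 r4; by field.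
Qed.

Variable phi : graded_fun R d.
Hypothesis phi_int : forall m k (x : mxtuple R d m) (y : mxtuple R d k)
    (L : 'M[C]_(m, k)), gball x -> gball y ->
  (forall r, submxcol x r *m L = L *m submxcol y r) ->
  phi x *m L = L *m phi y.
Hypothesis phi_con : forall m (x : mxtuple R d m) v, gball x ->
  nsq (phi x *m v) <= nsq v.
Variables (n : nat) (T : mxtuple R d n) (W : 'M[C]_n) (al : R).
Hypothesis J : julia_point g phi T W al.

(** The line is H + K + z (i K): self-adjoint for real z and equal to H at z = i.
    On the segment from 0 to i the real part of T* H is constant, so one radius
    serves for the whole chain of discs. *)
Lemma dirderiv_exists (H : mxtuple R d n) (lam : R) : 0 < lam -> inward g T lam H ->
  has_dirderiv phi T W H.
Proof.
move=> l0 cH; have [n0 iT al0 _ _] := J.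
pose K := skew_dir T H; pose K' : mxtuple R d n := 'i%C *: K.
have [h1 h10 bH] := gbounded_ex H; have [k k0 bK] := gbounded_ex K.
have ni : normc ('i%C : C) = 1 by rewrite /= expr0n expr1n add0r sqrtr1.
have bK' : gbounded g k K' by have := gboundedZ 'i%C bK; rewrite ni mul1r.
have k1 : 0 < k + 1 by lra.
have [rho rho0 rhok] : exists2 rho, 0 < rho & rho * k <= lam / 4.
  exists (lam / (4 * (k + 1))); first by rewrite divr_gt0 ?mulr_gt0.
  rewrite mulrAC ler_pdivrMr ?mulr_gt0//; have := mulr_gt0 l0 k1; lra.
pose P (x : C) := has_dirderiv phi T W (H + K + x *: K').
suff : P 'i%C by rewrite /P /K' scalerA -expr2 sqr_i scaleN1r addrK.
have [h hE] : exists h, h = h1 + k + k + lam by exists (h1 + k + k + lam).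
have lh : lam <= h by lra.
have h0 : 0 < h by lra.
have skew0 c v : rdot (gcol c K *m v) (gcol c T *m v) = 0.
  rewrite gcol_skew_dir -mulmxA (rdot_giso iT) rdot_skew_part; lra.
have cone_real (y : R) : inward g T lam (H + y%:C *: K).
  move=> c v; rewrite gcolD gcolZ mulmxDl -scalemxAl rdotDl rdotZl skew0 mulr0 addr0.
  exact: cH.
apply: (@chain_of_balls _ P 0 'i%C rho) => //.
  move=> s u /andP[s0 s1] u0 u1 hx y y1.
  rewrite add0r subr0 in hx *.
  pose p : C := s%:C * 'i%C.
  have E q : H + K + (p + rho%:C * q) *: K' = H + K + p *: K' + q *: (rho%:C *: K').
    by rewrite scalerDl scalerA (mulrC q) addrA.
  have pE : H + K + p *: K' = H + (1 - s)%:C *: K.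
    rewrite /K' scalerA /p -mulrA -expr2 sqr_i mulrN1 rmorphB rmorph1 scalerBl scale1r.
    by rewrite scaleNr addrA.
  rewrite /P -/p E; apply: (vitali_step c0 phi_int phi_con J l0 lh _ _ _ u0 u1 _ y1).
  - by rewrite pE; exact: cone_real.
  - have s2 : normc (1 - s)%:C <= 1 by rewrite normcR ger0_norm; lra.
    have nK : 0 <= normc (1 - s)%:C * k by rewrite mulr_ge0 ?normc_ge0.
    have nK1 : normc (1 - s)%:C * k <= k by rewrite ler_piMl.
    rewrite pE; apply: gbounded_le (gbounded_add h10 nK bH (gboundedZ _ bK)); first exact: addr_ge0.
    lra.
  - have := gboundedZ rho%:C bK'; rewrite normcR ger0_norm ?(ltW rho0)//.
    by apply: gbounded_le => //; exact: mulr_ge0 (ltW rho0) k0.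
  - by move=> x /hx; rewrite /P E.
move=> x /andP[x0 x1]; rewrite add0r.
have xk : x * k <= lam / 4.
  apply: le_trans rhok; rewrite ler_wpM2r//; lra.
have bx := gboundedZ x%:C bK'; rewrite normcR ger0_norm// in bx.
have xk0 : 0 <= x * k by rewrite mulr_ge0.
have cK1 := cone_real 1; rewrite rmorph1 scale1r in cK1.
apply: (julia_caratheodory_sym c0 phi_int phi_con J (lam := lam / 2) (h := h)) => //.
- lra.
- by apply: inward_le (inward_add iT xk0 cK1 bx); lra.
- apply: gbounded_le (gbounded_add _ xk0 (gbounded_add h10 k0 bH bK) bx).
  + by rewrite !addr_ge0.
  + have : x * k <= lam by lra.
    lra.
  + exact: addr_ge0.
- exact: gsym_real_dir.
Qed.

End all_directions.

(** * Interpolation and homogeneity of the limit *)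

Section directional_derivative.
Context {R : realType}.
Local Notation C := R[i].
Local Notation normc := Normc.normc.
Variables (d : nat) (I : finType) (g : 'I_d -> I) (c0 : I).
Local Notation gcol := (gcol g).
Local Notation gball := (gball g).
Variable phi : graded_fun R d.
Hypothesis phi_int : forall m k (x : mxtuple R d m) (y : mxtuple R d k)
    (L : 'M[C]_(m, k)), gball x -> gball y ->
  (forall r, submxcol x r *m L = L *m submxcol y r) ->
  phi x *m L = L *m phi y.
Hypothesis phi_con : forall m (x : mxtuple R d m) v, gball x ->
  nsq (phi x *m v) <= nsq v.
Variables (n : nat) (T : mxtuple R d n) (W : 'M[C]_n) (al : R).
Hypothesis J : julia_point g phi T W al.
Variable eta : mxtuple R d n -> 'M[C]_n.
Hypothesis eta_lim : forall (H : mxtuple R d n) (lam : R), 0 < lam -> inward g T lam H ->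
  mxlim0 (fun t => diff_quot phi T W t H) (eta H).

Lemma eta_interp N (H K : mxtuple R d n) (lam h : R) (z : nat -> C) (c : 'I_N -> C) :
    0 < lam -> lam <= h -> inward g T lam H -> gbounded g h H ->
    gbounded g (lam / 4) K -> (forall i, (i <= N)%N -> normc (z i) <= 1) ->
    exact_rule z c ->
  forall v, l2norm ((eta (H + z N *: K) - \sum_(i < N) c i *: eta (H + z i *: K)) *m v)
     <= 64 * al * h ^+ 2 / lam * \prod_(i < N) normc (z N - z i) * l2norm v.
Proof.
move=> l0 lh cH bH bK z1 exz v.
have [n0 iT al0 _ _] := J.
have h0 : 0 < h by lra.
have lim i : (i <= N)%N ->
    mxlim0 (fun t => diff_quot phi T W t (H + z i *: K)) (eta (H + z i *: K)).
  move=> /z1 zi; have zK := gboundedZ (z i) bK.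
  have zK0 : 0 <= normc (z i) * (lam / 4) by rewrite mulr_ge0 ?normc_ge0//; lra.
  have zK1 : normc (z i) * (lam / 4) <= lam / 4 by rewrite ler_piMl//; lra.
  have l20 : 0 < lam / 2 by lra.
  by apply: (eta_lim l20); apply: inward_le (inward_add iT zK0 cH zK); lra.
have limS := mxlim0_sum (fun i : 'I_N => mxlim0Z (- c i) (lim i (ltnW (ltn_ord i)))).
have := mxlim0D (lim N (leqnn N)) limS.
have t00 : 0 < lam / (8 * h ^+ 2) by rewrite divr_gt0 ?mulr_gt0 ?exprn_gt0.
rewrite (_ : \sum_i _ = - \sum_(i < N) c i *: eta (H + z i *: K)); last first.
  by rewrite -sumrN; apply: eq_bigr => i _; rewrite scaleNr.
apply: mxlim0_le t00 _ => t /andP[t0].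
rewrite ltr_pdivlMr ?mulr_gt0 ?exprn_gt0// => th.
have {}th : 8 * t * h ^+ 2 <= lam by lra.
have := newton_interp c0 phi_int phi_con J l0 lh cH bH bK z1 exz t0 th v.
rewrite (_ : \sum_i - c i *: _ = - \sum_(i < N) c i *: diff_quot phi T W t (H + z i *: K))//.
by rewrite -sumrN; apply: eq_bigr => i _; rewrite scaleNr.
Qed.

Lemma eta_homogeneousR (H : mxtuple R d n) (lam a : R) : 0 < lam -> inward g T lam H ->
  0 < a -> eta (a%:C *: H) = a%:C *: eta H.
Proof.
move=> l0 cH a0.
have al0 : 0 < a * lam by exact: mulr_gt0.
have caH : inward g T (a * lam) (a%:C *: H).
  move=> c v; rewrite gcolZ -scalemxAl rdotZl -mulrN -mulrA.
  by apply: ler_wpM2l; [exact: ltW | exact: cH].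
apply: (mxlim0_uniq (eta_lim al0 caH)).
have /(mxlim0Z a%:C) h := eta_lim l0 cH.
move=> e e0; have [D D0 hD] := h e e0; exists (D / a); first exact: divr_gt0.
move=> s /andP[s0]; rewrite ltr_pdivlMr// => sD v.
have -> : diff_quot phi T W s (a%:C *: H) = a%:C *: diff_quot phi T W (s * a) H.
  rewrite /diff_quot !scalerA -!rmorphM; congr (_%:C *: _).
  by field; rewrite !gt_eqF.
by apply: hD; rewrite sD mulr_gt0.
Qed.

(** Real scaling is a change of the parameter t. Interpolation with at least two
    nodes is exact on z eta(H), so the equality spreads from a real segment along
    the chain of discs from 1 to z. *)
Lemma eta_homogeneous (H : mxtuple R d n) (lam : R) (z : C) : 0 < lam ->
    inward g T lam H -> inward g T lam (z *: H) ->
  eta (z *: H) = z *: eta H.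
Proof.
move=> l0 cH czH; have [n0 iT al0 _ _] := J.
have [k k0 bH] := gbounded_ex g H.
have k1 : 0 < k + 1 by lra.
have [rho rho0 rhok] : exists2 rho, 0 < rho & rho * k <= lam / 4.
  exists (lam / (4 * (k + 1))); first by rewrite divr_gt0 ?mulr_gt0.
  rewrite mulrAC ler_pdivrMr ?mulr_gt0//; have := mulr_gt0 l0 k1; lra.
pose P (x : C) := eta (x *: H) = x *: eta H.
have [h hE] : exists h : R, h = (1 + normc z) * k + lam by exists ((1 + normc z) * k + lam).
have hk0 : 0 <= (1 + normc z) * k by rewrite mulr_ge0 ?addr_ge0 ?normc_ge0.
have lh : lam <= h by lra.
have h0 : 0 < h by lra.
have bK : gbounded g (lam / 4) (rho%:C *: H).
  have := gboundedZ rho%:C bH; rewrite normcR ger0_norm ?(ltW rho0)//.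
  by apply: gbounded_le => //; exact: mulr_ge0 (ltW rho0) k0.
apply: (@chain_of_balls _ P 1 z rho) => //; last first.
  move=> x /andP[x0 x1]; rewrite /P -[1](rmorph1 (real_complex R)) -rmorphD.
  by apply: (eta_homogeneousR l0) => //; lra.
move=> s u /andP[s0 s1] u0 u1 hx y y1.
set p := 1 + s%:C * (z - 1) in hx *.
have pE : p = (1 - s)%:C + s%:C * z by rewrite /p rmorphB rmorph1; ring.
have E q : (p + rho%:C * q) *: H = p *: H + q *: (rho%:C *: H).
  by rewrite scalerDl scalerA (mulrC q).
have cp : inward g T lam (p *: H).
  move=> c v; rewrite pE scalerDl -scalerA gcolD !gcolZ mulmxDl -!scalemxAl.
  rewrite rdotDl !rdotZl.
  have a1 : (1 - s) * (lam * nsq v) <= (1 - s) * - rdot (gcol c H *m v) (gcol c T *m v).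
    by apply: ler_wpM2l; [lra | exact: cH].
  have := czH c v; rewrite gcolZ -scalemxAl => a2.
  have a3 : s * (lam * nsq v) <= s * - rdot (z *: (gcol c H *m v)) (gcol c T *m v).
    by apply: ler_wpM2l.
  by move: a1 a3; move: (rdot _ _) (rdot _ _) => r1 r2; lra.
have bp : gbounded g h (p *: H).
  have np : normc p <= 1 + normc z.
    rewrite pE; apply: le_trans (le_normcD _ _) _.
    rewrite Normc.normcM !normcR !ger0_norm//; last by lra.
    have : s * normc z <= normc z by rewrite ler_piMl ?normc_ge0.
    by lra.
  apply: gbounded_le (gboundedZ p bH); first by rewrite mulr_ge0 ?normc_ge0.
  have : normc p * k <= (1 + normc z) * k by apply: ler_wpM2r.
  by lra.
rewrite /P; apply: mx_ext => v; apply/eqP; rewrite -subr_eq0 -mulmxBl; apply/eqP/nsq_eq0.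
set A := eta _ - _.
suff A0 : l2norm (A *m v) <= 0.
  by apply/eqP; rewrite -sqr_l2norm sqrf_eq0 eq_le A0 l2norm_ge0.
apply/ler_addgt0Pr => e e0; rewrite add0r.
have M0 : 0 <= 64 * al * h ^+ 2 / lam.
  by apply: ltW; rewrite divr_gt0 ?mulr_gt0 ?exprn_gt0.
have B0 := mulr_ge0 M0 (l2norm_ge0 v).
have [N hN] := half_power_small B0 e0.
have [z' [c [zN zi z1 hc pr]]] := ray_rule N.+2 u0 u1 y1.
have := eta_interp l0 lh cp bp bK z1 hc v.
have -> : \sum_(i < N.+2) c i *: eta (p *: H + z' i *: (rho%:C *: H)) =
    (p + rho%:C * y) *: eta H.
  have lin := hc (p%:P + rho%:C *: 'X).
  have -> : p + rho%:C * y = \sum_(i < N.+2) c i * (p + rho%:C * z' i).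
    rewrite -zN; move: lin; rewrite !hornerE => ->.
      by apply: eq_bigr => i _; rewrite !hornerE.
    apply: leq_trans (size_polyD _ _) _; rewrite geq_max.
    rewrite (leq_trans (size_polyC_leq1 _))//= (leq_trans (size_scale_leq _ _))//.
    by rewrite size_polyX.
  rewrite scaler_suml; apply: eq_bigr => i _; rewrite -E.
  by have [a a01 ->] := zi i; rewrite hx// scalerA.
rewrite {1}zN -E -/A => hA; apply: le_trans hA _; apply: le_trans hN.
rewrite -mulrA mulrCA mulrC; apply: ler_wpM2l => //.
apply: le_trans pr _; rewrite !exprS; have : 0 <= (1 / 2 : R) ^+ N by exact: exprn_ge0.
by lra.
Qed.

(** Interpolation at the nodes 0 and x with target y, multiplied by x: a bound
    for the second divided difference of eta along K. *)
Lemma three_points (H K : mxtuple R d n) (lam h : R) (x y : C) :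
    0 < lam -> lam <= h -> inward g T lam H -> gbounded g h H ->
    gbounded g (lam / 4) K -> normc x <= 1 -> normc y <= 1 -> x != 0 ->
  forall v, l2norm ((x *: (eta (H + y *: K) - eta H) - y *: (eta (H + x *: K) - eta H)) *m v)
     <= 64 * al * h ^+ 2 / lam * (normc x * normc y * normc (y - x)) * l2norm v.
Proof.
move=> l0 lh cH bH bK x1 y1 x0 v.
pose z (i : nat) : C := if i is 0%N then 0 else if i is 1%N then x else y.
pose c (i : 'I_2) : C := if val i == 0%N then 1 - y / x else y / x.
have exz : exact_rule z c.
  move=> p sp; rewrite big_ord_recl big_ord1 /c /= /z /=.
  rewrite (horner_coef_wide _ sp) (horner_coef_wide _ sp) (horner_coef_wide _ sp).
  rewrite !big_ord_recl !big_ord0 /=.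
  by field.
have z1 i : (i <= 2)%N -> normc (z i) <= 1.
  by case: i => [|[|i]] //= _; rewrite expr0n addr0 sqrtr0 ler01.
have := eta_interp l0 lh cH bH bK z1 exz v.
rewrite !big_ord_recl !big_ord0 /= /c /=.
rewrite scale0r addr0 subr0 addr0 mulr1.
set M := 64 * al * h ^+ 2 / lam; move=> hM.
have -> : x *: (eta (H + y *: K) - eta H) - y *: (eta (H + x *: K) - eta H) =
   x *: (eta (H + y *: K) - ((1 - y / x) *: eta H + (y / x) *: eta (H + x *: K))).
  rewrite !scalerBr scalerDr !scalerA mulrBr mulr1 mulrCA divff// mulr1 scalerBl.
  by rewrite !opprB !opprD !opprK -!addrA; congr (_ + _); rewrite addrA addrC addrA addrC.
rewrite -scalemxAl l2normZ.
have := ler_wpM2l (normc_ge0 x) hM; move: (l2norm _) (l2norm v) => p q; lra.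
Qed.

End directional_derivative.

(** * Quadratic approximation of the limit *)

Section frechet.
Context {R : realType}.
Local Notation C := R[i].
Local Notation normc := Normc.normc.

Lemma mxlim0_bound m k (F : R -> 'M[C]_(m, k)) L (B D : R) : 0 < D ->
    (forall s, 0 < s < D -> forall v, l2norm ((F s - L) *m v) <= B * s * l2norm v) ->
  mxlim0 F L.
Proof.
move=> D0 h e e0.
have B1 : 0 < `|B| + 1 by rewrite ltr_wpDl.
exists (Num.min D (e / (`|B| + 1))); first by rewrite lt_min D0 divr_gt0.
move=> s; rewrite lt_min => /and3P[s0 sD]; rewrite ltr_pdivlMr// => se v.
have := h s; rewrite s0 sD => /(_ isT v) /le_trans; apply.
apply: ler_wpM2r; first exact: l2norm_ge0.
apply: le_trans (ltW se); rewrite mulrC ler_pM2l//.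
by have := ler_norm B; lra.
Qed.

Lemma mxlim0_scale m k (F : R -> 'M[C]_(m, k)) L (a : R) : 0 < a ->
  mxlim0 F L -> mxlim0 (fun s => F (a * s)) L.
Proof.
move=> a0 h e /h[D D0 hD]; exists (D / a); first exact: divr_gt0.
move=> s /andP[s0]; rewrite ltr_pdivlMr// mulrC => sD.
by apply: hD; rewrite mulr_gt0.
Qed.

Variables (d : nat) (I : finType) (g : 'I_d -> I) (c0 : I).
Local Notation gcol := (gcol g).
Local Notation gball := (gball g).
Variable phi : graded_fun R d.
Hypothesis phi_int : forall m k (x : mxtuple R d m) (y : mxtuple R d k)
    (L : 'M[C]_(m, k)), gball x -> gball y ->
  (forall r, submxcol x r *m L = L *m submxcol y r) ->
  phi x *m L = L *m phi y.
Hypothesis phi_con : forall m (x : mxtuple R d m) v, gball x ->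
  nsq (phi x *m v) <= nsq v.
Variables (n : nat) (T : mxtuple R d n) (W : 'M[C]_n) (al : R).
Hypothesis J : julia_point g phi T W al.
Variable eta : mxtuple R d n -> 'M[C]_n.
Hypothesis eta_lim : forall (H : mxtuple R d n) (lam : R), 0 < lam -> inward g T lam H ->
  mxlim0 (fun t => diff_quot phi T W t H) (eta H).

Section at_point.
Variables (H : mxtuple R d n) (lam h : R).
Hypotheses (l0 : 0 < lam) (lh : lam <= h) (cH : inward g T lam H) (bH : gbounded g h H).

Local Notation M := (64 * al * h ^+ 2 / lam).
Local Notation q K s := ((s^-1)%:C *: (eta (H + s%:C *: K) - eta H)).

Lemma M_gt0 : 0 < M.
Proof.
have [_ _ al0 _ _] := J; have h0 : 0 < h := lt_le_trans l0 lh.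
by rewrite divr_gt0 ?mulr_gt0 ?exprn_gt0.
Qed.

Lemma quot_close (K : mxtuple R d n) (s : R) (y : C) : gbounded g (lam / 4) K ->
    0 < s <= 1 -> normc y <= 1 ->
  forall v, l2norm ((eta (H + y *: K) - eta H - y *: q K s) *m v) <=
     M * (normc y * (normc y + s)) * l2norm v.
Proof.
move=> bK /andP[s0 s1] y1 v.
have ns : normc s%:C = s by rewrite normcR gtr0_norm.
have sn : s%:C != 0 :> C by rewrite fmorph_eq0 gt_eqF.
have s1' : normc s%:C <= 1 by rewrite ns.
have := three_points c0 phi_int phi_con J eta_lim l0 lh cH bH bK s1' y1 sn v.
have -> : s%:C *: (eta (H + y *: K) - eta H) - y *: (eta (H + s%:C *: K) - eta H) =
   s%:C *: (eta (H + y *: K) - eta H - y *: q K s).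
  rewrite [RHS]scalerBr !scalerA mulrCA -rmorphM divff ?gt_eqF// rmorph1 mulr1.
  by [].
rewrite -scalemxAl l2normZ ns.
have ny : normc (y - s%:C) <= normc y + s.
  by apply: le_trans (le_normcD _ _) _; rewrite normcN ns.
move: ny (ltW M_gt0) (normc_ge0 y) (l2norm_ge0 v).
move: M (normc (y - _)) (normc y) (l2norm (_ *m v)) (l2norm v).
move=> m a b r p ny m0 b0 p0 hr; rewrite -(ler_pM2l s0).
have := ler_wpM2l (mulr_ge0 (ltW s0) (mulr_ge0 b0 (mulr_ge0 m0 p0))) ny; lra.
Qed.

Lemma quot_lim_small (K : mxtuple R d n) : gbounded g (lam / 4) K ->
  exists D, mxlim0 (fun s => q K s) D.
Proof.
move=> bK; apply: weak_lim0 => v w; apply: cauchy_lim0 => e e0.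
have m0 := M_gt0.
have vw0 : 0 <= l2norm v * l2norm w by rewrite mulr_ge0 ?l2norm_ge0.
have [c cE] : exists c, c = 2 * M * (l2norm v * l2norm w) + 1 by eexists.
have cp : 0 < c by rewrite cE ltr_wpDl// mulr_ge0// mulr_ge0// ltW.
have key s s' : 0 < s <= 1 -> 0 < s' <= 1 ->
    rdot (q K s *m v) w - rdot (q K s' *m v) w <= M * (s + s') * (l2norm v * l2norm w).
  move=> s01 /andP[s'0 s'1].
  have ns : normc s'%:C = s' by rewrite normcR gtr0_norm.
  have s1' : normc s'%:C <= 1 by rewrite ns.
  have := quot_close bK s01 s1' v; rewrite ns.
  have -> : eta (H + s'%:C *: K) - eta H - s'%:C *: q K s = s'%:C *: (q K s' - q K s).
    rewrite [RHS]scalerBr; congr (_ - _).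
    by rewrite scalerA -rmorphM divff ?gt_eqF// rmorph1 scale1r.
  move: (q K s) (q K s') => A' B; rewrite -scalemxAl l2normZ ns.
  rewrite -rdotBl -mulmxBl -[A' - B]opprB mulNmx; move: (B - A') => A hA.
  apply: le_trans (rdot_le _ _) _; rewrite l2normN mulrA.
  apply: ler_wpM2r; first exact: l2norm_ge0.
  rewrite -(ler_pM2l s'0); apply: le_trans hA _; rewrite le_eqVlt; apply/orP; left.
  by apply/eqP; ring.
exists (Num.min 1 (e / c)); first by rewrite lt_min ltr01 divr_gt0.
move=> s s'; rewrite !lt_min => /and3P[s0 s1 se] /and3P[s'0 s'1 s'e].
have a1 : 0 < s <= 1 by rewrite s0 ltW.
have a2 : 0 < s' <= 1 by rewrite s'0 ltW.
have ss : s + s' <= 2 * (e / c) by lra.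
have se' : M * (s + s') * (l2norm v * l2norm w) <= e.
  apply: le_trans (_ : _ <= 2 * M * (l2norm v * l2norm w) * (e / c)) _.
    have := ler_wpM2l (mulr_ge0 (ltW m0) vw0) ss.
    by move: M (l2norm v * l2norm w) (e / c) => *; lra.
  by rewrite mulrCA ler_piMr ?(ltW e0)// ler_pdivrMr// mul1r cE lerDl.
have b1 := le_trans (key s s' a1 a2) se'.
rewrite addrC in se'; have b2 := le_trans (key s' s a2 a1) se'.
by rewrite ler_norml b1 andbT lerNl opprB.
Qed.

(** The distance between the quotients at s and y is at most a multiple of
    |y| + s; let s tend to 0. *)
Lemma quot_dist (K : mxtuple R d n) D (y : C) : gbounded g (lam / 4) K ->
    mxlim0 (fun s => q K s) D -> normc y <= 1 ->
  forall v, l2norm ((eta (H + y *: K) - eta H - y *: D) *m v) <=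
     M * normc y ^+ 2 * l2norm v.
Proof.
move=> bK hD y1 v; have m0 := M_gt0.
have lim : mxlim0 (fun s => eta (H + y *: K) - eta H - y *: q K s)
    (eta (H + y *: K) - eta H - y *: D).
  have := mxlim0D (mxlim0_cst (eta (H + y *: K) - eta H)) (mxlim0Z (- y) hD).
  rewrite scaleNr; apply: mxlim0_eq => s; by rewrite scaleNr.
apply/ler_addgt0Pr => e e0.
have [c cE] : exists c, c = M * normc y * l2norm v + 1 by eexists.
have c0' : 0 <= M * normc y * l2norm v.
  by apply: mulr_ge0 (l2norm_ge0 v); apply: mulr_ge0 (normc_ge0 y); exact: ltW.
have cp : 0 < c by rewrite cE ltr_wpDl.
have D0 : 0 < Num.min 1 (e / c) by rewrite lt_min ltr01 divr_gt0.
apply: (mxlim0_le D0 _ lim) => s; rewrite lt_min => /and3P[s0 s1 se].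
have s01 : 0 < s <= 1 by rewrite s0 ltW.
apply: le_trans (quot_close bK s01 y1 v) _.
have : s * c < e by rewrite -ltr_pdivlMr.
rewrite cE; move: M (normc y) (l2norm v) => m b p; have := s0; lra.
Qed.

End at_point.
Definition dquot (H K : mxtuple R d n) (s : R) : 'M[C]_n :=
  (s^-1)%:C *: (eta (H + s%:C *: K) - eta H).

Lemma dquot_scale (H K : mxtuple R d n) (a s : R) : 0 < a -> 0 < s ->
  dquot H (a%:C *: K) s = a%:C *: dquot H K (a * s).
Proof.
move=> a0 s0; rewrite /dquot !scalerA -!rmorphM (mulrC s a); congr (_%:C *: _).
by field; rewrite !gt_eqF.
Qed.

Lemma mxlim0_eq_pos m k (F F' : R -> 'M[C]_(m, k)) L :
  (forall s, 0 < s -> F s = F' s) -> mxlim0 F L -> mxlim0 F' L.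
Proof.
move=> h hF e /hF[D D0 hD]; exists D; first exact: D0.
move=> s sD v.
have /andP[s0 _] := sD; rewrite -(h s s0); exact: hD.
Qed.

Lemma scale_small (K : mxtuple R d n) (k : R) : 0 < k ->
  exists2 t : R, 0 < t & gbounded g k (t%:C *: K).
Proof.
move=> k0; have [b b0 bK] := gbounded_ex g K.
have b1 : 0 < b + 1 by lra.
exists (k / (b + 1)); first exact: divr_gt0.
have t0 : 0 < k / (b + 1) := divr_gt0 k0 b1.
have := gboundedZ (k / (b + 1))%:C bK; rewrite normcR gtr0_norm//.
apply: gbounded_le; first by rewrite mulr_ge0// ltW.
by rewrite mulrAC ler_pdivrMr// ler_pM2l//; lra.
Qed.

Section differential.
Variables (H : mxtuple R d n) (lam : R).
Hypotheses (l0 : 0 < lam) (cH : inward g T lam H).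

Lemma dquot_lim K : exists D, mxlim0 (dquot H K) D.
Proof.
have lp := l0.
have [h h0 bH] := gbounded_ex g H.
have bH' : gbounded g (h + lam) H by apply: gbounded_le bH; lra.
have lh : lam <= h + lam by lra.
have l40 : 0 < lam / 4 by lra.
have [t t0 bK] := scale_small K l40.
have [D hD] := quot_lim_small l0 lh cH bH' bK.
have ti : 0 < t^-1 by rewrite invr_gt0.
exists ((t^-1)%:C *: D); have := mxlim0Z (t^-1)%:C (mxlim0_scale ti hD).
apply: mxlim0_eq_pos => s s0; rewrite -/(dquot H _ _) -dquot_scale//.
by rewrite scalerA -rmorphM mulVf ?gt_eqF// rmorph1 scale1r.
Qed.

Definition ddiff (K : mxtuple R d n) : 'M[C]_n := xget 0 [set D | mxlim0 (dquot H K) D].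

Lemma ddiffP K : mxlim0 (dquot H K) (ddiff K).
Proof. by have [D hD] := dquot_lim K; exact: (xgetPex 0 (ex_intro _ D hD)). Qed.

Lemma ddiffE K D : mxlim0 (dquot H K) D -> ddiff K = D.
Proof. by move=> hD; exact: mxlim0_uniq (ddiffP K) hD. Qed.

Lemma ddiffZR (K : mxtuple R d n) (a : R) : 0 < a -> ddiff (a%:C *: K) = a%:C *: ddiff K.
Proof.
move=> a0; apply: ddiffE; have := mxlim0Z a%:C (mxlim0_scale a0 (ddiffP K)).
by apply: mxlim0_eq_pos => s s0; rewrite dquot_scale.
Qed.

Lemma ddiff_dist : exists2 B, 0 < B & forall (K : mxtuple R d n) (y : C), gbounded g (lam / 4) K ->
  normc y <= 1 -> forall v,
  l2norm ((eta (H + y *: K) - eta H - y *: ddiff K) *m v) <= B * normc y ^+ 2 * l2norm v.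
Proof.
have lp := l0.
have [h h0 bH] := gbounded_ex g H.
have bH' : gbounded g (h + lam) H by apply: gbounded_le bH; lra.
have lh : lam <= h + lam by lra.
exists (64 * al * (h + lam) ^+ 2 / lam); first exact: M_gt0 l0 lh.
move=> K y bK y1 v; have := quot_dist l0 lh cH bH' bK (ddiffP K) y1; apply.
Qed.

Lemma ddiffZ_small (K : mxtuple R d n) (z : C) : gbounded g (lam / 4) K -> normc z <= 1 ->
  ddiff (z *: K) = z *: ddiff K.
Proof.
move=> bK z1; have [B B0 hB] := ddiff_dist; apply: ddiffE.
apply: (@mxlim0_bound _ _ _ _ (B * normc z ^+ 2) 1) => // s /andP[s0 s1] v.
have ns : normc (s%:C * z) = s * normc z.
  by rewrite Normc.normcM normcR gtr0_norm.
have sz : normc (s%:C * z) <= 1.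
  rewrite ns; apply: le_trans z1; rewrite ler_piMl ?normc_ge0//; exact: ltW.
have := hB K _ bK sz v; rewrite ns -scalerA.
have -> : dquot H (z *: K) s - z *: ddiff K =
    (s^-1)%:C *: (eta (H + s%:C *: (z *: K)) - eta H - (s%:C * z) *: ddiff K).
  rewrite [RHS]scalerBr; congr (_ - _).
  by rewrite scalerA mulrA -rmorphM mulVf ?gt_eqF// rmorph1 mul1r.
move: (eta _ - _ - _) => A hA.
rewrite -scalemxAl l2normZ normcR gtr0_norm ?invr_gt0//.
rewrite -(ler_pM2l s0) mulrA divff ?gt_eqF// mul1r; apply: le_trans hA _.
rewrite le_eqVlt; apply/orP; left; apply/eqP; ring.
Qed.

Lemma ddiffZ (K : mxtuple R d n) (z : C) : ddiff (z *: K) = z *: ddiff K.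
Proof.
have lp := l0.
have l40 : 0 < lam / 4 by lra.
have [t t0 bK] := scale_small K l40.
have z0 := normc_ge0 z; have z10 : 0 < normc z + 1 by lra.
pose r := (normc z + 1)^-1; have r0 : 0 < r by rewrite invr_gt0.
have nrz : normc (r%:C * z) <= 1.
  rewrite Normc.normcM normcR gtr0_norm// mulrC ler_pdivrMr//; lra.
have := ddiffZ_small bK nrz.
have -> : (r%:C * z) *: (t%:C *: K) = (r * t)%:C *: (z *: K).
  by rewrite !scalerA rmorphM; congr (_ *: _); ring.
rewrite !ddiffZR ?mulr_gt0// scalerA.
have -> : r%:C * z * t%:C = (r * t)%:C * z by rewrite rmorphM; ring.
have rt0 : (r * t)%:C != 0 :> C by rewrite fmorph_eq0 gt_eqF// mulr_gt0.
by rewrite -scalerA; exact: scalerI.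
Qed.

(** H + 2 s K1 and H + 2 s K2 are symmetric about H + s (K1 + K2), and the second
    difference of eta there is of order s^2; after division by s this compares the
    quotients along K1, K2 and K1 + K2. *)
Lemma ddiffD_small (K1 K2 : mxtuple R d n) : gbounded g (lam / 16) K1 -> gbounded g (lam / 16) K2 ->
  ddiff (K1 + K2) = ddiff K1 + ddiff K2.
Proof.
have lp := l0.
move=> b1 b2; have [h h0 bH] := gbounded_ex g H.
have k0 : 0 <= lam / 16 by lra.
have b12 := gbounded_add k0 k0 b1 b2.
have bm : gbounded g (lam / 16 + lam / 16) (K1 - K2).
  have := gboundedZ (-1) b2; rewrite normcN Normc.normc1 mul1r scaleN1r => b2'.
  exact: (gbounded_add k0 k0 b1 b2').
have [hh hhE] : exists hh, hh = h + lam by eexists.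
have lhh : lam / 2 <= hh by lra.
have l20 : 0 < lam / 2 by lra.
pose B := 64 * al * hh ^+ 2 / (lam / 2).
have lim1 : mxlim0 (fun s => dquot H K1 (2 * s) + dquot H K2 (2 * s) +
    - 1 *: dquot H (K1 + K2) s) (ddiff K1 + ddiff K2 + - 1 *: ddiff (K1 + K2)).
  have two : 0 < 2 :> R by [].
  apply: mxlim0D; first apply: mxlim0D.
  - exact: mxlim0_scale two (ddiffP K1).
  - exact: mxlim0_scale two (ddiffP K2).
  - exact: mxlim0Z (ddiffP _).
suff lim2 : mxlim0 (fun s => dquot H K1 (2 * s) + dquot H K2 (2 * s) +
    - 1 *: dquot H (K1 + K2) s) 0.
  have := mxlim0_uniq lim1 lim2; rewrite scaleN1r => /eqP.
  by rewrite subr_eq0 => /eqP.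
apply: (@mxlim0_bound _ _ _ _ B 1) => // s /andP[s0 s1] v.
rewrite subr0; set A := dquot H K1 (2 * s) + dquot H K2 (2 * s) +
    - 1 *: dquot H (K1 + K2) s.
pose mid := H + s%:C *: (K1 + K2).
have ns : normc s%:C = s by rewrite normcR gtr0_norm.
have ns1 : normc s%:C <= 1 by rewrite ns ltW.
have nNs1 : normc (- s%:C) <= 1 by rewrite normcN.
have sn : s%:C != 0 :> C by rewrite fmorph_eq0 gt_eqF.
have sk : s * (lam / 16 + lam / 16) <= lam / 8.
  by rewrite -[leRHS]mul1r; apply: ler_pM; lra.
have bs := gboundedZ s%:C b12; rewrite ns in bs.
have sk0 : 0 <= s * (lam / 16 + lam / 16) by apply: mulr_ge0; lra.
have cm : inward g T (lam / 2) mid.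
  by apply: inward_le (inward_add (let: And5 _ iT _ _ _ := J in iT) sk0 cH bs); lra.
have bmid : gbounded g hh mid.
  by apply: gbounded_le (gbounded_add h0 sk0 bH bs); lra.
have bm' : gbounded g (lam / 2 / 4) (K1 - K2) by apply: gbounded_le bm; lra.
have := three_points c0 phi_int phi_con J eta_lim l20 lhh cm bmid bm' ns1 nNs1 sn v.
have e1 : mid + - s%:C *: (K1 - K2) = H + (2 * s)%:C *: K2.
  by rewrite rmorphM rmorph_nat; apply/matrixP => i j; rewrite !mxE; ring.
have e2 : mid + s%:C *: (K1 - K2) = H + (2 * s)%:C *: K1.
  by rewrite rmorphM rmorph_nat; apply/matrixP => i j; rewrite !mxE; ring.
rewrite e1 e2 normcN ns -/B.
have -> : normc (- s%:C - s%:C) = 2 * s.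
  by rewrite -opprD normcN -rmorphD normcR gtr0_norm; lra.
have -> : s%:C *: (eta (H + (2 * s)%:C *: K2) - eta mid)
     - - s%:C *: (eta (H + (2 * s)%:C *: K1) - eta mid) =
   (2 * s ^+ 2)%:C *: A.
  rewrite /A /dquot -/mid.
  move: (eta mid) (eta (H + _ *: K1)) (eta (H + _ *: K2)) (eta H) => x a b y.
  apply/matrixP => i j; rewrite !mxE.
  have -> : ((2 * s)^-1)%:C = (2 * s%:C)^-1 :> C by rewrite fmorphV rmorphM rmorph_nat.
  have -> : (s^-1)%:C = (s%:C)^-1 :> C by rewrite fmorphV.
  have -> : (2 * s ^+ 2)%:C = 2 * s%:C ^+ 2 :> C by rewrite rmorphM rmorph_nat rmorphXn.
  by field.
clearbody A.
rewrite -scalemxAl l2normZ normcR gtr0_norm; last by rewrite mulr_gt0// exprn_gt0.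
have s20 : 0 < 2 * s ^+ 2 by rewrite mulr_gt0// exprn_gt0.
move=> hA; rewrite -(ler_pM2l s20); apply: le_trans hA _.
by rewrite le_eqVlt; apply/orP; left; apply/eqP; ring.
Qed.

Lemma ddiffD (K1 K2 : mxtuple R d n) : ddiff (K1 + K2) = ddiff K1 + ddiff K2.
Proof.
have lp := l0.
have k0 : 0 < lam / 16 by lra.
have [t1 t10 b1] := scale_small K1 k0; have [t2 t20 b2] := scale_small K2 k0.
have [t [t0 tt1 tt2]] : exists t : R, [/\ 0 < t, t <= t1 & t <= t2].
  by exists (Num.min t1 t2); rewrite lt_min t10 t20 !ge_min !lexx orbT.
have small (K : mxtuple R d n) (t' : R) : 0 < t' -> t <= t' -> gbounded g (lam / 16) (t'%:C *: K) ->
    gbounded g (lam / 16) (t%:C *: K).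
  move=> t'0 tt' bK; have := gboundedZ (t / t')%:C bK.
  have t'n : t' != 0 by rewrite gt_eqF.
  have -> : (t / t')%:C *: (t'%:C *: K) = t%:C *: K.
    by rewrite scalerA -(rmorphM (real_complex R)) (divfK t'n).
  have -> : normc (t / t')%:C = t / t' by rewrite normcR gtr0_norm// divr_gt0.
  have r1 : t / t' <= 1 by rewrite ler_pdivrMr// mul1r.
  by apply: gbounded_le; [rewrite mulr_ge0 ?divr_ge0 ?ltW | rewrite ler_piMl// ltW].
have c1 : gbounded g (lam / 16) (t%:C *: K1) := small K1 t1 t10 tt1 b1.
have c2 : gbounded g (lam / 16) (t%:C *: K2) := small K2 t2 t20 tt2 b2.
have := ddiffD_small c1 c2; rewrite -scalerDr !ddiffZR// -scalerDr.
have tn0 : t%:C != 0 :> C by rewrite fmorph_eq0 gt_eqF.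
exact: scalerI.
Qed.

Lemma frechet_eta : exists2 B, 0 < B & forall (k : R) (K : mxtuple R d n),
  0 < k -> k <= lam / 4 -> gbounded g k K ->
  forall v, l2norm ((eta (H + K) - eta H - ddiff K) *m v) <= B * k ^+ 2 * l2norm v.
Proof.
have lp := l0.
have [B B0 hB] := ddiff_dist.
exists (B * (4 / lam) ^+ 2); first by rewrite mulr_gt0// exprn_gt0// divr_gt0.
move=> k K k0 kl bK v.
have y0 : 0 < 4 * k / lam by rewrite divr_gt0// mulr_gt0.
have ny : normc (4 * k / lam)%:C = 4 * k / lam by rewrite normcR gtr0_norm.
have y1 : normc (4 * k / lam)%:C <= 1 by rewrite ny ler_pdivrMr//; lra.
have bK' : gbounded g (lam / 4) ((lam / (4 * k))%:C *: K).
  have := gboundedZ (lam / (4 * k))%:C bK; rewrite normcR gtr0_norm; last first.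
    by rewrite divr_gt0// mulr_gt0.
  suff -> : lam / (4 * k) * k = lam / 4 by [].
  by field; rewrite gt_eqF.
have := hB _ _ bK' y1 v; rewrite -ddiffZ scalerA -rmorphM.
have -> : 4 * k / lam * (lam / (4 * k)) = 1 by field; rewrite !gt_eqF.
rewrite rmorph1 scale1r ny.
suff -> : B * (4 * k / lam) ^+ 2 = B * (4 / lam) ^+ 2 * k ^+ 2 by [].
ring.
Qed.

End differential.
End frechet.

(** * The polydisk and the column ball *)

Section opnorm_theory.
Context {R : realType}.
Local Notation C := R[i].

Lemma opnorm_set m n (A : 'M[C]_(m, n)) :
  has_sup [set l2norm (A *m v) | v in [set v : 'cV[C]_n | l2norm v <= 1]].
Proof.
split; first by exists (l2norm (A *m 0)); exists 0 => //=; rewrite l2norm0 ler01.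
exists (\sum_j \sum_i Normc.normc (A i j)) => _ [v /= v1 <-].
apply: le_trans (l2norm_mulmx_le _ _) _; rewrite ler_piMr//.
by apply: sumr_ge0 => j _; apply: sumr_ge0 => i _; exact: normc_ge0.
Qed.

Lemma opnorm_ge0 m n (A : 'M[C]_(m, n)) : 0 <= opnorm A.
Proof.
apply: le_trans (_ : l2norm (A *m 0) <= _); first exact: l2norm_ge0.
by apply: sup_upper_bound (opnorm_set A) _ _; exists 0 => //=; rewrite l2norm0 ler01.
Qed.

Lemma l2norm_opnorm m n (A : 'M[C]_(m, n)) v : l2norm (A *m v) <= opnorm A * l2norm v.
Proof.
have [v0|v0] := eqVneq (l2norm v) 0.
  have -> : v = 0 by apply: nsq_eq0; rewrite -sqr_l2norm v0 expr0n.
  by rewrite mulmx0 !l2norm0 mulr0.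
have vp : 0 < l2norm v by rewrite lt_neqAle eq_sym v0 l2norm_ge0.
have : l2norm (A *m ((l2norm v)^-1%:C *: v)) <= opnorm A.
  apply: sup_upper_bound (opnorm_set A) _ _; exists ((l2norm v)^-1%:C *: v) => //=.
  by rewrite l2normZ normcR gtr0_norm ?invr_gt0// mulVf.
rewrite -scalemxAr l2normZ normcR gtr0_norm ?invr_gt0// ler_pdivrMl//.
by rewrite mulrC.
Qed.

Lemma opnorm_le m n (A : 'M[C]_(m, n)) (k : R) : 0 <= k ->
  (forall v, l2norm (A *m v) <= k * l2norm v) -> opnorm A <= k.
Proof.
move=> k0 h; apply: ge_sup; first by case: (opnorm_set A).
move=> _ [v /= v1 <-]; apply: le_trans (h v) _.
by rewrite ler_piMr.
Qed.

End opnorm_theory.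

Section concrete_domains.
Context {R : realType}.
Local Notation C := R[i].
Variable d : nat.

(** The operator norm of delta(x) is the largest norm of the grouped columns, and 0
    when there is no group (d = 0). *)
Record grouping (delta : ncpolymx R d) (I : finType) (g : 'I_d -> I) : Prop := Grouping {
  grp_le : forall n (x : mxtuple R d n) c v,
    l2norm (gcol g c x *m v) <= opnorm (ncmx_eval delta x) * l2norm v;
  grp_ge : forall n (x : mxtuple R d n) (k : R), 0 <= k ->
    (forall c v, l2norm (gcol g c x *m v) <= k * l2norm v) ->
    opnorm (ncmx_eval delta x) <= k;
  grp_iso : forall n (x : mxtuple R d n), Defs.isometry (ncmx_eval delta x) -> giso g x }.

Lemma ncpoly_eval_var n (r : 'I_d) (x : mxtuple R d n) :
  ncpoly_eval (@ncpoly_var R d r) x = submxcol x r.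
Proof. by rewrite /ncpoly_eval /ncpoly_var !big_seq1 scale1r. Qed.

Lemma nsq_gcol (I : finType) (g : 'I_d -> I) c n (x : mxtuple R d n) (v : 'cV[C]_n) :
  nsq (gcol g c x *m v) = \sum_(r | g r == c) nsq (submxcol x r *m v).
Proof. exact: rdot_gcol. Qed.

Lemma nsq_polydisk n (x : mxtuple R d n) (v : 'cV[C]_(\sum_(j < d) n)) :
  nsq (ncmx_eval (polydisk R d) x *m v) = \sum_c nsq (gcol id c x *m submxcol v c).
Proof.
rewrite nsq_submxcol; apply: eq_bigr => i _.
rewrite nsq_gcol big_pred1_eq; congr nsq.
rewrite -[in LHS](submxcolK v) mul_mxblock_mxrow mxcolK (bigD1 i)//= eqxx.
rewrite ncpoly_eval_var big1 ?addr0// => j ji.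
by rewrite eq_sym (negbTE ji) /ncpoly_eval big_nil mul0mx.
Qed.

Lemma grouping_polydisk : grouping (polydisk R d) id.
Proof.
have key n (x : mxtuple R d n) c (v : 'cV[C]_n) :
    exists2 w, nsq w = nsq v & nsq (ncmx_eval (polydisk R d) x *m w) = nsq (gcol id c x *m v).
  exists (\mxcol_(j < d) (if j == c then v else 0)).
    rewrite nsq_submxcol (bigD1 c)//= mxcolK eqxx big1 ?addr0// => j jc.
    by rewrite mxcolK (negbTE jc) nsq0.
  rewrite nsq_polydisk (bigD1 c)//= mxcolK eqxx [X in _ + X]big1 ?addr0// => j jc.
  by rewrite mxcolK (negbTE jc) mulmx0 nsq0.
split=> n x.
- move=> c v; have [w wv E] := key n x c v.
  have := l2norm_opnorm (ncmx_eval (polydisk R d) x) w.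
  by rewrite !l2normE E wv.
- move=> k k0 h; apply: opnorm_le => // v.
  rewrite l2norm_le ?mulr_ge0 ?l2norm_ge0// nsq_polydisk exprMn sqr_l2norm.
  rewrite nsq_submxcol mulr_sumr; apply: ler_sum => c _.
  have := h c (submxcol v c).
  by rewrite l2norm_le ?mulr_ge0 ?l2norm_ge0// exprMn sqr_l2norm.
- move=> ix c v; have [w <- <-] := key n x c v.
  by rewrite -!sqr_l2norm ix.
Qed.

Lemma nsq_column_ball n (x : mxtuple R d n) (v : 'cV[C]_(\sum_(j < 1) n)) :
  nsq (ncmx_eval (column_ball R d) x *m v) =
  nsq (gcol (fun=> tt) tt x *m submxcol v ord0).
Proof.
rewrite nsq_submxcol nsq_gcol; apply: eq_big => // i _; congr nsq.
rewrite -[in LHS](submxcolK v) mul_mxblock_mxrow mxcolK big_ord1.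
by rewrite ncpoly_eval_var.
Qed.

Lemma grouping_column_ball : grouping (column_ball R d) (fun=> tt).
Proof.
have nsq1 n (v : 'cV[C]_(\sum_(j < 1) n)) : nsq v = nsq (submxcol v ord0).
  by rewrite nsq_submxcol big_ord1.
split=> n x.
- case=> v; pose w : 'cV[C]_(\sum_(j < 1) n) := \mxcol_(j < 1) v.
  have := l2norm_opnorm (ncmx_eval (column_ball R d) x) w.
  by rewrite !l2normE nsq_column_ball nsq1 mxcolK.
- move=> k k0 h; apply: opnorm_le => // v.
  by rewrite !l2normE nsq_column_ball nsq1 -!l2normE.
- move=> ix [] v; pose w : 'cV[C]_(\sum_(j < 1) n) := \mxcol_(j < 1) v.
  have := congr1 (fun r => r ^+ 2) (ix w).
  by rewrite !sqr_l2norm nsq_column_ball nsq1 mxcolK.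
Qed.

End concrete_domains.

Section nc_functions.
Context {R : realType}.
Local Notation C := R[i].
Variables (d : nat) (delta : ncpolymx R d) (I : finType) (g : 'I_d -> I) (c0 : I).
Hypothesis grp : grouping delta g.

Lemma gball_Gdom n (x : mxtuple R d n) : gball g x <-> Gdom delta x.
Proof.
split=> [[n0 [k k1 hk]]|[n0 x1]]; split => //.
  pose k' := Num.sqrt (Num.max k 0).
  have m0 : 0 <= Num.max k 0 by rewrite le_max lexx orbT.
  have k'0 : 0 <= k' by exact: sqrtr_ge0.
  apply: le_lt_trans (_ : k' < 1).
    apply: (grp_ge grp) => // c v; rewrite l2norm_le ?mulr_ge0 ?l2norm_ge0//.
    rewrite exprMn sqr_l2norm sqr_sqrtr//; apply: le_trans (hk c v) _.
    by apply: ler_wpM2r; rewrite ?nsq_ge0// le_max lexx.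
  by rewrite -[ltRHS]sqrtr1 ltr_sqrt// gt_max k1 ltr01.
exists (opnorm (ncmx_eval delta x) ^+ 2).
  by rewrite expr_lt1// opnorm_ge0.
move=> c v; rewrite -!sqr_l2norm -exprMn ler_sqr ?nnegrE ?mulr_ge0 ?l2norm_ge0 ?opnorm_ge0//.
exact: (grp_le grp).
Qed.

Variable phi : graded_fun R d.
Hypothesis hphi : schur_class delta phi.

Lemma schur_contractive m (x : mxtuple R d m) v : gball g x ->
  nsq (phi x *m v) <= nsq v.
Proof.
move=> /gball_Gdom Gx; have := hphi.2 _ _ Gx => p1.
rewrite -!sqr_l2norm ler_sqr ?nnegrE ?l2norm_ge0//.
apply: le_trans (l2norm_opnorm _ _) _; rewrite ler_piMl ?l2norm_ge0//; exact: ltW.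
Qed.

(** The unipotent matrix with corner L commutes with the direct sum of x and y,
    hence with its image. *)
Lemma schur_intertwine m k (x : mxtuple R d m) (y : mxtuple R d k) (L : 'M[C]_(m, k)) :
    gball g x -> gball g y ->
    (forall r, submxcol x r *m L = L *m submxcol y r) ->
  phi x *m L = L *m phi y.
Proof.
move=> Gx Gy xL.
have Gs : gball g (tuple_dsum x y).
  case: (Gx) (Gy) => m0 [k1 k11 h1] [_ [k2 k21 h2]].
  split; first by rewrite addn_gt0 m0.
  exists (Num.max k1 k2); first by rewrite gt_max k11.
  move=> c v; rewrite -[v]vsubmxK nsq_col_mx nsq_gcol.
  have -> : \sum_(r | g r == c) nsq (submxcol (tuple_dsum x y) r *m col_mx (usubmx v) (dsubmx v))
     = nsq (gcol g c x *m usubmx v) + nsq (gcol g c y *m dsubmx v).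
    rewrite !nsq_gcol -big_split; apply: eq_bigr => r _.
    by rewrite mxcolK mul_block_col !mul0mx addr0 add0r nsq_col_mx.
  rewrite mulrDr; apply: lerD.
    apply: le_trans (h1 _ _) _; apply: ler_wpM2r; first exact: nsq_ge0.
    by rewrite le_max lexx.
  apply: le_trans (h2 _ _) _; apply: ler_wpM2r; first exact: nsq_ge0.
  by rewrite le_max lexx orbT.
pose s : 'M[C]_(m + k) := block_mx 1%:M L 0 1%:M.
have su : s \in unitmx.
  by rewrite unitmxE det_ublock !det1 mulr1 unitr1.
have cs : tuple_conj s (tuple_dsum x y) = tuple_dsum x y.
  rewrite /tuple_conj; apply: eq_mxcol => r; rewrite mxcolK -mulmxA.
  suff -> : block_mx (submxcol x r) 0 0 (submxcol y r) *m s =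
            s *m block_mx (submxcol x r) 0 0 (submxcol y r) by rewrite mulKmx.
  rewrite !mulmx_block !mulmx0 !mul0mx !mulmx1 !mul1mx !addr0 !add0r.
  by rewrite xL.
have [[hsum hconj] _] := hphi.
have := hconj _ s (tuple_dsum x y) su.
rewrite cs => /(_ ((gball_Gdom _).1 Gs) ((gball_Gdom _).1 Gs)).
rewrite hsum; [|exact/gball_Gdom..].
move=> /(congr1 (mulmx s)); rewrite !mulmxA mulmxV// mul1mx.
rewrite !mulmx_block !mulmx0 !mul0mx !mulmx1 !mul1mx !addr0 !add0r.
by move=> /eq_block_mx[_ -> _ _].
Qed.

End nc_functions.

(** * The boundary value at a B-point *)

Section matrix_topology.
Context {R : realType}.
Local Notation C := R[i].
Local Notation normc := Normc.normc.

Lemma normC (z : C) : `|z| = (normc z)%:C.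
Proof. by rewrite normc_def; case: z. Qed.

Lemma gt0_complex (e : C) : 0 < e -> exists2 r : R, 0 < r & e = r%:C.
Proof.
by case: e => a b; rewrite ltcE /= => /andP[/eqP -> a0]; exists a.
Qed.

Lemma mxnorm_lt m n (A : 'M[C]_(m, n)) (e : R) :
  `|A| < e%:C <-> (0 < e /\ forall i j, normc (A i j) < e).
Proof.
have H : ball (0 : 'M[C]_(m, n)) (e%:C) A <-> `|A| < e%:C.
  by rewrite mx_norm_ball /ball_ /= sub0r normrN.
apply: iff_trans (iff_sym H) _; rewrite /ball /= /mx_ball ltcR.
split=> -[e0 h]; split=> // i j; have := h i j.
  by rewrite /ball /= mxE sub0r normrN normC ltcR.
by rewrite /ball /= mxE sub0r normrN normC ltcR.
Qed.

Lemma l2norm_entries m n (A : 'M[C]_(m, n)) (e : R) v :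
  (forall i j, normc (A i j) <= e) -> l2norm (A *m v) <= (n * m)%:R * e * l2norm v.
Proof.
move=> h; apply: le_trans (l2norm_mulmx_le _ _) _.
apply: ler_wpM2r; first exact: l2norm_ge0.
apply: le_trans (_ : _ <= \sum_(j < n) \sum_(i < m) e) _.
  by apply: ler_sum => j _; apply: ler_sum => i _.
by rewrite !sumr_const !card_ord -!mulrnA mulr_natl mulnC.
Qed.

Lemma normc_le_bound m n (A : 'M[C]_(m, n)) (e : R) i j :
  (forall v, l2norm (A *m v) <= e * l2norm v) -> normc (A i j) <= e.
Proof.
move=> h; have := h (delta_mx j 0); rewrite l2norm_delta mulr1 -colE.
by apply: le_trans; have := normc_le_l2norm (col j A) i; rewrite mxE.
Qed.

Lemma mxlim0_cvg m n (F : R -> 'M[C]_(m, n)) L :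
  mxlim0 F L -> F t @[t --> (0 : R)^'+] --> L.
Proof.
move=> h; apply/cvgrPdist_lt => _ /gt0_complex[r r0 ->].
have r20 : 0 < r / 2 by lra.
have [D D0 hD] := h _ r20; near=> t.
have tD : 0 < t < D.
  by apply/andP; split; near: t; [exact: nbhs_right_gt | exact: nbhs_right_lt].
rewrite distrC; apply/mxnorm_lt; split=> // i j.
by apply: le_lt_trans (normc_le_bound i j (hD t tD)) _; lra.
Unshelve. all: by end_near. Qed.

Lemma mxseqlim_cvg m (F : nat -> 'M[C]_m) (W : 'M[C]_m) : mxseqlim F W -> F j @[j --> \oo] --> W.
Proof.
move=> h; apply/cvgrPdist_lt => _ /gt0_complex[r r0 ->].
have r20 : 0 < r / 2 by lra.
have [N hN] := h _ r20; exists N => // t /= /hN ht.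
rewrite distrC; apply/mxnorm_lt; split=> // i j.
by apply: le_lt_trans (normc_le_bound i j ht) _; lra.
Qed.

Lemma cvg_entries m n (F : nat -> 'M[C]_(m, n)) (W : 'M[C]_(m, n)) : F j @[j --> \oo] --> W ->
  forall e : R, 0 < e -> exists N, forall j, (N <= j)%N -> forall i k,
    normc ((F j - W) i k) <= e.
Proof.
move=> /cvgrPdist_lt h e e0.
have e0C : 0 < e%:C by rewrite ltcR.
have [N _ hN] := h _ e0C; exists N => j Nj i k.
have := hN j Nj; rewrite /= distrC => /mxnorm_lt[_ /(_ i k)]; exact: ltW.
Qed.

Lemma cvg_mxseqlim m (F : nat -> 'M[C]_m) (W : 'M[C]_m) : F j @[j --> \oo] --> W -> mxseqlim F W.
Proof.
move=> h e e0; have N1 : 0 < (m * m)%:R + 1 :> R by rewrite ltr_wpDl.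
have [N hN] := cvg_entries h (divr_gt0 e0 N1); exists N => j /hN hj w.
apply: le_trans (l2norm_entries _ hj) _; apply: ler_wpM2r; first exact: l2norm_ge0.
by rewrite mulrA ler_pdivrMr//; lra.
Qed.

End matrix_topology.

Section boundary_values.
Context {R : realType}.
Local Notation C := R[i].
Local Notation normc := Normc.normc.
Local Open Scope sesquilinear_scope.
Variables (d : nat) (delta : ncpolymx R d) (I : finType) (g : 'I_d -> I) (c0 : I).
Hypothesis grp : grouping delta g.
Local Notation gcol := (gcol g).
Variable phi : graded_fun R d.
Hypothesis hphi : schur_class delta phi.

Lemma gcol_entry m (x : mxtuple R d m) c (e : R) : 0 <= e ->
  (forall i j, normc (x i j) <= e) -> forall i j, normc (gcol c x i j) <= e.
Proof.
move=> e0 h i j; rewrite mxE; case: ifP => _; last by rewrite mxE Normc.normc0.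
by rewrite mxE.
Qed.

Lemma cvg_gcol m (Z : nat -> mxtuple R d m) (T : mxtuple R d m) : Z j @[j --> \oo] --> T ->
  forall E : R, 0 < E -> exists N, forall j, (N <= j)%N -> forall c w,
     l2norm (gcol c (Z j - T) *m w) <= E * l2norm w.
Proof.
move=> h e e0; have N1 : 0 < (m * \sum_(r < d) m)%:R + 1 :> R by rewrite ltr_wpDl.
have [N hN] := cvg_entries h (divr_gt0 e0 N1); exists N => j /hN hj c w.
have {}hj := gcol_entry c (ltW (divr_gt0 e0 N1)) hj.
apply: le_trans (l2norm_entries _ hj) _; apply: ler_wpM2r; first exact: l2norm_ge0.
by rewrite mulrA ler_pdivrMr//; lra.
Qed.

Lemma julia_seq_of_quotient m (T : mxtuple R d m) Z (M : R) : approaches delta Z T ->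
    (forall j, julia_quotient delta phi (Z j) <= M) ->
  julia_seq g phi T Z (Num.max M 1) (fun j => 1 - opnorm (ncmx_eval delta (Z j)) ^+ 2).
Proof.
move=> [GZ cZ] hM.
have e0 j : 0 < 1 - opnorm (ncmx_eval delta (Z j)) ^+ 2.
  by rewrite subr_gt0 expr_lt1// ?opnorm_ge0//; case: (GZ j).
split => //.
- by move=> j; exact/(gball_Gdom grp).
- move=> j c w; rewrite mulrBl mul1r lerD2l lerN2.
  rewrite -!sqr_l2norm -exprMn ler_sqr ?nnegrE ?mulr_ge0 ?l2norm_ge0 ?opnorm_ge0//.
  exact: (grp_le grp).
- move=> j w.
  have -> : nsq w - nsq (phi (Z j) *m w) =
      rdot ((1%:M - (phi (Z j)) ^t* *m phi (Z j)) *m w) w.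
    by rewrite mulmxBl mul1mx rdotBl -mulmxA rdot_adjC.
  apply: le_trans (rdot_le _ _) _.
  apply: le_trans (ler_wpM2r (l2norm_ge0 w) (l2norm_opnorm _ w)) _.
  rewrite -[leLHS]mulrA -expr2 sqr_l2norm; apply: ler_wpM2r; first exact: nsq_ge0.
  have := hM j; rewrite /julia_quotient ler_pdivrMr// => /le_trans; apply.
  by apply: ler_wpM2r; [exact: ltW | rewrite le_max lexx].
- exact: cvg_gcol.
Qed.

Definition radial_path m (T : mxtuple R d m) (s : R) := phi ((1 - s ^+ 2 / 4)%:C *: T).

Let phi_int := schur_intertwine grp hphi.
Let phi_con := schur_contractive grp hphi.

(** Values of phi on the radius are all close to phi(Z j) for large j, hence
    close to each other. *)
Lemma radial_limit m (T : mxtuple R d m) Z (al : R) e : (0 < m)%N -> 0 < al ->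
  giso g T -> julia_seq g phi T Z al e -> exists W, mxlim0 (radial_path T) W.
Proof.
move=> m0 al0 iT Jz; apply: weak_lim0 => v w; apply: cauchy_lim0 => E E0.
have c1 : 0 < l2norm v * l2norm w + 1 by rewrite ltr_wpDl ?mulr_ge0 ?l2norm_ge0.
have [eta eta0 etaE] : exists2 eta : R, 0 < eta & eta * (l2norm v * l2norm w) <= E.
  exists (E / (l2norm v * l2norm w + 1)); first exact: divr_gt0.
  by rewrite mulrAC ler_pdivrMr// ler_pM2l//; lra.
have D0 : 0 < eta ^+ 2 / (4 * (1 + al)).
  by rewrite divr_gt0 ?exprn_gt0// mulr_gt0//; lra.
have key s s' : 0 < s < Num.min 1 (eta ^+ 2 / (4 * (1 + al))) ->
   0 < s' < Num.min 1 (eta ^+ 2 / (4 * (1 + al))) ->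
   l2norm ((radial_path T s - radial_path T s') *m v) <= eta * l2norm v.
  rewrite !lt_min => /and3P[s0 s1 sD] /and3P[s'0 s'1 s'D].
  have s01 : 0 < s < 1 by rewrite s0.
  have s'01 : 0 < s' < 1 by rewrite s'0.
  have [N hN] := radial_close c0 phi_int phi_con m0 iT Jz s01.
  have [N' hN'] := radial_close c0 phi_int phi_con m0 iT Jz s'01.
  have := hN _ (leq_maxl N N') v; have := hN' _ (leq_maxr N N') v.
  rewrite -/(radial_path T s) -/(radial_path T s').
  move: (radial_path T s) (radial_path T s') (phi (Z _)) => A B V.
  rewrite !mulmxBl; move: (A *m v) (B *m v) (V *m v) => a b x h2 h1.
  rewrite l2norm_le ?mulr_ge0 ?l2norm_ge0 ?(ltW eta0)// exprMn sqr_l2norm.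
  have := nsq_ge0 ((a - x) + (b - x)); rewrite nsqD => h3.
  have -> : a - b = (a - x) - (b - x) by rewrite opprB addrA subrK.
  rewrite nsqB.
  have h4 : (2 * (s + s') * (1 + al)) * nsq v <= eta ^+ 2 * nsq v.
    apply: ler_wpM2r; first exact: nsq_ge0.
    move: sD s'D; rewrite !ltr_pdivlMr; [|lra|lra].
    by move: (eta ^+ 2) => q; lra.
  by move: (nsq (a - x)) (nsq (b - x)) (rdot _ _) h1 h2 h3 h4 => *; lra.
exists (Num.min 1 (eta ^+ 2 / (4 * (1 + al)))); first by rewrite lt_min ltr01.
move=> s s' hs hs'; have hk := key s s' hs hs'.
rewrite -rdotBl -mulmxBl ler_norml; apply/andP.
have hE : l2norm ((radial_path T s - radial_path T s') *m v) * l2norm w <= E.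
  apply: le_trans etaE; rewrite mulrA; apply: ler_wpM2r => //; exact: l2norm_ge0.
split; last exact: le_trans (rdot_le _ _) hE.
by apply: le_trans (rdot_ge _ _); rewrite lerN2.
Qed.

Lemma radial_limit_seq m (T : mxtuple R d m) Z (al : R) e W : (0 < m)%N -> 0 < al ->
    giso g T -> julia_seq g phi T Z al e -> mxlim0 (radial_path T) W ->
  mxseqlim (fun j => phi (Z j)) W.
Proof.
move=> m0 al0 iT Jz hW E E0.
have E20 : 0 < E / 2 by lra.
have [D D0 hD] := hW _ E20.
have D10 : 0 < E ^+ 2 / (4 * (1 + al)).
  by rewrite divr_gt0 ?exprn_gt0// mulr_gt0//; lra.
have [s [s0 sD s1 sE]] : exists s : R, [/\ 0 < s, s < D, s < 1 & s < E ^+ 2 / (4 * (1 + al))].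
  exists (Num.min (Num.min D 1) (E ^+ 2 / (4 * (1 + al))) / 2).
  set q := Num.min _ _; have q0 : 0 < q by rewrite !lt_min D0 ltr01.
  have q2 : q / 2 < q by lra.
  by split; [lra | apply: lt_le_trans q2 _; rewrite !ge_min lexx ?orbT ..].
have s01 : 0 < s < 1 by rewrite s0.
have [N hN] := radial_close c0 phi_int phi_con m0 iT Jz s01.
exists N => j /hN hj v; have := hj v.
have : l2norm ((radial_path T s - W) *m v) <= E / 2 * l2norm v.
  by apply: hD; rewrite s0.
rewrite -/(radial_path T s); move: (radial_path T s) (phi (Z _)) => A V h1 h2.
have h3 : l2norm ((A - V) *m v) <= E / 2 * l2norm v.
  rewrite l2norm_le; last exact: mulr_ge0 (ltW E20) (l2norm_ge0 v).
  rewrite exprMn sqr_l2norm; apply: le_trans h2 _; apply: ler_wpM2r; first exact: nsq_ge0.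
  have p : 0 < 4 * (1 + al) by lra.
  by move: sE; rewrite ltr_pdivlMr// expr_div_n; lra.
have -> : (V - W) *m v = (A - W) *m v - (A - V) *m v.
  by rewrite -mulmxBl opprB (addrC (A - W)) addrA subrK.
apply: le_trans (l2normB _ _) _.
by move: (l2norm (_ *m v)) (l2norm (_ *m v)) h1 h3 => *; lra.
Qed.

Lemma mxseqlim_iso m (T : mxtuple R d m) Z (al : R) e W : (0 < m)%N -> 0 < al ->
    giso g T -> julia_seq g phi T Z al e -> mxseqlim (fun j => phi (Z j)) W ->
  forall w, nsq (W *m w) = nsq w.
Proof.
move=> m0 al0 iT Jz hW w.
have close E : 0 < E -> exists j, e j <= E /\ l2norm ((phi (Z j) - W) *m w) <= E * l2norm w.
  move=> E0; have [N hN] := hW E E0; have [N' hN'] := js_e_small c0 m0 iT Jz E0.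
  exists (maxn N N'); split; first exact: hN' (leq_maxr _ _).
  exact: hN (leq_maxl _ _) w.
have w0 := nsq_ge0 w.
suff : l2norm (W *m w) = l2norm w by rewrite -!sqr_l2norm => ->.
apply/eqP; rewrite eq_le; apply/andP; split; apply/ler_addgt0Pr => E E0.
  have c1 : 0 < l2norm w + 1 by rewrite ltr_wpDl ?l2norm_ge0.
  have [j [_ hj]] := close _ (divr_gt0 E0 c1).
  have hE : E / (l2norm w + 1) * l2norm w <= E.
    by rewrite mulrAC ler_pdivrMr// ler_pM2l//; lra.
  have -> : W *m w = phi (Z j) *m w - (phi (Z j) - W) *m w by rewrite mulmxBl subKr.
  apply: le_trans (l2normB _ _) _.
  have := phi_con_norm phi_con w (js_ball Jz j); lra.
have [->|wn] := eqVneq (l2norm w) 0; first by rewrite addr_ge0 ?l2norm_ge0 ?ltW.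
have wp : 0 < l2norm w by rewrite lt_neqAle eq_sym wn l2norm_ge0.
have p1 : 0 < (1 + al) * l2norm w by rewrite mulr_gt0//; lra.
have [j [hj1 hj2]] := close _ (divr_gt0 E0 p1).
set x := E / ((1 + al) * l2norm w) in hj1 hj2.
have xE : x * ((1 + al) * l2norm w) = E by rewrite /x divfK// gt_eqF.
have := js_phi Jz j w; rewrite -!sqr_l2norm => hp.
have a0 := l2norm_ge0 (phi (Z j) *m w).
have hp2 : l2norm w - l2norm (phi (Z j) *m w) <= al * x * l2norm w.
  have ej : al * e j * l2norm w ^+ 2 <= al * x * l2norm w ^+ 2.
    by apply: ler_wpM2r; [exact: sqr_ge0 | rewrite ler_pM2l].
  have hn := phi_con_norm phi_con w (js_ball Jz j).
  rewrite -(ler_pM2l wp); apply: le_trans (_ : _ <= l2norm w ^+ 2 - l2norm (phi (Z j) *m w) ^+ 2) _.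
    by have := ler_wpM2r a0 hn; move: (l2norm _) (l2norm _) => *; nra.
  by apply: le_trans hp _; apply: le_trans ej _; rewrite le_eqVlt; apply/orP; left; apply/eqP; ring.
have -> : W *m w = phi (Z j) *m w - (phi (Z j) - W) *m w by rewrite mulmxBl subKr.
have : l2norm (phi (Z j) *m w) <= l2norm (phi (Z j) *m w - (phi (Z j) - W) *m w)
     + l2norm ((phi (Z j) - W) *m w).
  by rewrite -[X in l2norm X <= _](subrK ((phi (Z j) - W) *m w)); exact: l2normD.
by move: (l2norm _) (l2norm _) (l2norm _) (l2norm _) hj2 hp2 xE => *; lra.
Qed.

Lemma iso_unitary m (W : 'M[C]_m) : (forall w, nsq (W *m w) = nsq w) -> W \is unitarymx.
Proof.
move=> iW; apply/unitarymxP; apply: mulmx1C; apply: mx_ext => v; apply: rdot_ext => u.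
have := nsqD (W *m v) (W *m u); rewrite -mulmxDr !iW nsqD => h.
rewrite mul1mx -mulmxA rdot_adjC; lra.
Qed.

(** The radial limit has the property from which the boundary value is chosen, so
    the chosen matrix has it too; it is then used for the given sequence. *)
Lemma boundary_value_julia_point m (T : mxtuple R d m) : (0 < m)%N -> Ibdry delta T ->
    Bpoint delta phi T ->
  exists al, julia_point g phi T (boundary_value delta phi T) al.
Proof.
move=> m0 [_ isoT] [_ [Z aZ cq]].
have iT : giso g T := grp_iso grp isoT.
have [M hM] : exists M : R, forall j, julia_quotient delta phi (Z j) <= M.
  have [M [_ hM]] := cvg_seq_bounded cq.
  exists (M + 1) => j; apply: le_trans (ler_norm _) _.
  by apply: (hM (M + 1)) => //; lra.
have Jz := julia_seq_of_quotient aZ hM.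
have al0 : 0 < Num.max M 1 by rewrite lt_max ltr01 orbT.
have [W hW] := radial_limit m0 al0 iT Jz.
have sW := radial_limit_seq m0 al0 iT Jz hW.
have uW := iso_unitary (mxseqlim_iso m0 al0 iT Jz sW).
pose P := [set W : 'M[C]_m | W \is unitarymx /\
    forall Z : nat -> mxtuple R d m, approaches delta Z T ->
      (exists M : R, forall j, julia_quotient delta phi (Z j) <= M) ->
      (fun j => phi (Z j)) @ \oo --> W].
have PW : P W.
  split=> // Z' aZ' [M' hM']; apply: mxseqlim_cvg.
  have al0' : 0 < Num.max M' 1 by rewrite lt_max ltr01 orbT.
  exact: (radial_limit_seq m0 al0' iT (julia_seq_of_quotient aZ' hM') hW).
have [uB hB] : P (boundary_value delta phi T) by exact: (xgetPex 0 (ex_intro _ W PW)).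
have sB := cvg_mxseqlim (hB Z aZ (ex_intro _ M hM)).
exists (Num.max M 1); split=> //.
  by exists Z, (fun j => 1 - opnorm (ncmx_eval delta (Z j)) ^+ 2).
split; first exact: mxseqlim_iso m0 al0 iT Jz sB.
by exists ((boundary_value delta phi T) ^t*); apply/unitarymxP.
Qed.

End boundary_values.

(** * Differentiability from a quadratic estimate *)

Section frechet_differentiability.
Context {R : realType}.
Local Notation C := R[i].
Local Notation normc := Normc.normc.

Lemma ge0_complex (z : C) : 0 <= z -> exists2 r : R, 0 <= r & z = r%:C.
Proof. by case: z => a b; rewrite lecE /= => /andP[/eqP -> a0]; exists a. Qed.

Lemma linear_mx_continuous m n p q (L : {linear 'M[C]_(m, n) -> 'M[C]_(p, q)}) :
  continuous L.
Proof.
apply/linear_bounded_continuous.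
exists (\sum_i \sum_j `|L (delta_mx i j)|); split.
  by apply: ger0_real; apply: sumr_ge0 => i _; apply: sumr_ge0 => j _.
move=> M hM; apply/nbhs_ballP; exists 1 => /=; first exact: ltr01.
move=> X; rewrite mx_norm_ball /ball_ /= sub0r normrN -(rmorph1 (real_complex R)).
move=> /mxnorm_lt[_ hX]; apply: le_trans (ltW hM).
rewrite {1}(matrix_sum_delta X) linear_sum; apply: le_trans (ler_norm_sum _ _ _) _.
apply: ler_sum => i _; rewrite linear_sum; apply: le_trans (ler_norm_sum _ _ _) _.
apply: ler_sum => j _; rewrite linearZ normrZ ler_piMl//.
by rewrite normC -(rmorph1 (real_complex R)) lecR ltW.
Qed.

(** The term ['d] is a choice among the continuous linear maps with error o(k); it
    suffices to exhibit one, and a quadratic error is o(k). *)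
Lemma quadratic_differentiable m n p (f : 'M[C]_(m, n) -> 'M[C]_p) (x : 'M[C]_(m, n))
    (df : 'M[C]_(m, n) -> 'M[C]_p) (B e0 : R) : 0 < B -> 0 < e0 ->
    (forall a y z, df (a *: y + z) = a *: df y + df z) ->
    (forall (e : R) y, 0 < e -> e <= e0 -> `|y| < e%:C ->
      forall v, l2norm ((f (x + y) - f x - df y) *m v) <= B * e ^+ 2 * l2norm v) ->
  differentiable f x.
Proof.
move=> B0 e00 lin hf.
pose L : {linear 'M[C]_(m, n) -> 'M[C]_p} := HB.pack df (GRing.isLinear.Build _ _ _ _ df lin).
have L0 : L 0 = 0 by exact: linear0.
suff : exists L : {linear 'M[C]_(m, n) -> 'M[C]_p}, continuous L /\ forall y,
    f y = f (lim (nbhs x)) + L (y - lim (nbhs x)) +o_(y \near (nbhs x)) (y - lim (nbhs x)).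
  by move=> /getPex h; apply/diffP.
exists L; split; first exact: linear_mx_continuous.
have lx : lim (nbhs x) = x by exact: lim_id.
have E : f = (fun y => f (lim (nbhs x)) + L (y - lim (nbhs x)))
   +o_ x (fun y => y - lim (nbhs x)).
  apply/eqaddoP => _ /gt0_complex[r r0 ->]; rewrite lx.
  pose D := Num.min (e0 / 2) (r / (8 * B)).
  have D0 : 0 < D by rewrite lt_min !divr_gt0 ?mulr_gt0.
  apply/nbhs_ballP; exists D%:C => /=; first by rewrite ltcR.
  move=> y; rewrite mx_norm_ball /ball_ /= distrC => xy.
  have [q q0 qE] := ge0_complex (normr_ge0 (y - x)).
  rewrite qE ltcR in xy; rewrite qE -rmorphM.
  have [q00|qn] := eqVneq q 0.
    have : y - x = 0 by apply/eqP; rewrite -normr_eq0 qE q00.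
    move=> /eqP; rewrite subr_eq0 => /eqP ->.
    have L0d : df 0 = 0 by exact: L0.
    by rewrite q00 mulr0 rmorph0 /= !fctE /= subrr L0d addr0 subrr normr0.
  have qp : 0 < q by rewrite lt_neqAle eq_sym qn.
  have [q1 q2] : q < e0 / 2 /\ q < r / (8 * B) by move: xy; rewrite lt_min => /andP.
  have q2' : q * (8 * B) < r by rewrite -ltr_pdivlMr// mulr_gt0.
  have q20 : 0 < 2 * q by rewrite mulr_gt0.
  have q2e : 2 * q <= e0 by lra.
  have yq : `|y - x| < (2 * q)%:C by rewrite qE ltcR; lra.
  have := hf (2 * q) (y - x) q20 q2e yq; rewrite (addrC x) subrK => hv.
  have hv2 : 0 < 8 * B * q ^+ 2 by rewrite !mulr_gt0// exprn_gt0.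
  apply: le_trans (_ : _ <= (8 * B * q ^+ 2)%:C) _.
    apply: ltW; apply/mxnorm_lt; split=> // i j.
    have -> : ((f - (fun y0 => f x + L (y0 - x))) y) = f y - f x - df (y - x).
      by rewrite !fctE /= opprD addrA.
    apply: le_lt_trans (normc_le_bound i j hv) _.
    have := mulr_gt0 B0 (exprn_gt0 2 qp); rewrite exprMn; lra.
  rewrite lecR expr2 mulrA; apply: ler_wpM2r => //; lra.
move=> y; exact: (congr1 (fun h => h y) E).
Qed.

End frechet_differentiability.

(** * Assembly *)

Section assembly.
Context {R : realType}.
Local Notation C := R[i].
Local Notation normc := Normc.normc.
Variables (d : nat) (delta : ncpolymx R d) (I : finType) (g : 'I_d -> I) (c0 : I).
Hypothesis grp : grouping delta g.
Local Notation gcol := (gcol g).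
Variable phi : graded_fun R d.
Hypothesis hphi : schur_class delta phi.
Variables (n : nat) (T : mxtuple R d n).
Hypotheses (hT : Ibdry delta T) (hB : Bpoint delta phi T).
Local Notation W := (boundary_value delta phi T).

Lemma Ibdry_level : (0 < n)%N.
Proof.
case: hT => -[clT _] _; have [x [[n0 _] _]] := clT setT (@filterT _ (nbhs T) _).
exact: n0.
Qed.

Lemma Ibdry_giso : giso g T.
Proof. by case: hT => _; exact: (grp_iso grp). Qed.

Lemma ball_gbounded : exists2 N : R, 0 < N & forall (X : mxtuple R d n) (e : R),
  0 < e -> `|X| < e%:C -> gbounded g (N * e) X.
Proof.
have N0 : 0 < (n * \sum_(r < d) n)%:R + 1 :> R by rewrite ltr_wpDl.
exists ((n * \sum_(r < d) n)%:R + 1) => // X e e0 /mxnorm_lt[_ hX].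
apply/gboundedP; first by rewrite mulr_ge0 ?ltW.
move=> c v; have hX' i j : normc (X i j) <= e by exact: ltW.
apply: le_trans (l2norm_entries _ (gcol_entry g c (ltW e0) hX')) _.
apply: ler_wpM2r; first exact: l2norm_ge0.
by rewrite ler_pM2r//; lra.
Qed.

(** If T + t H is in the domain for one t > 0 then expanding |T v + t H v|^2 gives
    the strict inequality; conversely it dominates the term t^2 |H v|^2 for small
    t. *)
Lemma directionsP (H : mxtuple R d n) :
  directions delta T H <-> exists2 lam : R, 0 < lam & inward g T lam H.
Proof.
split=> [hH|[lam l0 cH]].
  have [t [t0 /(gball_Gdom grp)[_ [k k1 hk]]]] : exists t : R, 0 < t /\ Gdom delta (T + t%:C *: H).
    have [t [h1 h2]] := filter_ex (filterI (nbhs_right_gt (0 : R)) hH).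
    by exists t.
  exists ((1 - k) / (2 * t)); first by rewrite divr_gt0 ?subr_gt0// mulr_gt0.
  move=> c v; have := hk c v; rewrite gcolD gcolZ mulmxDl -scalemxAl nsqD nsqZR.
  rewrite Ibdry_giso rdotZr rdotC => hkv; rewrite mulrAC ler_pdivrMr ?mulr_gt0//.
  move: hkv; have : 0 <= t ^+ 2 * nsq (gcol c H *m v) by rewrite mulr_ge0 ?sqr_ge0 ?nsq_ge0.
  move: (rdot _ _) (nsq v) (t ^+ 2 * _) => *; lra.
have [h h0 bH] := gbounded_ex g H; have h1 : 0 < h + 1 by lra.
have bH' : gbounded g (h + 1) H by apply: gbounded_le bH; lra.
have D0 : 0 < lam / (h + 1) ^+ 2 by rewrite divr_gt0 ?exprn_gt0.
rewrite /directions /=; near=> t.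
have t0 : 0 < t by near: t; exact: nbhs_right_gt.
have tD : t < lam / (h + 1) ^+ 2 by near: t; exact: nbhs_right_lt.
apply/(gball_Gdom grp); apply: (gball_inward Ibdry_level Ibdry_giso l0 cH bH' t0).
by move: tD; rewrite ltr_pdivlMr ?exprn_gt0// => /ltW.
Unshelve. all: by end_near. Qed.

Lemma directions_open : open (directions delta T).
Proof.
rewrite openE => H /directionsP[lam l0 cH].
have [N N0 hN] := ball_gbounded.
have e0 : 0 < lam / (2 * N) by rewrite divr_gt0 ?mulr_gt0.
apply/nbhs_ballP; exists (lam / (2 * N))%:C => /=; first by rewrite ltcR.
move=> H'; rewrite mx_norm_ball /ball_ /= distrC => /(hN _ _ e0).
have -> : N * (lam / (2 * N)) = lam / 2 by field; rewrite gt_eqF.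
move=> bK; apply/directionsP; exists (lam / 2); first by rewrite divr_gt0.
have l20 : 0 <= lam / 2 by rewrite divr_ge0// ltW.
have := inward_add Ibdry_giso l20 cH bK; rewrite [H + _]addrC subrK.
by apply: inward_le; lra.
Qed.

Theorem directional_derivative_of_grouping :
  exists eta : mxtuple R d n -> 'M[C]_n,
    [/\ forall H : mxtuple R d n, directions delta T H ->
          (fun t : R => (t^-1)%:C *: (phi (T + t%:C *: H) - W)) @ (0 : R)^'+ --> eta H,
        holomorphic_on (directions delta T) eta
      & forall (z : C) (H : mxtuple R d n),
          directions delta T H -> directions delta T (z *: H) ->
          eta (z *: H) = z *: eta H].
Proof.
have [al J] := boundary_value_julia_point c0 grp hphi Ibdry_level hT hB.
have phi_int := schur_intertwine grp hphi.
have phi_con := schur_contractive grp hphi.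
pose eta (H : mxtuple R d n) : 'M[C]_n :=
  xget 0 [set L | mxlim0 (fun t => diff_quot phi T W t H) L].
have eta_lim : forall (H : mxtuple R d n) (lam : R), 0 < lam -> inward g T lam H ->
    mxlim0 (fun t => diff_quot phi T W t H) (eta H).
  move=> H lam l0 cH; have [L hL] := dirderiv_exists c0 phi_int phi_con J l0 cH.
  exact: (xgetPex 0 (ex_intro _ L hL)).
exists eta; split.
- move=> H /directionsP[lam l0 cH]; exact: mxlim0_cvg (eta_lim H lam l0 cH).
- split; first exact: directions_open.
  move=> H /directionsP[lam l0 cH].
  have [B B0 hBd] := frechet_eta c0 phi_int phi_con J eta_lim l0 cH.
  have [N N0 hN] := ball_gbounded.
  apply: (@quadratic_differentiable _ _ _ _ _ _ (ddiff eta H) (B * N ^+ 2) (lam / (4 * N))).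
  + by rewrite mulr_gt0// exprn_gt0.
  + by rewrite divr_gt0// mulr_gt0.
  + move=> a K K'.
    rewrite (ddiffD c0 phi_int phi_con J eta_lim l0 cH).
    by rewrite (ddiffZ c0 phi_int phi_con J eta_lim l0 cH).
  + move=> e K e0 ee hK v.
    have Ne0 : 0 < N * e by rewrite mulr_gt0.
    have Nel : N * e <= lam / 4.
      by move: ee; rewrite ler_pdivlMr ?mulr_gt0//; lra.
    have := hBd (N * e) K Ne0 Nel (hN K e e0 hK) v.
    by rewrite exprMn mulrA.
- move=> z H /directionsP[l1 l10 c1] /directionsP[l2 l20 c2].
  have l0 : 0 < Num.min l1 l2 by rewrite lt_min l10.
  apply: (eta_homogeneous c0 phi_int phi_con J eta_lim l0).
    by apply: inward_le c1; rewrite ge_min lexx.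
  by apply: inward_le c2; rewrite ge_min lexx orbT.
Qed.

End assembly.

(** Without coordinates the domain is everything and has no boundary. *)
Lemma Ibdry_polydisk0 (R : realType) n (T : mxtuple R 0 n) : ~ Ibdry (polydisk R 0) T.
Proof.
case=> -[clT niT] _; have [x [[n0 _] _]] := clT setT (@filterT _ (nbhs T) _).
apply: niT; rewrite /interior.
have -> : @Gdom R 0 (polydisk R 0) n = setT; last exact: filterT.
apply/seteqP; split=> // y _.
apply/(gball_Gdom (grouping_polydisk 0)); split=> //.
by exists 0 => //; case.
Qed.

Theorem theorem1p11 (R : realType) (d : nat) (delta : ncpolymx R d)
    (hdelta : delta = polydisk R d \/ delta = column_ball R d)
    (phi : graded_fun R d) (hphi : schur_class delta phi)
    (n : nat) (T : mxtuple R d n)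
    (hT : Ibdry delta T) (hB : Bpoint delta phi T) :
  exists eta : mxtuple R d n -> 'M[R[i]]_n,
    [/\ forall H : mxtuple R d n, directions delta T H ->
          (fun t : R => (t^-1)%:C *:
             (phi n (T + t%:C *: H) - boundary_value delta phi T))
            @ (0 : R)^'+ --> eta H,
        holomorphic_on (directions delta T) eta
      & forall (z : R[i]) (H : mxtuple R d n),
          directions delta T H -> directions delta T (z *: H) ->
          eta (z *: H) = z *: eta H].
Proof.
case: hdelta => hd; rewrite hd in hphi hT hB *.
- case: d phi hphi T hT hB {delta hd} => [|d'] phi hphi T hT hB.
    by case: (Ibdry_polydisk0 hT).
  exact: (directional_derivative_of_grouping ord0 (grouping_polydisk d'.+1) hphi hT hB).
- exact: (directional_derivative_of_grouping tt (grouping_column_ball d) hphi hT hB).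
Qed.
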